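(* Let $(\Sigma,m)$ be a weighted simplicial complex with locally summable weight, let $\circ\in\{+,-,H\}$, and let $d^\circ$ be an intrinsic metric for $b^\circ$ over $(\Sigma,m)$ with finite jump size $s>0$. Let $\lambda_2^\circ=\inf\sigma(\Delta_2^\circ)$. For all $\omega,\eta\in\ell^2(\Sigma,m)$, with $A=\mathrm{supp}\,\omega$, $B=\mathrm{supp}\,\eta$, and all $t>0$, one has $$|\langle e^{-t\Delta_2^\circ}\omega,\eta\rangle|\le\exp\left(-\lambda_2^\circ t-\frac t{s^2}\zeta\left(\frac{s\,d^\circ(A,B)}t\right)\right)\|\omega\|_2\|\eta\|_2 ,$$ where $\zeta(r)=r\,\mathrm{arcsinh}(r)-\sqrt{1+r^2}+1$ for $r\ge0$. In particular, the kernel $p_t^\circ$ of $e^{-t\Delta_2^\circ}$ satisfies for all $\sigma,\tau\in\Sigma$ $$|p_t^\circ(\sigma,\tau)|\le(m(\sigma)m(\tau))^{-1/2}\exp\left(-\lambda_2^\circ t-\frac t{s^2}\zeta\left(\frac{s\,d^\circ(\sigma,\tau)}t\right)\right).$$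
   Context: Simplicial complex: a family $\hat\Sigma$ of finite subsets of a countable set $V$, closed under taking subsets; $\hat\Sigma_k$ are its elements of cardinality $k+1$ (dimension $k$). Given $m:\hat\Sigma\to(0,\infty)$, put $\Sigma=\hat\Sigma$ if $\sum_{v\in\hat\Sigma_0}m(v)<\infty$ and $\Sigma=\hat\Sigma\setminus\{\varnothing\}$ otherwise; $(\Sigma,m)$ is a weighted simplicial complex. Write $\tau\prec\sigma$ if $\tau\subset\sigma$, $|\sigma\setminus\tau|=1$, $\tau,\sigma\in\Sigma$. Local summability: $\gamma(\tau)=\sum_{\sigma\succ\tau}m(\sigma)<\infty$ for all $\tau\in\Sigma$. $C(\Sigma)$, $C_c(\Sigma)$: complex functions, resp. finitely supported ones; $\ell^p=\ell^p(\Sigma,m)$, $\langle\omega,\eta\rangle=\sum_\Sigma m\omega\overline\eta$. A coboundary operator is fixed: $\delta\omega(\sigma)=\sum_{\tau\prec\sigma}\theta(\tau,\sigma)\omega(\tau)$ with $\theta(\tau,\sigma)\in\{\pm1\}$ for $\tau\prec\sigma$, such that $\delta\delta=0$. Boundary operator: $\partial\omega(\rho)=\frac1{m(\rho)}\sum_{\tau\succ\rho}m(\tau)\omega(\tau)\theta(\rho,\tau)$ (where absolutely convergent for all $\rho$). The forms $Q^+(\omega)=\|\delta\omega\|_2^2$, $Q^-(\omega)=\|\partial\omega\|_2^2$, $Q^H(\omega)=\|\delta\omega+\partial\omega\|_2^2$ on $C_c(\Sigma)$ are closable in $\ell^2$; $\Delta_2^\circ$ is the positive self-adjoint operator associated with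 the closure of $Q^\circ$. The kernel is $p^\circ_t(\sigma,\tau)=\langle e^{-t\Delta_2^\circ}1_\sigma,1_\tau\rangle/(m(\sigma)m(\tau))$. The graph $b^\circ$ over $(\Sigma,m)$ is the edge weight in the representation of $Q^\circ$ on $C_c(\Sigma)$ as a signed Schrödinger form: $b^\circ(\tau,\tau')=|Q^\circ(1_{\tau'},1_\tau)|$ for $\tau\ne\tau'$ and $b^\circ(\tau,\tau)=0$ (with $Q^\circ(\cdot,\cdot)$ the sesquilinear form of $Q^\circ$). An intrinsic metric for $b^\circ$ is a pseudo metric $d^\circ$ on $\Sigma$ with $\frac1{m(\tau)}\sum_{\tau'}b^\circ(\tau,\tau')d^\circ(\tau,\tau')^2\le1$ for all $\tau$; its jump size is $s=\sup\{d^\circ(\tau,\tau'):b^\circ(\tau,\tau')>0\}$. $d^\circ(A,B)=\inf_{A\times B}d^\circ$. *)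

(* Defs.v *)
From HB Require Import structures.
From mathcomp Require Import all_boot all_order all_algebra.
From mathcomp Require Import finmap.
From mathcomp Require Import all_classical all_reals all_analysis.
From mathcomp Require Import complex.

Set Implicit Arguments.
Unset Strict Implicit.
Unset Printing Implicit Defensive.

Import Order.TTheory GRing.Theory Num.Theory.
Import numFieldNormedType.Exports.

Local Open Scope classical_set_scope.
Local Open Scope ring_scope.
Local Open Scope complex_scope.

(* The family of faces may contain the empty simplex. Only the values of the
   weight on faces are meaningful. *)
Record weighted_complex (V : countType) (R : realType) := WeightedComplex {
  face : set {fset V};
  weight : {fset V} -> R;
  face_closed : forall s t : {fset V}, face s -> (t `<=` s)%fset -> face t;
  weight_gt0 : forall s : {fset V}, face s -> 0 < weight s }.

Section Complexes.
Context {V : countType} {R : realType}.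
Variable X : weighted_complex V R.

(* The empty simplex is kept exactly when the total vertex weight is finite. *)
Definition Sigma : set {fset V} :=
  [set s | face X s /\ (s = fset0 ->
     (\esum_(v in [set v | face X v /\ #|` v| = 1%N]) (weight X v)%:E < +oo)%E)].

Definition simplex : choiceType := set_type Sigma.

Definition cochain := simplex -> R[i].

Definition mass (s : simplex) : R := weight X (val s).

Definition facet (t s : simplex) : Prop :=
  (val t `<=` val s)%fset /\ #|` (val s `\` val t)%fset| = 1%N.

Definition locally_summable : Prop :=
  forall t, (\esum_(s in [set s | facet t s]) (mass s)%:E < +oo)%E.

(* Meaningful for absolutely summable families only. *)
Definition rsum (A : set simplex) (f : simplex -> R) : R :=
  fine (\esum_(s in A) (Num.max (f s) 0)%:E) -
  fine (\esum_(s in A) (Num.max (- f s) 0)%:E).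

Definition csum (A : set simplex) (f : cochain) : R[i] :=
  rsum A (fun s => complex.Re (f s)) +i* rsum A (fun s => complex.Im (f s)).

Definition inner (f g : cochain) : R[i] :=
  csum [set: simplex] (fun s => (mass s)%:C * f s * (g s)^*).

Definition norm2_sqr (f : cochain) : \bar R :=
  \esum_(s in [set: simplex]) (mass s * Normc.normc (f s) ^+ 2)%:E.

Definition l2 (f : cochain) : Prop := (norm2_sqr f < +oo)%E.

Definition norm2 (f : cochain) : R := Num.sqrt (fine (norm2_sqr f)).

Definition supp (f : cochain) : set simplex := [set s | f s != 0].

Definition finitely_supported (f : cochain) : Prop := finite_set (supp f).

Definition delta1 (s : simplex) : cochain := fun t => (t == s)%:R.

Definition coboundary (theta : simplex -> simplex -> R) (f : cochain) : cochain :=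
  fun s => \sum_(t \in [set t | facet t s]) ((theta t s)%:C * f t).

Definition boundary (theta : simplex -> simplex -> R) (f : cochain) : cochain :=
  fun r => ((mass r)^-1)%:C *
    csum [set t | facet r t] (fun t => (mass t)%:C * f t * (theta r t)%:C).

Definition coboundary_signs (theta : simplex -> simplex -> R) : Prop :=
  (forall t s, facet t s -> theta t s = 1 \/ theta t s = -1) /\
  (forall f s, coboundary theta (coboundary theta f) s = 0).

Definition form := cochain -> cochain -> R[i].

(* Unbounded operators are represented by their graphs. *)
Definition operator := cochain -> cochain -> Prop.

Definition form_approx (Q : form) (u : nat -> cochain) (f : cochain) : Prop :=
  [/\ forall n, finitely_supported (u n),
      (fun n => norm2 (u n \- f)) @ \oo --> (0 : R)
    & forall e : R, 0 < e -> exists N : nat, forall n k, (N <= n)%N -> (N <= k)%N ->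
        Normc.normc (Q (u n \- u k) (u n \- u k)) < e].

(* Domain of the closure of the form Q on finitely supported cochains, and the
   graph of that closure (single-valued when Q is closable). *)
Definition closure_dom (Q : form) (f : cochain) : Prop :=
  l2 f /\ exists u, form_approx Q u f.

Definition closure_form (Q : form) (f g : cochain) (c : R[i]) : Prop :=
  exists u v, [/\ form_approx Q u f, form_approx Q v g
    & (fun n => Normc.normc (Q (u n) (v n) - c)) @ \oo --> (0 : R)].

Definition associated_operator (Q : form) : operator := fun f g =>
  [/\ closure_dom Q f, l2 g
    & forall h, closure_dom Q h -> closure_form Q f h (inner g h)].

Definition resolvent_set (D : operator) : set R[i] :=
  [set z | exists (S : cochain -> cochain) (C : R),
     (forall h, l2 h ->
        [/\ l2 (S h), norm2 (S h) <= C * norm2 h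
          & D (S h) (fun s => h s + z * S h s)]) /\
     (forall f g, D f g -> S (fun s => g s - z * f s) = f)].

Definition spectrum (D : operator) : set R[i] := ~` resolvent_set D.

Definition spectrum_inf (D : operator) : R := inf [set x : R | spectrum D x%:C].

(* The maps E A matter only on l2 and for Borel sets A. Multiplicativity
   E (A `&` B) = E A \o E B and E set0 = 0 follow from these axioms. *)
Definition projection_valued_measure (E : set R -> cochain -> cochain) : Prop :=
  [/\ forall A, measurable A ->
        [/\ forall f, l2 f -> l2 (E A f),
            forall (a : R[i]) f g, l2 f -> l2 g ->
              E A (fun s => a * f s + g s) = (fun s => a * E A f s + E A g s),
            forall f, l2 f -> E A (E A f) = E A f
          & forall f g, l2 f -> l2 g -> inner (E A f) g = inner f (E A g)],
      forall f, l2 f -> E [set: R] f = f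
    & forall F : nat -> set R, (forall n, measurable (F n)) -> trivIset setT F ->
        forall f, l2 f ->
          (fun n => norm2 (fun s => (\sum_(0 <= i < n) E (F i) f s) -
                                    E (\bigcup_i F i) f s)) @ \oo --> (0 : R)].

(* A |-> <E A f, f>; it is a finite Borel measure for f in l2. *)
Definition spectral_measure (E : set R -> cochain -> cochain) (f : cochain) :
    set R -> \bar R :=
  fun A => (complex.Re (inner (E A f) f))%:E.

(* D is the functional calculus operator \int phi dE: its domain is
   {f | \int phi^2 d<E f, f> < oo}, where <D f, f> = \int phi d<E f, f>; by
   polarization and density this determines D. *)
Definition spectral_integral (E : set R -> cochain -> cochain) (phi : R -> R)
    (D : operator) : Prop :=
  [/\ forall (a : R[i]) f f' g g', D f g -> D f' g' ->
        D (fun s => a * f s + f' s) (fun s => a * g s + g' s),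
      forall f, (exists g, D f g) <->
        l2 f /\ (\int[spectral_measure E f]_(x in [set: R]) (phi x ^+ 2)%:E < +oo)%E
    & forall f g, D f g -> l2 g /\
        inner g f = (fine (\int[spectral_measure E f]_(x in [set: R]) (phi x)%:E))%:C].

Definition bounded_operator (T : cochain -> cochain) : operator :=
  fun f g => l2 f /\ g = T f.

(* T t = exp (- t D) for t > 0, in the sense of the spectral theorem *)
Definition heat_semigroup (D : operator) (T : R -> cochain -> cochain) : Prop :=
  exists E, [/\ projection_valued_measure E,
      spectral_integral E (fun x => x) D
    & forall t, 0 < t ->
        spectral_integral E (fun x => expR (- t * x)) (bounded_operator (T t))].

Definition heat_kernel (T : R -> cochain -> cochain) (t : R) (s r : simplex) : R[i] :=
  inner (T t (delta1 s)) (delta1 r) / (mass s * mass r)%:C.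

Definition edge_weight (Q : form) (t t' : simplex) : R :=
  if t == t' then 0 else Normc.normc (Q (delta1 t') (delta1 t)).

Definition pseudo_metric (d : simplex -> simplex -> R) : Prop :=
  [/\ forall x y, 0 <= d x y, forall x, d x x = 0, forall x y, d x y = d y x
    & forall x y z, d x z <= d x y + d y z].

Definition intrinsic_metric (b d : simplex -> simplex -> R) : Prop :=
  pseudo_metric d /\
  forall t, (((mass t)^-1)%:E *
             (\esum_(t' in [set: simplex]) (b t t' * d t t' ^+ 2)%:E) <= 1)%E.

Definition jump_size (b d : simplex -> simplex -> R) : \bar R :=
  ereal_sup [set x | exists t t', 0 < b t t' /\ x = (d t t')%:E].

(* The infimum over the empty set is 0 here, where the mathematical convention
   is +oo; A or B is empty only if one of the cochains vanishes. *)
Definition set_dist (d : simplex -> simplex -> R) (A B : set simplex) : R :=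
  inf [set x | exists a b, [/\ A a, B b & x = d a b]].

End Complexes.

Inductive laplacian_kind := Up | Down | Hodge.

Section Laplacians.
Context {V : countType} {R : realType} {X : weighted_complex V R}.

Definition energy (theta : simplex X -> simplex X -> R) (o : laplacian_kind) : form X :=
  fun f g => match o with
  | Up => inner (coboundary theta f) (coboundary theta g)
  | Down => inner (boundary theta f) (boundary theta g)
  | Hodge => inner (coboundary theta f \+ boundary theta f)
                   (coboundary theta g \+ boundary theta g)
  end.

Definition laplacian (theta : simplex X -> simplex X -> R) (o : laplacian_kind) :
  operator X := associated_operator (energy theta o).

End Laplacians.

Definition arcsinh {R : realType} (r : R) : R := ln (r + Num.sqrt (1 + r ^+ 2)).

Definition zeta {R : realType} (r : R) : R :=
  r * arcsinh r - Num.sqrt (1 + r ^+ 2) + 1.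

(* Main.v *)
(** Davies' method. Let [Q] be the closed form, [lambda] the bottom of the
    spectrum of its operator [D], [u_t = exp (- t D) f] and [phi = exp psi],
    where [psi] is [k] times the distance to the support of [f], truncated at
    the distance [r] between the two supports. Symmetrising the matrix of [Q]
    gives
      [Re Q(u, phi^2 u) >= Q(phi u) - (cosh (k s) - 1) / s^2 ||phi u||^2],
    so [||phi u_t||] grows at most like
    [exp ((- lambda + (cosh (k s) - 1) / s^2) t)]; pairing with [phi^-1 g]
    yields an additional factor [exp (- k r)], and [k = arcsinh (s r / t) / s]
    is optimal.

    - The function [phi^2 u] lies in the form domain by the localization
      identity: if [phi^2 + chi^2 = 1], then [Q(phi f) + Q(chi f) - Q(f)] is
      bounded by a multiple of [||f||^2]. This uses only the matrix of [Q], and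
      so covers the Hodge form, whose edge weights may vanish by cancellation.
    - [Q >= lambda] because a real [a] of the resolvent set with [Q >= a]
      satisfies [Q >= a + 1 / C], where [C] bounds the resolvent at [a].
    - The evolution equation is applied to [sum_k exp (- t k e) E(I_k) f] for
      a partition of the half-line into cells [I_k] of length [e]: it is a
      finite sum of exponentials on which [D] acts as multiplication by [k e]
      up to [e], and it converges weakly to [exp (- t D) f]. *)
Require Import Defs.
From HB Require Import structures.
From mathcomp Require Import all_boot all_order all_algebra.
From mathcomp Require Import finmap.
From mathcomp Require Import all_classical all_reals all_analysis.
From mathcomp Require Import complex.
From mathcomp Require Import measurable_realfun.
From mathcomp Require Import ring lra.

Set Implicit Arguments.
Unset Strict Implicit.
Unset Printing Implicit Defensive.

Import Order.TTheory GRing.Theory Num.Theory.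
Import numFieldNormedType.Exports.

Local Open Scope classical_set_scope.
Local Open Scope ring_scope.

(** * Absolutely summable families *)

Section RealSums.
Context {V : countType} {R : realType} {X : weighted_complex V R}.
Implicit Types (A : set (simplex X)) (h g k : simplex X -> R).

(** The hypotheses describe [D] and [exp (- t D)] only through quadratic forms: [<D f, f>] and
    [<T t f, f>] are integrals against [<E f, f>], with no formula for [||D f||] and no commutation
    of [E] with [D]. This shapes the spectral part: that [D] is close to a scalar on a cell
    ([op_piece]) and that the discretized semigroup converges to [T t] ([approx_cvg]) both come by
    polarization from statements about scalar measures. Weak convergence suffices because the
    estimate bounds a pairing with a fixed [g]; and the weighted norm of a finite sum of
    exponentials is an explicit function of a real variable, so no vector-valued derivative occurs.
    The three Laplacians share the shape [Q(f, g) = <L f, L g>], where the point evaluations of [L]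
    are continuous for the [l2] norm; this yields closability. The argument runs in the real Hilbert
    space of [rip], the real part of the inner product, and a unimodular factor restores the modulus
    at the end. *)

Definition abs_summable A h : Prop := (\esum_(s in A) `|h s|%:E < +oo)%E.

Lemma abs_summable_le A h g :
  (forall s, A s -> `|h s| <= g s) -> abs_summable A g -> abs_summable A h.
Proof.
move=> hg; apply: le_lt_trans; apply: le_esum => s As.
by rewrite lee_fin (le_trans (hg _ As)) ?ler_norm.
Qed.

Lemma le_esum_bound A g (M : \bar R) :
  (forall F, finite_set F -> F `<=` A -> ((\sum_(s <- fset_set F) g s)%:E <= M)%E) ->
  (\esum_(s in A) (g s)%:E <= M)%E.
Proof.
move=> gM; apply: ge_ereal_sup => _ [F [finF FA] <-].
by rewrite fsbig_finite//= sumEFin; exact: gM.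
Qed.

Lemma esum_ge_finite A g (F : set (simplex X)) : finite_set F -> F `<=` A ->
  ((\sum_(s <- fset_set F) g s)%:E <= \esum_(s in A) (g s)%:E)%E.
Proof.
move=> finF FA; apply: esum_ge; exists F => //.
by rewrite fsbig_finite//= sumEFin.
Qed.

Lemma esum_fin_num A g : (forall s, 0 <= g s) ->
  (\esum_(s in A) (g s)%:E < +oo)%E -> (\esum_(s in A) (g s)%:E)%E \is a fin_num.
Proof.
move=> g0 gf; rewrite ge0_fin_numE //.
by apply: esum_ge0 => s _; rewrite lee_fin.
Qed.

Lemma abs_summableE A g : (forall s, 0 <= g s) ->
  abs_summable A g = (\esum_(s in A) (g s)%:E < +oo)%E.
Proof.
move=> g0; rewrite /abs_summable.
by under eq_esum do rewrite ger0_norm//.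
Qed.

Lemma abs_summableD A h g : abs_summable A h -> abs_summable A g ->
  abs_summable A (fun s => h s + g s).
Proof.
move=> hh hg; apply: (@abs_summable_le _ _ (fun s => `|h s| + `|g s|)).
  by move=> s _; exact: ler_normD.
rewrite abs_summableE; last by move=> s; rewrite addr_ge0.
under eq_esum do rewrite EFinD.
rewrite esumD; [|by move=> s _; rewrite lee_fin..].
by rewrite lte_add_pinfty.
Qed.

Lemma abs_summableZ A h (a : R) : abs_summable A h ->
  abs_summable A (fun s => a * h s).
Proof.
move=> hh; rewrite /abs_summable.
have fin := esum_fin_num (fun s => normr_ge0 (h s)) hh.
apply: (@le_lt_trans _ _ (`|a|%:E * (\esum_(s in A) `|h s|%:E))%E); last first.
  by rewrite -(fineK fin) -EFinM ltry.
apply: le_esum_bound => F finF FA.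
under eq_bigr do rewrite normrM.
by rewrite -mulr_sumr EFinM lee_wpmul2l ?lee_fin// esum_ge_finite.
Qed.

(** The positive and negative parts [p], [n] of [h] are dominated by [g] and [k], hence summable,
    and summing both sides of [p + k = g + n] compares the two decompositions. Additivity of [rsum]
    rests on this freedom of decomposition. *)
Lemma rsum_diff A h g k : (forall s, A s -> h s = g s - k s) ->
  (forall s, 0 <= g s) -> (forall s, 0 <= k s) ->
  (\esum_(s in A) (g s)%:E < +oo)%E -> (\esum_(s in A) (k s)%:E < +oo)%E ->
  rsum A h = fine (\esum_(s in A) (g s)%:E) - fine (\esum_(s in A) (k s)%:E).
Proof.
move=> hgk g0 k0 gf kf; rewrite /rsum.
pose p s := Num.max (h s) 0; pose n s := Num.max (- h s) 0.
have p0 s : 0 <= p s by rewrite le_max lexx orbT.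
have n0 s : 0 <= n s by rewrite le_max lexx orbT.
have pf : (\esum_(s in A) (p s)%:E < +oo)%E.
  apply: le_lt_trans gf; apply: le_esum => s As.
  by rewrite lee_fin ge_max g0 andbT hgk// lerBlDr lerDl.
have nf : (\esum_(s in A) (n s)%:E < +oo)%E.
  apply: le_lt_trans kf; apply: le_esum => s As.
  by rewrite lee_fin ge_max k0 andbT hgk// opprB lerBlDr lerDl.
have pn s : p s - n s = h s.
  rewrite /p /n; case: (leP 0 (h s)) => h0.
  - by rewrite max_r ?oppr_le0// subr0.
  - by rewrite max_l ?oppr_ge0 ?ltW// sub0r opprK.
have E : (\esum_(s in A) (p s)%:E + \esum_(s in A) (k s)%:E =
    \esum_(s in A) (g s)%:E + \esum_(s in A) (n s)%:E)%E.
  rewrite -!esumD; try by move=> s _; rewrite lee_fin.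
  apply: eq_esum => s As; rewrite -!EFinD; congr (_ %:E).
  by have := hgk _ As; have := pn s; lra.
have := congr1 fine E.
rewrite !fineD ?esum_fin_num// -/p -/n; lra.
Qed.

Lemma abs_summable_pos A h : abs_summable A h ->
  (\esum_(s in A) (Num.max (h s) 0)%:E < +oo)%E.
Proof.
apply: le_lt_trans; apply: le_esum => s _.
by rewrite lee_fin ge_max normr_ge0 andbT ler_norm.
Qed.

Lemma abs_summableN A h : abs_summable A h -> abs_summable A (fun s => - h s).
Proof. by rewrite /abs_summable; under eq_esum do rewrite -normrN. Qed.

Lemma max0_ge0 (x : R) : 0 <= Num.max x 0.
Proof. by rewrite le_max lexx orbT. Qed.

Lemma max0_split (x : R) : x = Num.max x 0 - Num.max (- x) 0.
Proof.
case: (leP 0 x) => x0.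
- by rewrite max_r ?oppr_le0// subr0.
- by rewrite max_l ?oppr_ge0 ?ltW// sub0r opprK.
Qed.

Lemma eq_rsum A h g : (forall s, A s -> h s = g s) -> rsum A h = rsum A g.
Proof.
move=> hg; rewrite /rsum.
by congr (fine _ - fine _); apply: eq_esum => s As; rewrite hg.
Qed.

Lemma rsumD A h g : abs_summable A h -> abs_summable A g ->
  rsum A (fun s => h s + g s) = rsum A h + rsum A g.
Proof.
move=> hh hg.
have pf h' : abs_summable A h' -> _ := @abs_summable_pos A h'.
have hN := abs_summableN hh; have gN := abs_summableN hg.
rewrite (@rsum_diff A _ (fun s => Num.max (h s) 0 + Num.max (g s) 0)
   (fun s => Num.max (- h s) 0 + Num.max (- g s) 0)).
- under eq_esum do rewrite EFinD.
  under [X in _ - fine X]eq_esum do rewrite EFinD.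
  rewrite !esumD; try by move=> s _; rewrite lee_fin max0_ge0.
  rewrite !fineD ?esum_fin_num ?pf//; try by move=> s; exact: max0_ge0.
  by rewrite /rsum; lra.
- by move=> s _; have := max0_split (h s); have := max0_split (g s); lra.
- by move=> s; rewrite addr_ge0// max0_ge0.
- by move=> s; rewrite addr_ge0// max0_ge0.
- under eq_esum do rewrite EFinD.
  rewrite esumD ?lte_add_pinfty ?pf// => s _; by rewrite lee_fin max0_ge0.
- under eq_esum do rewrite EFinD.
  rewrite esumD ?lte_add_pinfty ?pf// => s _; by rewrite lee_fin max0_ge0.
Qed.

Lemma rsumN A h : rsum A (fun s => - h s) = - rsum A h.
Proof.
by rewrite /rsum opprB; congr (_ - fine _); apply: eq_esum => s _; rewrite opprK.
Qed.

(** Finite partial sums give one inequality; the other is the same inequality for [a^-1] and the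
    family [a * g]. *)
Lemma esum_ge0Z A g (a : R) : 0 <= a -> (forall s, 0 <= g s) ->
  (\esum_(s in A) (g s)%:E < +oo)%E ->
  fine (\esum_(s in A) (a * g s)%:E) = a * fine (\esum_(s in A) (g s)%:E).
Proof.
move=> a0 g0 gf; have [->|an0] := eqVneq a 0.
  by rewrite mul0r esum1// => s _; rewrite mul0r.
have le (b : R) (k : simplex X -> R) : 0 <= b -> (forall s, 0 <= k s) ->
    (\esum_(s in A) (k s)%:E < +oo)%E ->
    (\esum_(s in A) (b * k s)%:E <= b%:E * \esum_(s in A) (k s)%:E)%E.
  move=> b0 k0 kf; apply: le_esum_bound => F finF FA.
  by rewrite -mulr_sumr EFinM lee_wpmul2l ?lee_fin// esum_ge_finite.
have gfin := esum_fin_num g0 gf.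
have agf : (\esum_(s in A) (a * g s)%:E < +oo)%E.
  by apply: le_lt_trans (le _ _ a0 g0 gf) _; rewrite -(fineK gfin) -EFinM ltry.
have ag0 s : 0 <= a * g s by rewrite mulr_ge0.
have agfin := esum_fin_num ag0 agf.
apply/le_anti/andP; split.
  by rewrite -lee_fin EFinM !fineK// le.
have ia0 : 0 <= a^-1 by rewrite invr_ge0.
have := le _ _ ia0 ag0 agf.
under eq_esum do rewrite mulrA mulVf// mul1r.
by rewrite -(fineK gfin) -(fineK agfin) -EFinM lee_fin ler_pdivlMl ?lt_def ?an0.
Qed.

Lemma rsumZ A h (a : R) : abs_summable A h ->
  rsum A (fun s => a * h s) = a * rsum A h.
Proof.
wlog a0 : a / 0 <= a => [wl hh|hh].
  have [/wl->//|/ltW a0] := leP 0 a.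
  rewrite (@eq_rsum A _ (fun s => - (- a * h s))) => [|s _]; last by lra.
  by rewrite rsumN wl ?oppr_ge0// mulNr opprK.
rewrite /rsum mulrBr -!esum_ge0Z//; try by move=> s; exact: max0_ge0.
- congr (fine _ - fine _); apply: eq_esum => s _; congr (_ %:E).
    by rewrite maxr_pMr// mulr0.
  by rewrite maxr_pMr// mulr0 mulrN.
- exact/abs_summable_pos/abs_summableN.
- exact: abs_summable_pos.
Qed.

Lemma rsum_ge0E A h : (forall s, A s -> 0 <= h s) ->
  rsum A h = fine (\esum_(s in A) (h s)%:E).
Proof.
move=> h0; rewrite /rsum.
rewrite [X in _ - fine X]esum1 ?subr0.
  by congr fine; apply: eq_esum => s As; rewrite max_l ?h0.
by move=> s As; rewrite max_r ?oppr_le0 ?h0.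
Qed.

Lemma rsum_mkcond A h : rsum A h = rsum setT (fun s => \1_A s * h s).
Proof.
rewrite /rsum; congr (fine _ - fine _); rewrite esum_mkcond;
  apply: eq_esum => s _; rewrite indicE; case: ifPn => As;
  by rewrite ?mul1r// mul0r ?oppr0 maxxx.
Qed.

Lemma finite_abs_summable A h : finite_set [set s | h s != 0] -> abs_summable A h.
Proof.
set D := [set s | h s != 0] => fh; rewrite /abs_summable.
apply: (@le_lt_trans _ _ (\esum_(s in D) `|h s|%:E)%E).
  rewrite esum_mkcond [leRHS]esum_mkcond; apply: le_esum => s _.
  case: ifPn => _; case: ifPn => //=.
  by rewrite notin_setE/= => /negP; rewrite negbK => /eqP ->; rewrite normr0.
rewrite (esum_fset fh) => [|s _]; last by rewrite lee_fin.
rewrite (fsbig_finite _ _ fh) sumEFin; exact: ltry.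
Qed.

Lemma rsum_point h (x : simplex X) : (forall s, s != x -> h s = 0) ->
  rsum setT h = h x.
Proof.
have pt g : (forall s, 0 <= g s) -> (forall s, s != x -> g s = 0) ->
    fine (\esum_(s in setT) (g s)%:E) = g x.
  move=> g0 gx; rewrite -[RHS]/(fine (g x)%:E) -(@esum_set1 _ _ x (fun s => (g s)%:E)) ?lee_fin//.
  rewrite [in RHS]esum_mkcond; congr fine; apply: eq_esum => s _.
  by case: ifPn => //; rewrite notin_setE/= => /eqP /gx ->.
move=> hx; rewrite /rsum (pt (fun s => Num.max (h s) 0)); last 2 first.
- by move=> s; exact: max0_ge0.
- by move=> s /hx ->; rewrite maxxx.
rewrite (pt (fun s => Num.max (- h s) 0)); last 2 first.
- by move=> s; exact: max0_ge0.
- by move=> s /hx ->; rewrite oppr0 maxxx.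
by rewrite -max0_split.
Qed.

End RealSums.

(** * The real Hilbert space of square-summable cochains *)

Section L2.
Context {V : countType} {R : realType} {X : weighted_complex V R}.
Implicit Types (f g h : cochain X) (a : R) (c : R[i]) (phi : simplex X -> R).

Definition zscale c f : cochain X := fun s => c * f s.
Definition rmul phi f : cochain X := fun s => (phi s)%:C%C * f s.

Lemma cochainD f g s : (f + g) s = f s + g s. Proof. by []. Qed.

Lemma cochainN f s : (- f) s = - f s. Proof. by []. Qed.

Lemma zscaleE c f s : zscale c f s = c * f s. Proof. by []. Qed.

Lemma rmulE phi f s : rmul phi f s = (phi s)%:C%C * f s. Proof. by []. Qed.

Definition cochainE := (cochainD, cochainN, zscaleE, rmulE).

(** Symmetric and real bilinear, so Cauchy-Schwarz and polarization take their real form. The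
    imaginary part is recovered from [Im <f, g> = Re <f, i g>] in [innerE]. *)
Definition rip f g : R := complex.Re (inner f g).
Definition rdens f g (s : simplex X) : R :=
  mass s * (complex.Re (f s) * complex.Re (g s) + complex.Im (f s) * complex.Im (g s)).

Lemma normc_sqr (z : R[i]) :
  Normc.normc z ^+ 2 = complex.Re z ^+ 2 + complex.Im z ^+ 2.
Proof. by case: z => a b /=; rewrite sqr_sqrtr// addr_ge0// sqr_ge0. Qed.

Lemma normc_ge0 (z : R[i]) : 0 <= Normc.normc z.
Proof. by case: z => a b; exact: sqrtr_ge0. Qed.

Lemma normc_real (x : R) : Normc.normc x%:C%C = `|x|.
Proof. by rewrite /= expr0n/= addr0 sqrtr_sqr. Qed.

Lemma ler_normc_Re (z : R[i]) : `|complex.Re z| <= Normc.normc z.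
Proof.
rewrite -(@ler_pXn2r _ 2) ?nnegrE ?normc_ge0//.
by rewrite normc_sqr real_normK ?num_real// lerDl sqr_ge0.
Qed.

Lemma ReM (z w : R[i]) : complex.Re (z * w) =
  complex.Re z * complex.Re w - complex.Im z * complex.Im w.
Proof. by case: z w => a b [c d]. Qed.

Lemma ImM (z w : R[i]) : complex.Im (z * w) =
  complex.Re z * complex.Im w + complex.Im z * complex.Re w.
Proof. by case: z w => a b [c d]. Qed.

Lemma ReD (z w : R[i]) : complex.Re (z + w) = complex.Re z + complex.Re w.
Proof. by case: z w => a b [c d]. Qed.

Lemma ImD (z w : R[i]) : complex.Im (z + w) = complex.Im z + complex.Im w.
Proof. by case: z w => a b [c d]. Qed.

Lemma ReN (z : R[i]) : complex.Re (- z) = - complex.Re z.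
Proof. by case: z. Qed.

Lemma ImN (z : R[i]) : complex.Im (- z) = - complex.Im z.
Proof. by case: z. Qed.

Lemma ReJ (z : R[i]) : complex.Re (z^*)%C = complex.Re z.
Proof. by case: z. Qed.

Lemma ImJ (z : R[i]) : complex.Im (z^*)%C = - complex.Im z.
Proof. by case: z. Qed.

Lemma cplx_eq (z w : R[i]) :
  complex.Re z = complex.Re w -> complex.Im z = complex.Im w -> z = w.
Proof. by case: z w => a b [c d] /= -> ->. Qed.

Definition reimE := (ReM, ImM, ReD, ImD, ReN, ImN, ReJ, ImJ).

Lemma mass_gt0 (s : simplex X) : 0 < mass s.
Proof. by apply: weight_gt0; have := set_valP s; case. Qed.

Lemma mass_ge0 (s : simplex X) : 0 <= mass s.
Proof. exact/ltW/mass_gt0. Qed.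

Lemma ripE f g : rip f g = rsum setT (rdens f g).
Proof.
rewrite /rip /inner /csum /=; apply: eq_rsum => s _.
by rewrite /rdens !reimE /=; ring.
Qed.

Lemma innerE f g : inner f g = (rip f g +i* rip f (zscale 'i%C g))%C.
Proof.
apply: cplx_eq => //=; rewrite ripE; apply: eq_rsum => s _.
by rewrite /rdens !reimE /=; ring.
Qed.

Lemma rdens_ge0 f (s : simplex X) : 0 <= rdens f f s.
Proof. by rewrite mulr_ge0 ?mass_ge0// addr_ge0// -expr2 sqr_ge0. Qed.

Lemma rdensE f (s : simplex X) : rdens f f s = mass s * Normc.normc (f s) ^+ 2.
Proof. by rewrite normc_sqr. Qed.

Lemma l2E f : l2 f = abs_summable setT (rdens f f).
Proof.
rewrite abs_summableE; last by move=> s; exact: rdens_ge0.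
by rewrite /l2 /norm2_sqr; under eq_esum do rewrite -rdensE.
Qed.

Lemma rdens_summable f g : l2 f -> l2 g -> abs_summable setT (rdens f g).
Proof.
rewrite !l2E => hf hg.
apply: (@abs_summable_le _ _ _ _ _ (fun s => rdens f f s + rdens g g s)); last first.
  exact: abs_summableD.
move=> s _; rewrite ler_norml /rdens -mulrDr -mulrN !ler_pM2l ?mass_gt0//.
move: (complex.Re (f s)) (complex.Im (f s)) (complex.Re (g s)) (complex.Im (g s)).
move=> x y z w; have := sqr_ge0 (x + z); have := sqr_ge0 (y + w).
have := sqr_ge0 (x - z); have := sqr_ge0 (y - w).
have := sqr_ge0 x; have := sqr_ge0 y; have := sqr_ge0 z; have := sqr_ge0 w.
by rewrite !sqrrD !sqrrN => *; apply/andP; split; nra.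
Qed.

Lemma ripC f g : rip f g = rip g f.
Proof. by rewrite !ripE; apply: eq_rsum => s _; rewrite /rdens; ring. Qed.

Lemma ripDl f g h : l2 f -> l2 g -> l2 h -> rip (f + g) h = rip f h + rip g h.
Proof.
move=> hf hg hh; rewrite !ripE -rsumD; try exact: rdens_summable.
by apply: eq_rsum => s _; rewrite /rdens /= !reimE; ring.
Qed.

Lemma ripDr f g h : l2 f -> l2 g -> l2 h -> rip h (f + g) = rip h f + rip h g.
Proof. by move=> *; rewrite ripC ripDl// !(ripC h). Qed.

Lemma ripNl f h : rip (- f) h = - rip f h.
Proof.
by rewrite !ripE -rsumN; apply: eq_rsum => s _; rewrite /rdens /= !reimE; ring.
Qed.

Lemma ripNr f h : rip h (- f) = - rip h f.
Proof. by rewrite ripC ripNl ripC. Qed.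

Lemma ripZl a f h : l2 f -> l2 h -> rip (zscale a%:C%C f) h = a * rip f h.
Proof.
move=> hf hh; rewrite !ripE -rsumZ; last exact: rdens_summable.
by apply: eq_rsum => s _; rewrite /rdens /zscale !reimE /=; ring.
Qed.

Lemma ripZr a f h : l2 f -> l2 h -> rip h (zscale a%:C%C f) = a * rip h f.
Proof. by move=> *; rewrite ripC ripZl// ripC. Qed.

Lemma rip_rmul phi f g : rip (rmul phi f) g = rip f (rmul phi g).
Proof.
by rewrite !ripE; apply: eq_rsum => s _; rewrite /rdens /rmul !reimE /=; ring.
Qed.

Lemma rip_zscaleJ c f g : rip (zscale c f) g = rip f (zscale (c^*)%C g).
Proof.
by rewrite !ripE; apply: eq_rsum => s _; rewrite /rdens /zscale !reimE /=; ring.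
Qed.

Lemma l2_bounded a f g :
  (forall s, Normc.normc (g s) <= a * Normc.normc (f s)) -> l2 f -> l2 g.
Proof.
move=> fg; rewrite !l2E => /(@abs_summableZ _ _ _ _ _ (a ^+ 2)).
apply: abs_summable_le => s _; rewrite ger0_norm ?rdens_ge0// !rdensE.
rewrite [leRHS]mulrCA ler_pM2l ?mass_gt0// -exprMn ler_pXn2r ?nnegrE ?normc_ge0//.
exact: le_trans (normc_ge0 _) (fg s).
Qed.

Lemma l2Z c f : l2 f -> l2 (zscale c f).
Proof.
apply: (@l2_bounded (Normc.normc c)) => s.
by rewrite /zscale Normc.normcM.
Qed.

Lemma l2N f : l2 f -> l2 (- f).
Proof.
apply: (@l2_bounded 1) => s; rewrite mul1r.
by rewrite -[leRHS]normcN.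
Qed.

Lemma l2_rmul a phi f : (forall s, `|phi s| <= a) -> l2 f -> l2 (rmul phi f).
Proof.
move=> pa; apply: (@l2_bounded a) => s.
by rewrite Normc.normcM normc_real ler_wpM2r ?normc_ge0.
Qed.

Lemma l2D f g : l2 f -> l2 g -> l2 (f + g).
Proof.
move=> hf hg; rewrite l2E.
apply: (@abs_summable_le _ _ _ _ _ (fun s => 2 * (rdens f f s + rdens g g s))).
  move=> s _; rewrite ger0_norm ?rdens_ge0// /rdens -mulrDr mulrCA.
  rewrite ler_pM2l ?mass_gt0// /= !reimE.
  move: (complex.Re (f s)) (complex.Im (f s)) (complex.Re (g s)) (complex.Im (g s)).
  move=> x y z w; have := sqr_ge0 (x - z); have := sqr_ge0 (y - w).
  by rewrite !sqrrD !sqrrN => *; nra.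
by apply/abs_summableZ/abs_summableD; rewrite -l2E.
Qed.

Lemma l2B f g : l2 f -> l2 g -> l2 (f - g).
Proof. by move=> hf hg; apply: l2D => //; exact: l2N. Qed.

Lemma finitely_supported_l2 f : finitely_supported f -> l2 f.
Proof.
move=> ff; rewrite l2E; apply: finite_abs_summable.
apply: sub_finite_set ff => s /=; apply: contra_neq => fs0.
by rewrite /rdens fs0 /= !mul0r addr0 mulr0.
Qed.

Lemma l2_0 : l2 (0 : cochain X).
Proof.
apply: finitely_supported_l2; rewrite /finitely_supported /supp.
by rewrite (_ : [set s | _] = set0)//; apply/seteqP; split => s //=; rewrite eqxx.
Qed.

Lemma l2_sum (I : Type) (r : seq I) (P : pred I) (F : I -> cochain X) :
  (forall i, P i -> l2 (F i)) -> l2 (\sum_(i <- r | P i) F i).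
Proof. by move=> hF; elim/big_ind : _ => //; [exact: l2_0|exact: l2D]. Qed.

Lemma rip0l g : rip 0 g = 0.
Proof.
rewrite ripE (@eq_rsum _ _ _ _ _ (fun=> 0)) => [|s _].
  by rewrite /rsum oppr0 subrr.
by rewrite /rdens /= !mul0r addr0 mulr0.
Qed.

Lemma rip_suml (I : Type) (r : seq I) (P : pred I) (F : I -> cochain X) g :
  (forall i, P i -> l2 (F i)) -> l2 g ->
  rip (\sum_(i <- r | P i) F i) g = \sum_(i <- r | P i) rip (F i) g.
Proof.
move=> hF hg.
elim: r => [|i r IH]; last first.
  rewrite !big_cons; case: ifPn => // Pi; rewrite ripDl ?IH//; first exact: hF.
  exact: l2_sum.
by rewrite !big_nil rip0l.
Qed.

Lemma rip_sumr (I : Type) (r : seq I) (P : pred I) (F : I -> cochain X) g :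
  (forall i, P i -> l2 (F i)) -> l2 g ->
  rip g (\sum_(i <- r | P i) F i) = \sum_(i <- r | P i) rip g (F i).
Proof.
by move=> hF hg; rewrite ripC rip_suml//; under eq_bigr do rewrite ripC.
Qed.

Lemma ripBl f g h : l2 f -> l2 g -> l2 h -> rip (f - g) h = rip f h - rip g h.
Proof. by move=> hf hg hh; rewrite ripDl ?ripNl//; exact: l2N. Qed.

Lemma ripBr f g h : l2 f -> l2 g -> l2 h -> rip h (f - g) = rip h f - rip h g.
Proof. by move=> hf hg hh; rewrite ripDr ?ripNr//; exact: l2N. Qed.

Lemma rip_ge0 f : 0 <= rip f f.
Proof.
rewrite ripE rsum_ge0E => [|s _]; last exact: rdens_ge0.
by apply/fine_ge0/esum_ge0 => s _; rewrite lee_fin rdens_ge0.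
Qed.

Lemma norm2E f : norm2 f = Num.sqrt (rip f f).
Proof.
rewrite ripE rsum_ge0E => [|s _]; last exact: rdens_ge0.
by rewrite /norm2 /norm2_sqr; under eq_esum do rewrite -rdensE.
Qed.

Lemma norm2_sqrE f : norm2 f ^+ 2 = rip f f.
Proof. by rewrite norm2E sqr_sqrtr// rip_ge0. Qed.

Lemma norm2_ge0 f : 0 <= norm2 f.
Proof. exact: sqrtr_ge0. Qed.

Lemma norm2_0 : norm2 (0 : cochain X) = 0.
Proof. by rewrite norm2E rip0l sqrtr0. Qed.

Lemma rip_finite_le f (F : set (simplex X)) : l2 f -> finite_set F ->
  \sum_(s <- fset_set F) mass s * Normc.normc (f s) ^+ 2 <= rip f f.
Proof.
move=> hf fF; under eq_bigr do rewrite -rdensE.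
rewrite ripE rsum_ge0E => [|s _]; last exact: rdens_ge0.
rewrite -lee_fin fineK; first exact: esum_ge_finite.
apply: esum_fin_num => [s|]; first exact: rdens_ge0.
by rewrite -abs_summableE -?l2E// => s; exact: rdens_ge0.
Qed.

(** The sum is the supremum of its finite partial sums, so a uniform bound on these passes to it. In
    [null_image] this does the work of Fatou's lemma. *)
Lemma rip_le_bound f (M : R) :
  (forall F, finite_set F ->
     \sum_(s <- fset_set F) mass s * Normc.normc (f s) ^+ 2 <= M) ->
  rip f f <= M.
Proof.
move=> hM; rewrite ripE rsum_ge0E => [|s _]; last exact: rdens_ge0.
have M0 : 0 <= M.
  by have := hM _ (finite_set0 _); rewrite fset_set0 big_seq_fset0.
have le : (\esum_(s in setT) (rdens f f s)%:E <= M%:E)%E.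
  apply: le_esum_bound => F fF _; rewrite lee_fin.
  by under eq_bigr do rewrite rdensE; exact: hM.
rewrite -lee_fin fineK//; apply: esum_fin_num => [s|]; first exact: rdens_ge0.
by apply: le_lt_trans le _; exact: ltry.
Qed.

Lemma normc_le_norm2 f (s : simplex X) : l2 f ->
  Normc.normc (f s) <= (Num.sqrt (mass s))^-1 * norm2 f.
Proof.
move=> hf; have m0 := mass_gt0 s.
rewrite ler_pdivlMl ?sqrtr_gt0// norm2E -[Normc.normc _]ger0_norm ?normc_ge0//.
rewrite -sqrtr_sqr -sqrtrM ?mass_ge0// ler_wsqrtr//.
have := rip_finite_le hf (finite_set1 s).
by rewrite fset_set1 big_seq_fset1.
Qed.

Lemma norm2_eq0 f : l2 f -> norm2 f = 0 -> f = 0.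
Proof.
move=> hf f0; apply/funext => s; apply: Normc.eq0_normc.
apply/le_anti; rewrite normc_ge0 andbT.
by have := normc_le_norm2 s hf; rewrite f0 mulr0.
Qed.

(** Common source of Cauchy-Schwarz for [rip] and for the form [Q - a0] in [form_resolvent_gap]. *)
Lemma discr_le (a b c : R) : (forall t, 0 <= a + 2 * t * b + t ^+ 2 * c) ->
  b ^+ 2 <= a * c.
Proof.
move=> h; have a0 : 0 <= a by have := h 0; lra.
have [c0|c0|c0] := ltgtP c 0.
(* For this [t >= 1] one has [a + t ^ 2 * c < 0], and adding the hypotheses at [t] and [- t] cancels
   the linear term. *)
- exfalso; pose t := (a + 1) / - c + 1.
  have cn0 : c != 0 by rewrite lt_eqF.
  have t1 : 1 <= t by rewrite /t lerDr divr_ge0; lra.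
  have tc : t * c = - (a + 1) + c by rewrite /t; field.
  have tt : t ^+ 2 * c = t * (- (a + 1) + c) by rewrite -tc; ring.
  by have := h t; have := h (- t); rewrite sqrrN tt; nra.
- have := h (- b / c); have cn0 : c != 0 by rewrite gt_eqF.
  have -> : a + 2 * (- b / c) * b + (- b / c) ^+ 2 * c = (a * c - b ^+ 2) / c by field.
  by rewrite pmulr_lge0 ?invr_gt0// subr_ge0.
- rewrite c0 mulr0; case: (eqVneq b 0) => [->|b0]; first by rewrite expr0n.
  have := h (- (a + 1) / b); rewrite c0 mulr0 addr0.
  have -> : a + 2 * (- (a + 1) / b) * b = - a - 2 by field.
  lra.
Qed.

Lemma rip_CS f g : l2 f -> l2 g -> `|rip f g| <= norm2 f * norm2 g.
Proof.
move=> hf hg; rewrite -(@ler_pXn2r _ 2) ?nnegrE ?mulr_ge0 ?norm2_ge0//.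
rewrite exprMn !norm2_sqrE real_normK ?num_real//; apply: discr_le => t.
have := rip_ge0 (f + zscale t%:C%C g).
have htg := l2Z t%:C%C hg.
rewrite ripDl ?ripDr ?ripZl ?ripZr ?(ripC g f)//; last exact: l2D.
by move/le_trans; apply; rewrite le_eqVlt; apply/orP; left; apply/eqP; ring.
Qed.

Lemma rip_CSr f g : l2 f -> l2 g -> rip f g <= norm2 f * norm2 g.
Proof. by move=> hf hg; apply: le_trans (ler_norm _) (rip_CS hf hg). Qed.

Lemma norm2_triangle f g : l2 f -> l2 g -> norm2 (f + g) <= norm2 f + norm2 g.
Proof.
move=> hf hg; rewrite -(@ler_pXn2r _ 2) ?nnegrE ?addr_ge0 ?norm2_ge0//.
rewrite norm2_sqrE ripDl ?ripDr ?(ripC g f) -?norm2_sqrE//; last exact: l2D.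
have := rip_CSr hf hg; rewrite sqrrD; lra.
Qed.

Lemma norm2N f : norm2 (- f) = norm2 f.
Proof. by rewrite !norm2E ripNl ripNr opprK. Qed.

Lemma norm2_triangleB f g : l2 f -> l2 g -> norm2 (f - g) <= norm2 f + norm2 g.
Proof. by move=> hf hg; rewrite -(norm2N g) norm2_triangle//; exact: l2N. Qed.

Lemma norm2Z a f : l2 f -> norm2 (zscale a%:C%C f) = `|a| * norm2 f.
Proof.
move=> hf; rewrite norm2E ripZl ?ripZr//; last exact: l2Z.
by rewrite mulrA -expr2 sqrtrM ?sqr_ge0// sqrtr_sqr -norm2E.
Qed.

Lemma norm2_le f g a : 0 <= a -> l2 f ->
  (forall s, Normc.normc (g s) <= a * Normc.normc (f s)) ->
  norm2 g <= a * norm2 f.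
Proof.
move=> a0 hf fg; have hg := l2_bounded fg hf.
rewrite -(@ler_pXn2r _ 2) ?nnegrE ?mulr_ge0 ?norm2_ge0//.
rewrite exprMn !norm2_sqrE; apply: rip_le_bound => F fF.
apply: (@le_trans _ _ (a ^+ 2 * \sum_(s <- fset_set F) mass s * Normc.normc (f s) ^+ 2)).
  rewrite mulr_sumr; apply: ler_sum => s _.
  rewrite [leRHS]mulrCA ler_pM2l ?mass_gt0// -exprMn ler_pXn2r ?nnegrE ?normc_ge0//.
  exact: le_trans (normc_ge0 _) (fg s).
by rewrite ler_wpM2l ?sqr_ge0// rip_finite_le.
Qed.

Lemma norm2_rmul a phi f : 0 <= a -> (forall s, `|phi s| <= a) -> l2 f ->
  norm2 (rmul phi f) <= a * norm2 f.
Proof.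
move=> a0 pa hf; apply: norm2_le => // s.
by rewrite Normc.normcM normc_real ler_wpM2r ?normc_ge0.
Qed.

Lemma inner_zscale c f g : l2 f -> l2 g -> inner (zscale c f) g = c * inner f g.
Proof.
move=> hf hg; have hig := l2Z 'i%C hg.
have split h : l2 h -> rip (zscale c f) h =
    complex.Re c * rip f h - complex.Im c * rip f (zscale 'i%C h).
  move=> hh; have hih := l2Z 'i%C hh.
  have -> : zscale c f = zscale (complex.Re c)%:C%C f +
      zscale (complex.Im c)%:C%C (zscale 'i%C f).
    apply/funext => s.
    rewrite [RHS]/((complex.Re c)%:C%C * f s + (complex.Im c)%:C%C * ('i%C * f s)).
    by rewrite /zscale; apply: cplx_eq; rewrite !reimE /=; ring.
  have hif := l2Z 'i%C hf.
  rewrite ripDl ?ripZl//; [|exact: l2Z..].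
  rewrite rip_zscaleJ; congr (_ + _); rewrite -mulrN -ripNr; congr (_ * rip _ _).
  by apply/funext => s; rewrite /zscale [RHS]/(- ('i%C * h s)) /=; apply: cplx_eq;
    rewrite !reimE /=; ring.
apply: cplx_eq; rewrite !innerE /= !reimE /= !split//.
have -> : zscale 'i%C (zscale 'i%C g) = - g.
  by apply/funext => s; apply: cplx_eq; rewrite /zscale !reimE /=; ring.
by rewrite ripNr; ring.
Qed.

(** Reduces a bound on the modulus of [inner] to a bound on [rip]; the factor is the conjugate of
    [inner f g] over its modulus. *)
Lemma rip_inner_rot f g : exists c, Normc.normc c = 1 /\
  Normc.normc (inner f g) = complex.Re (c * inner f g).
Proof.
set z := inner f g; have [z0|z0] := eqVneq z 0.
  exists 1; rewrite z0 mulr0; split; first exact: Normc.normc1.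
  by rewrite Normc.normc0.
have n0 : Normc.normc z != 0 by apply: contraNN z0 => /eqP /Normc.eq0_normc ->.
exists (z^* * (Normc.normc z)^-1%:C)%C; split.
  rewrite Normc.normcM normc_real ger0_norm ?invr_ge0 ?normc_ge0//.
  have -> : Normc.normc (z^*)%C = Normc.normc z.
    by case: (z) => a b /=; rewrite sqrrN.
  by rewrite divff.
have zz : (z^*)%C * z = (Normc.normc z ^+ 2)%:C%C.
  by apply: cplx_eq; rewrite ?normc_sqr !reimE /= ?normc_sqr; ring.
rewrite mulrAC zz -rmorphM /= expr2 -mulrA divff ?mulr1//.
Qed.

Lemma normc_inner_le f g : l2 f -> l2 g -> Normc.normc (inner f g) <= norm2 f * norm2 g.
Proof.
move=> hf hg; have [c [c1 ->]] := rip_inner_rot f g.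
rewrite -inner_zscale// -/(rip _ _).
apply: le_trans (rip_CSr (l2Z c hf) hg) _.
rewrite ler_wpM2r ?norm2_ge0// -[leRHS]mul1r; apply: norm2_le => // s.
by rewrite Normc.normcM c1.
Qed.

End L2.

(** * Coboundary and boundary as form operators *)

Section FormOperators.
Context {V : countType} {R : realType} {X : weighted_complex V R}.
Implicit Types (f g h : cochain X) (c : R[i]).

Lemma finitely_supportedD f g :
  finitely_supported f -> finitely_supported g -> finitely_supported (f + g).
Proof.
move=> hf hg; have fin : finite_set (supp f `|` supp g) by rewrite finite_setU.
apply: sub_finite_set fin.
  move=> s fgs; have [fs0|fs0] := eqVneq (f s) 0; [right|by left].
  by have : f s + g s != 0 := fgs; rewrite fs0 add0r.
Qed.

Lemma finitely_supported_le f g : (forall s, f s = 0 -> g s = 0) ->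
  finitely_supported f -> finitely_supported g.
Proof.
by move=> fg; apply: sub_finite_set => s /=; apply: contra_neq; exact: fg.
Qed.

Lemma finitely_supportedZ c f : finitely_supported f -> finitely_supported (zscale c f).
Proof. by apply: finitely_supported_le => s; rewrite /zscale => ->; rewrite mulr0. Qed.

Lemma finitely_supported_rmul phi f : finitely_supported f -> finitely_supported (rmul phi f).
Proof. by apply: finitely_supported_le => s; rewrite /rmul => ->; rewrite mulr0. Qed.

Lemma finitely_supportedN f : finitely_supported f -> finitely_supported (- f).
Proof. by apply: finitely_supported_le => s; rewrite cochainN => ->; rewrite oppr0.
Qed.

Lemma finitely_supportedB f g :
  finitely_supported f -> finitely_supported g -> finitely_supported (f - g).
Proof. by move=> hf hg; apply/finitely_supportedD/finitely_supportedN. Qed.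

Lemma finitely_supported0 : finitely_supported (0 : cochain X).
Proof.
rewrite /finitely_supported /supp (_ : [set s | _] = set0)//.
by apply/seteqP; split => s //=; rewrite eqxx.
Qed.

Lemma finitely_supported_sum (I : Type) (r : seq I) (F : I -> cochain X) :
  (forall i, finitely_supported (F i)) -> finitely_supported (\sum_(i <- r) F i).
Proof.
by move=> hF; elim/big_ind : _ => //;
  [exact: finitely_supported0|exact: finitely_supportedD].
Qed.

Lemma finitely_supported_delta1 (x : simplex X) : finitely_supported (delta1 x).
Proof.
apply: sub_finite_set (finite_set1 x) => s /=; rewrite /delta1.
by case: (eqVneq s x) => // sx; rewrite /supp /= (negbTE sx) eqxx.
Qed.

Lemma cochain_sumE (I : Type) (r : seq I) (F : I -> cochain X) s :
  (\sum_(i <- r) F i) s = \sum_(i <- r) F i s.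
Proof. by elim: r => [|i r IH]; rewrite ?big_nil// !big_cons -IH. Qed.

Lemma delta1_decomp f : finitely_supported f ->
  f = \sum_(x <- fset_set (supp f)) zscale (f x) (delta1 x).
Proof.
move=> hf; apply/funext => s; rewrite cochain_sumE.
have [fs0|fs0] := eqVneq (f s) 0.
  rewrite fs0 big1// => x _; rewrite /zscale /delta1.
  by case: (eqVneq s x) => [<-|_]; rewrite ?fs0 ?mul0r ?mulr0.
rewrite (big_fsetD1 s)/=; last by rewrite in_fset_set// inE.
rewrite {1}/zscale /delta1 eqxx mulr1 big1_fset ?addr0// => x.
by rewrite in_fsetD1 /zscale => /andP[xs _] _; rewrite eq_sym (negbTE xs) mulr0.
Qed.

(** A common frame for the coboundary, the boundary and their sum. The last clause, continuity of
    each point evaluation of [L f] in the [l2] norm of [f], is what makes [<L f, L g>] closable. *)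
Definition form_operator (L : cochain X -> cochain X) : Prop :=
  [/\ forall c f g, finitely_supported f -> finitely_supported g ->
        L (zscale c f + g) = zscale c (L f) + L g,
      forall f, finitely_supported f -> l2 (L f)
    & forall s, exists2 a : R, 0 <= a & forall f, finitely_supported f ->
        Normc.normc (L f s) <= a * norm2 f].

Section Linearity.
Variable L : cochain X -> cochain X.
Hypothesis Llin : forall c f g, finitely_supported f -> finitely_supported g ->
        L (zscale c f + g) = zscale c (L f) + L g.

Lemma form_operatorD f g : finitely_supported f -> finitely_supported g ->
  L (f + g) = L f + L g.
Proof.
move=> hf hg; have := Llin 1 hf hg.
have z1 (h : cochain X) : zscale 1 h = h by apply/funext => s; rewrite /zscale mul1r.
by rewrite !z1.
Qed.

Lemma form_operator0 : L 0 = 0.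
Proof.
have := form_operatorD finitely_supported0 finitely_supported0.
by rewrite addr0 => /eqP; rewrite -subr_eq subrr => /eqP.
Qed.

Lemma form_operatorZ c f : finitely_supported f -> L (zscale c f) = zscale c (L f).
Proof.
move=> hf; have := Llin c hf finitely_supported0.
by rewrite form_operator0 !addr0.
Qed.

Lemma form_operatorB f g : finitely_supported f -> finitely_supported g ->
  L (f - g) = L f - L g.
Proof.
move=> hf hg; have zN (h : cochain X) : - h = zscale (-1) h.
  by apply/funext => s; rewrite /zscale mulN1r.
rewrite form_operatorD//; last exact: finitely_supportedN.
by rewrite !zN form_operatorZ.
Qed.

Lemma form_operator_sum (I : Type) (r : seq I) (F : I -> cochain X) :
  (forall i, finitely_supported (F i)) -> L (\sum_(i <- r) F i) = \sum_(i <- r) L (F i).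
Proof.
move=> hF; elim: r => [|i r IH]; first by rewrite !big_nil form_operator0.
by rewrite !big_cons form_operatorD ?IH//; exact: finitely_supported_sum.
Qed.

Lemma form_operator_l2 : (forall x : simplex X, l2 (L (delta1 x))) ->
  forall f, finitely_supported f -> l2 (L f).
Proof.
move=> hx f hf; rewrite (delta1_decomp hf) form_operator_sum.
  apply: l2_sum => x _; rewrite form_operatorZ; first exact: l2Z.
  exact: finitely_supported_delta1.
by move=> x; apply/finitely_supportedZ/finitely_supported_delta1.
Qed.

End Linearity.

Lemma form_operator_add L M : form_operator L -> form_operator M ->
  form_operator (fun f => L f + M f).
Proof.
move=> [L1 L2 L3] [M1 M2 M3]; split.
- move=> c f g hf hg; rewrite L1// M1//; apply/funext => s.
  by rewrite !cochainE; ring.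
- by move=> f hf; apply: l2D; [exact: L2|exact: M2].
- move=> s; have [a a0 ha] := L3 s; have [b b0 hb] := M3 s.
  exists (a + b); first exact: addr_ge0.
  move=> f hf; rewrite mulrDl; apply: le_trans (le_normcD _ _) _.
  by apply: lerD; [exact: ha|exact: hb].
Qed.

Lemma innerC f g : inner f g = ((inner g f)^*)%C.
Proof.
apply: cplx_eq; rewrite !innerE !reimE /=; first exact: ripC.
rewrite ripC rip_zscaleJ !ripE -rsumN; apply: eq_rsum => s _.
by rewrite /rdens /zscale !reimE /=; ring.
Qed.

Lemma innerDl f g h : l2 f -> l2 g -> l2 h -> inner (f + g) h = inner f h + inner g h.
Proof.
move=> hf hg hh; have hih := l2Z 'i%C hh.
by apply: cplx_eq; rewrite !innerE !reimE /= ripDl.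
Qed.

Lemma inner_delta1 (x : simplex X) g : inner (delta1 x) g = (mass x)%:C%C * ((g x)^*)%C.
Proof.
apply: cplx_eq; rewrite !innerE !reimE /= !ripE (@rsum_point _ _ _ _ x) /rdens
  /zscale /delta1 /= ?eqxx ?reimE /=; try (by ring);
  by move=> s /negbTE ->; rewrite /= !mul0r addr0 mulr0.
Qed.

Section Coboundary.
Hypothesis hX : locally_summable X.
Variable theta : simplex X -> simplex X -> R.
Hypothesis htheta : forall t s, facet t s -> theta t s = 1 \/ theta t s = -1.

Lemma finite_facets (s : simplex X) : finite_set [set t : simplex X | facet t s].
Proof.
have fin : finite_set [set` fpowerset (val s)].
  exact: finite_fset.
have := @finite_preimage _ _ [set` fpowerset (val s)] (fun t : simplex X => val t) _ fin.
move=> h; apply: sub_finite_set (h _).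
  by move=> t /= [ts _]; rewrite fpowersetE.
by move=> x y _ _ /val_inj.
Qed.

Lemma coboundary_delta1 (x s : simplex X) :
  coboundary theta (delta1 x) s = (theta x s * \1_[set s' | facet x s'] s)%:C%C.
Proof.
rewrite /coboundary fsbig_finite ?indicE; last exact: finite_facets.
have -> : (s \in [set s' | facet x s']) = (x \in [set t | facet t s]).
  by apply/idP/idP; rewrite !inE.
case: (boolP (x \in [set t | facet t s])) => xs.
  rewrite (big_fsetD1 x)/=; last by rewrite in_fset_set//; exact: finite_facets.
  rewrite /delta1 eqxx mulr1 big1_fset ?addr0 ?mulr1// => t.
  by rewrite in_fsetD1 => /andP[tx _] _; rewrite (negbTE tx) mulr0.
rewrite mulr0 big1_fset// => t; rewrite in_fset_set; last exact: finite_facets.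
move=> ts _; rewrite /delta1; case: eqP => [tx|_]; last by rewrite mulr0.
by rewrite -tx ts in xs.
Qed.

(** Local summability enters here: the signs have modulus one, so the squared norm is at most the
    total mass of the simplices having [x] as a facet. *)
Lemma l2_coboundary_delta1 (x : simplex X) : l2 (coboundary theta (delta1 x)).
Proof.
rewrite l2E abs_summableE; last by move=> s; exact: rdens_ge0.
apply: le_lt_trans (hX x); rewrite [leRHS]esum_mkcond; apply: le_esum => s _.
rewrite rdensE coboundary_delta1 normc_real indicE.
case: ifPn => [|_]; last by rewrite mulr0 normr0 expr0n mulr0.
rewrite inE/= mulr1 lee_fin => /htheta[] ->;
by rewrite ?normrN normr1 expr1n mulr1.
Qed.

Lemma coboundary_form_operator : form_operator (coboundary theta).
Proof.
have lin c f g : coboundary theta (zscale c f + g) =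
    zscale c (coboundary theta f) + coboundary theta g.
  apply/funext => s.
  rewrite !cochainE /coboundary.
  rewrite !fsbig_finite; try exact: finite_facets.
  rewrite mulr_sumr -big_split/=; apply: eq_bigr => t _.
  by rewrite !cochainE; ring.
split => //.
  by apply: form_operator_l2 => // x; exact: l2_coboundary_delta1.
move=> s; exists (\sum_(t <- fset_set [set t | facet t s])
    `|theta t s| * (Num.sqrt (mass t))^-1).
  by apply: sumr_ge0 => t _; rewrite mulr_ge0// invr_ge0 sqrtr_ge0.
move=> f hf; rewrite /coboundary fsbig_finite; last exact: finite_facets.
rewrite mulr_suml; elim/big_ind2 : _ => //.
- by rewrite Normc.normc0.
- by move=> x1 x2 y1 y2 h1 h2; apply: le_trans (le_normcD _ _) _; exact: lerD.
- move=> t _; rewrite Normc.normcM normc_real -mulrA ler_wpM2l//.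
  by apply: normc_le_norm2; exact: finitely_supported_l2.
Qed.

(** The boundary is the formal adjoint of the coboundary. In this form Cauchy-Schwarz bounds its
    point evaluations. *)
Lemma boundaryE f (r : simplex X) :
  boundary theta f r = ((mass r)^-1)%:C%C * inner f (coboundary theta (delta1 r)).
Proof.
rewrite /boundary; congr (_ * _); rewrite /inner /csum.
congr (_ +i* _)%C; rewrite rsum_mkcond; apply: eq_rsum => t _;
  by rewrite coboundary_delta1 !reimE /=; ring.
Qed.

Lemma boundary_form_operator : form_operator (boundary theta).
Proof.
have lc r := l2_coboundary_delta1 r.
have lin c f g : finitely_supported f -> finitely_supported g ->
    boundary theta (zscale c f + g) =
    zscale c (boundary theta f) + boundary theta g.
  move=> /finitely_supported_l2 hf /finitely_supported_l2 hg; apply/funext => r.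
  rewrite !cochainE !boundaryE.
  rewrite innerDl// ?inner_zscale//; last exact: l2Z.
  by ring.
split => //.
  (* The boundary of [delta1 x] lives on the facets of [x], which are finitely many. *)
  apply: form_operator_l2 => // x; apply: finitely_supported_l2.
  apply: sub_finite_set (finite_facets x) => r /=.
  rewrite /supp /= boundaryE inner_delta1 coboundary_delta1 indicE.
  case: (boolP (x \in _)) => [|_]; first by rewrite inE.
  by rewrite mulr0 conjc0 !mulr0 eqxx.
move=> r; exists ((mass r)^-1 * norm2 (coboundary theta (delta1 r))).
  by rewrite mulr_ge0 ?norm2_ge0// invr_ge0 mass_ge0.
move=> f /finitely_supported_l2 hf; rewrite boundaryE Normc.normcM normc_real.
rewrite ger0_norm ?invr_ge0 ?mass_ge0// -mulrA ler_wpM2l ?invr_ge0 ?mass_ge0//.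
by rewrite mulrC; exact: normc_inner_le.
Qed.

(** The case distinction on the kind of Laplacian ends here; what follows only sees an abstract form
    operator [L]. *)
Lemma energy_form_operator (o : laplacian_kind) : exists2 L,
  form_operator L & energy theta o = fun f g => inner (L f) (L g).
Proof.
case: o.
- by exists (coboundary theta); first exact: coboundary_form_operator.
- by exists (boundary theta); first exact: boundary_form_operator.
- exists (fun f => coboundary theta f + boundary theta f) => //.
  by apply: form_operator_add; [exact: coboundary_form_operator|
    exact: boundary_form_operator].
Qed.

End Coboundary.
End FormOperators.

(** * Convergence and closability *)

Section Convergence.
Context {V : countType} {R : realType} {X : weighted_complex V R}.
Implicit Types (f g h : cochain X) (u v w z : nat -> cochain X).

Lemma cvg0_squeeze (a b : nat -> R) : (\forall n \near \oo, `|a n| <= b n) ->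
  b @ \oo --> (0 : R) -> a @ \oo --> (0 : R).
Proof.
move=> ab b0; apply/norm_cvg0P; apply: squeeze_cvgr b0; last exact: cvg_cst.
by apply: filterS ab => n ->; rewrite normr_ge0.
Qed.

Lemma rip_dist f f' g g' : l2 f -> l2 f' -> l2 g -> l2 g' ->
  `|rip f g - rip f' g'| <= norm2 (f - f') * norm2 g + norm2 f' * norm2 (g - g').
Proof.
move=> hf hf' hg hg'.
have -> : rip f g - rip f' g' = rip (f - f') g + rip f' (g - g').
  by rewrite ripBl ?ripBr//; ring.
apply: le_trans (ler_normD _ _) _.
by apply: lerD; apply: rip_CS => //; exact: l2B.
Qed.

(** Neither pair of sequences is assumed to converge. It is applied to images under [L], which are
    known to be Cauchy but whose limits are never formed. *)
Lemma rip_asymp u u' v v' (M : R) :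
  (forall n, l2 (u n)) -> (forall n, l2 (u' n)) ->
  (forall n, l2 (v n)) -> (forall n, l2 (v' n)) ->
  (fun n => norm2 (u n - u' n)) @ \oo --> (0 : R) ->
  (fun n => norm2 (v n - v' n)) @ \oo --> (0 : R) ->
  (\forall n \near \oo, norm2 (v n) <= M) ->
  (\forall n \near \oo, norm2 (u' n) <= M) ->
  (fun n => rip (u n) (v n) - rip (u' n) (v' n)) @ \oo --> (0 : R).
Proof.
move=> hu hu' hv hv' uu vv vM uM.
apply: (@cvg0_squeeze _ (fun n => norm2 (u n - u' n) * M + M * norm2 (v n - v' n))).
  near=> n; apply: le_trans (rip_dist (hu n) (hu' n) (hv n) (hv' n)) _.
  apply: lerD.
    by rewrite ler_wpM2l ?norm2_ge0//; near: n.
  by rewrite ler_wpM2r ?norm2_ge0//; near: n.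
rewrite -[X in _ --> X]addr0; apply: cvgD.
  by rewrite -[X in _ --> X](mul0r M); apply: cvgMr_tmp.
by rewrite -[X in _ --> X](mulr0 M); apply: cvgMl_tmp.
Unshelve. all: by end_near.
Qed.

Definition l2cvg u f := [/\ forall n, l2 (u n), l2 f &
  (fun n => norm2 (u n - f)) @ \oo --> (0 : R)].

Lemma l2cvg_cst f : l2 f -> l2cvg (fun=> f) f.
Proof.
move=> hf; split=> //; rewrite subrr.
rewrite norm2_0; exact: cvg_cst.
Qed.

Lemma l2cvg_bounded u f : l2cvg u f -> \forall n \near \oo, norm2 (u n) <= norm2 f + 1.
Proof.
move=> [hu hf uf]; near=> n.
have -> : u n = f + (u n - f) by rewrite addrC subrK.
apply: le_trans (norm2_triangle hf (l2B (hu n) hf)) _; rewrite lerD2l.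
near: n; move/cvgrPdist_lt : uf => /(_ _ ltr01); apply: filterS => n.
by rewrite sub0r normrN ger0_norm ?norm2_ge0// => /ltW.
Unshelve. all: by end_near.
Qed.

Lemma l2cvg_rip u v f g : l2cvg u f -> l2cvg v g ->
  (fun n => rip (u n) (v n)) @ \oo --> rip f g.
Proof.
move=> uf vg; have vb := l2cvg_bounded vg.
case: (uf) (vg) => hu hf uf0 [hv hg vg0]; apply/subr_cvg0.
apply: (@rip_asymp u (fun=> f) v (fun=> g) (norm2 f + norm2 g + 1)) => //.
  by apply: filterS vb => n /le_trans; apply; rewrite -addrA lerDr norm2_ge0.
by near=> n; rewrite -addrA lerDl addr_ge0 ?norm2_ge0.
Unshelve. all: by end_near.
Qed.

Lemma l2cvg_norm2 u f : l2cvg u f -> (fun n => norm2 (u n)) @ \oo --> norm2 f.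
Proof.
move=> [hu hf uf]; apply/subr_cvg0; apply: cvg0_squeeze uf; near=> n.
have hd := l2B (hu n) hf.
have h1 : norm2 (u n) <= norm2 f + norm2 (u n - f).
  by apply: le_trans (norm2_triangle _ _) => //; rewrite addrC subrK.
have h2 : norm2 f <= norm2 (u n) + norm2 (u n - f).
  by apply: le_trans (norm2_triangleB _ _) => //; rewrite opprB addrC subrK.
by rewrite ler_norml; apply/andP; split; lra.
Unshelve. all: by end_near.
Qed.

Lemma rmulB phi f g : rmul phi (f - g) = rmul phi f - rmul phi g.
Proof. by apply/funext => s; rewrite !cochainE mulrBr. Qed.

Lemma l2cvg_rmul (a : R) phi u f : 0 <= a -> (forall s, `|phi s| <= a) ->
  l2cvg u f -> l2cvg (fun n => rmul phi (u n)) (rmul phi f).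
Proof.
move=> a0 pa [hu hf uf]; split.
- by move=> n; exact: l2_rmul pa (hu n).
- exact: l2_rmul pa hf.
- apply: (@cvg0_squeeze _ (fun n => a * norm2 (u n - f))).
    near=> n; rewrite ger0_norm ?norm2_ge0// -rmulB.
    by apply: norm2_rmul => //; exact: l2B.
  by rewrite -[X in _ --> X](mulr0 a); apply: cvgMl_tmp.
Unshelve. all: by end_near.
Qed.

Lemma inner_self f : l2 f -> inner f f = (rip f f)%:C%C.
Proof.
move=> hf; rewrite innerE; apply: cplx_eq => //=.
rewrite -[RHS](rip0l f) !ripE; apply: eq_rsum => s _.
by rewrite /rdens !cochainE !reimE /=; ring.
Qed.

End Convergence.

(** * Closability and independence of the approximating sequence *)

Section ClosedForm.
Context {V : countType} {R : realType} {X : weighted_complex V R}.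
Implicit Types (f g h : cochain X) (u v w z : nat -> cochain X).
Variable L : cochain X -> cochain X.
Hypothesis HL : form_operator L.

Let Llin := let: And3 h _ _ := HL in h.
Let Ll2 := let: And3 _ h _ := HL in h.
Let Lpt := let: And3 _ _ h := HL in h.

Definition lform : Defs.form X := fun f g => inner (L f) (L g).

Definition cauchy_image u := forall e : R, 0 < e -> exists N : nat, forall n k,
  (N <= n)%N -> (N <= k)%N -> norm2 (L (u n) - L (u k)) < e.

(** Since [Q(h, h) = ||L h||^2], being Cauchy for the form means that the images under [L] are
    Cauchy in norm. *)
Lemma form_approxP u f : l2 f -> form_approx lform u f <->
  [/\ forall n, finitely_supported (u n), l2cvg u f & cauchy_image u].
Proof.
move=> hf.
have E n k : (forall n, finitely_supported (u n)) ->
  Normc.normc (lform (u n \- u k) (u n \- u k)) = norm2 (L (u n) - L (u k)) ^+ 2.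
  move=> hu; rewrite /lform (_ : u n \- u k = u n - u k)//.
  rewrite (form_operatorB Llin (hu n) (hu k)) inner_self; last by apply: l2B; exact: Ll2.
  by rewrite normc_real ger0_norm ?rip_ge0// norm2_sqrE.
split=> [[hu uf uc]|[hu [_ _ uf] uc]]; split => //.
- by split => // n; exact: finitely_supported_l2.
- move=> e e0; have [|N hN] := uc (e ^+ 2); first by rewrite exprn_gt0.
  exists N => n k Nn Nk; have := hN n k Nn Nk.
  by rewrite E// ltr_pXn2r ?nnegrE ?norm2_ge0// ltW.
- move=> e e0; have [|N hN] := uc (Num.sqrt e); first by rewrite sqrtr_gt0.
  exists N => n k Nn Nk; rewrite E// -[ltRHS]sqr_sqrtr ?(ltW e0)//.
  by rewrite ltr_pXn2r ?nnegrE ?norm2_ge0 ?sqrtr_ge0// hN.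
Qed.

Lemma cauchy_image_bounded u : (forall n, finitely_supported (u n)) ->
  cauchy_image u -> exists M : R, \forall n \near \oo, norm2 (L (u n)) <= M.
Proof.
move=> hu uc; have [N hN] := uc 1 ltr01; exists (norm2 (L (u N)) + 1).
exists N => // n /= Nn; have hl k := Ll2 (hu k).
have -> : L (u n) = L (u N) + (L (u n) - L (u N)) by rewrite addrC subrK.
apply: le_trans (norm2_triangle (hl N) (l2B (hl n) (hl N))) _.
by rewrite lerD2l ltW// hN.
Qed.

Lemma cauchy_imageB u v : (forall n, finitely_supported (u n)) ->
  (forall n, finitely_supported (v n)) ->
  cauchy_image u -> cauchy_image v -> cauchy_image (fun n => u n - v n).
Proof.
move=> hu hv uc vc e e0; have e2 : 0 < e / 2 by rewrite divr_gt0.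
have [N hN] := uc _ e2; have [M hM] := vc _ e2.
exists (maxn N M) => n k; rewrite !geq_max => /andP[Nn Mn] /andP[Nk Mk].
rewrite (form_operatorB Llin (hu n) (hv n)) (form_operatorB Llin (hu k) (hv k)).
have -> : L (u n) - L (v n) - (L (u k) - L (v k)) =
  (L (u n) - L (u k)) - (L (v n) - L (v k)).
  by apply/funext => s; rewrite !cochainE; ring.
have lu m := Ll2 (hu m); have lv m := Ll2 (hv m).
apply: le_lt_trans (norm2_triangleB (l2B (lu n) (lu k)) (l2B (lv n) (lv k))) _.
by rewrite [ltRHS]splitr; apply: ltrD; [exact: hN|exact: hM].
Qed.

(* Closability: the images of a null sequence converge pointwise to zero, so
   Fatou's lemma bounds their norms by the Cauchy tails. *)
Lemma null_image z : (forall n, finitely_supported (z n)) ->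
  (fun n => norm2 (z n)) @ \oo --> (0 : R) -> cauchy_image z ->
  (fun n => norm2 (L (z n))) @ \oo --> (0 : R).
Proof.
move=> hz z0 zc; apply/cvgrPdist_le => e e0.
have e2 : 0 < e / 2 by rewrite divr_gt0.
have [N hN] := zc _ e2; exists N => // n /= Nn.
rewrite sub0r normrN ger0_norm ?norm2_ge0//.
rewrite -(@ler_pXn2r _ 2) ?nnegrE ?norm2_ge0 ?(ltW e0)// norm2_sqrE.
apply: rip_le_bound => F fF.
have Lpt' s : exists a : R, 0 <= a /\ forall f, finitely_supported f ->
    Normc.normc (L f s) <= a * norm2 f by have [a a0 ha] := Lpt s; exists a.
have [a ha] := choice Lpt'.
pose C := \sum_(s <- fset_set F) mass s * a s ^+ 2.
(* Over the finite set [F], with [n] fixed, [|L z_n|^2 <= 2 |L z_n - L z_k|^2 + 2 |L z_k|^2]. The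
   first term is controlled by the Cauchy tail; the second tends to 0 in [k] by the point evaluation
   bounds, collected in [C]. *)
have lim : (fun k => 2 * (e / 2) ^+ 2 + 2 * C * norm2 (z k) ^+ 2) @ \oo -->
    2 * (e / 2) ^+ 2.
  rewrite -[X in _ --> X]addr0; apply: cvgD; first exact: cvg_cst.
  rewrite -[X in _ --> X](mulr0 (2 * C)); apply: cvgMl_tmp.
  by rewrite -(mulr0 0); apply: cvgM.
apply: (@le_trans _ _ (2 * (e / 2) ^+ 2)); last by nra.
apply: (cvgr_to_ge lim); exists N => // k /= Nk.
have Ld : l2 (L (z n) - L (z k)) by apply: l2B; exact: Ll2.
have h1 : \sum_(s <- fset_set F) mass s * Normc.normc ((L (z n) - L (z k)) s) ^+ 2
    <= (e / 2) ^+ 2.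
  apply: le_trans (rip_finite_le Ld fF) _.
  by rewrite -norm2_sqrE ler_pXn2r ?nnegrE ?norm2_ge0 ?(ltW e2)// ltW// hN.
have h2 : \sum_(s <- fset_set F) mass s * Normc.normc (L (z k) s) ^+ 2
    <= C * norm2 (z k) ^+ 2.
  rewrite mulr_suml; apply: ler_sum => s _; rewrite -mulrA ler_wpM2l ?mass_ge0//.
  have [a0 {}ha] := ha s.
  rewrite -exprMn ler_pXn2r ?nnegrE ?normc_ge0 ?mulr_ge0 ?norm2_ge0//.
  exact: ha.
rewrite -mulrA -mulrDr; apply: le_trans (ler_wpM2l _ (lerD h1 h2)) => //.
rewrite -big_split/= mulr_sumr; apply: ler_sum => s _.
rewrite -mulrDr [leRHS]mulrCA ler_wpM2l ?mass_ge0// !normc_sqr !cochainE !reimE.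
move: (complex.Re (L (z n) s)) (complex.Im (L (z n) s)) => x y.
move: (complex.Re (L (z k) s)) (complex.Im (L (z k) s)) => x' y'.
have := sqr_ge0 (x - 2 * x'); have := sqr_ge0 (y - 2 * y').
by rewrite !sqrrD !sqrrN; nra.
Qed.

(** The difference of the two sequences is a null sequence with Cauchy image, so closability applies
    to it. *)
Lemma approx_image_unique u u' f : l2 f ->
  form_approx lform u f -> form_approx lform u' f ->
  (fun n => norm2 (L (u n) - L (u' n))) @ \oo --> (0 : R).
Proof.
move=> hf /(form_approxP u hf)[hu [ul _ uf] uc] /(form_approxP u' hf)[hu' [ul' _ uf'] uc'].
have -> : (fun n => norm2 (L (u n) - L (u' n))) = (fun n => norm2 (L (u n - u' n))).
  by apply/funext => n; rewrite (form_operatorB Llin (hu n) (hu' n)).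
apply: null_image; last exact: cauchy_imageB.
  by move=> n; exact: finitely_supportedB.
apply: (@cvg0_squeeze _ _ (fun n => norm2 (u n - f) + norm2 (u' n - f))).
  near=> n; rewrite ger0_norm ?norm2_ge0//.
  apply: le_trans (norm2_triangleB (l2B (ul n) hf) (l2B (ul' n) hf)).
  by rewrite opprB addrA subrK.
by rewrite -[X in _ --> X]addr0; exact: cvgD.
Unshelve. all: by end_near.
Qed.

(** [closure_form] only asserts that some pair of sequences computes the value [c]. Closability
    transfers it to any prescribed pair, which allows the choice of sequences adapted to a
    multiplication operator. *)
Lemma closure_form_cvg u v f g (c : R[i]) : l2 f -> l2 g ->
  form_approx lform u f -> form_approx lform v g -> closure_form lform f g c ->
  (fun n => rip (L (u n)) (L (v n))) @ \oo --> complex.Re c.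
Proof.
move=> hf hg uf vg [u' [v' [u'f v'g cv]]].
have ul := approx_image_unique hf uf u'f; have vl := approx_image_unique hg vg v'g.
have [fu _ _] := (form_approxP _ hf).1 uf.
have [fu' _ uc'] := (form_approxP _ hf).1 u'f.
have [fv _ vc] := (form_approxP _ hg).1 vg.
have [fv' _ _] := (form_approxP _ hg).1 v'g.
have [M1 hM1] := cauchy_image_bounded fu' uc'.
have [M2 hM2] := cauchy_image_bounded fv vc.
apply/subr_cvg0.
have -> : (fun n => rip (L (u n)) (L (v n)) - complex.Re c) =
   (fun n => (rip (L (u n)) (L (v n)) - rip (L (u' n)) (L (v' n))) +
      (rip (L (u' n)) (L (v' n)) - complex.Re c)).
  by apply/funext => n; rewrite addrA subrK.
rewrite -[X in _ --> X]addr0; apply: cvgD.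
  apply: (@rip_asymp _ _ _ _ _ _ _ (Num.max M1 M2) (fun n => Ll2 (fu n))
    (fun n => Ll2 (fu' n)) (fun n => Ll2 (fv n)) (fun n => Ll2 (fv' n)) ul vl).
    by apply: filterS hM2 => n h; rewrite le_max h orbT.
  by apply: filterS hM1 => n h; rewrite le_max h.
apply: cvg0_squeeze cv; near=> n.
by have := ler_normc_Re (lform (u' n) (v' n) - c); rewrite ReD ReN.
Unshelve. all: by end_near.
Qed.

Lemma form_approx_cst f : finitely_supported f -> form_approx lform (fun=> f) f.
Proof.
move=> hf; have lf := finitely_supported_l2 hf; apply/(form_approxP _ lf); split => //.
  exact: l2cvg_cst.
by move=> e e0; exists 0%N => *; rewrite subrr norm2_0.
Qed.

End ClosedForm.

(** * Hyperbolic estimates *)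

Section RealAnalysis.
Context {R : realType}.
Implicit Types (a b c x y z : R).

Lemma is_derive_expR_lin c x :
  is_derive x 1 (fun y => expR (c * y)) (c * expR (c * x)).
Proof.
have hZ : is_derive x 1 (fun y : R => c * y) c.
  have := @is_deriveZ R R R id c x 1 1 (is_derive_id x 1).
  by rewrite /GRing.scale /= mulr1.
have := is_derive1_comp (is_derive_expR (c * x)) hZ.
by rewrite mulrC.
Qed.

Lemma is_derive_bound (f df : R -> R) a b c : a <= b ->
  (forall x, is_derive x 1 f (df x)) ->
  (forall x, a <= x <= b -> df x <= c) -> f b - f a <= c * (b - a).
Proof.
move=> ab hf hdf.
have cf : {within `[a, b], continuous f}.
  apply: continuous_subspaceT => x; apply: differentiable_continuous.
  by apply/derivable1_diffP; have [] := hf x.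
have [x xab ->] := MVT_segment ab (fun x _ => hf x) cf.
by rewrite ler_wpM2r ?subr_ge0// hdf// -in_itv.
Qed.

Lemma coshR_mono x y : `|x| <= y -> expR x + expR (- x) <= expR y + expR (- y).
Proof.
wlog x0 : x / 0 <= x => [wl h|].
  have [/wl->//|/ltW x0] := leP 0 x.
  by rewrite addrC -{2}(opprK x) wl ?oppr_ge0// normrN.
rewrite ger0_norm// => xy.
have e0 : 0 < expR x by exact: expR_gt0.
have ex : 1 <= expR x by rewrite -expR0 ler_expR.
have exy : expR x <= expR y by rewrite ler_expR.
rewrite !expRN; set u := expR x in e0 ex exy *; set v := expR y in exy *.
have v0 : 0 < v by apply: lt_le_trans exy.
rewrite -subr_ge0.
have -> : v + v^-1 - (u + u^-1) = (v - u) * (u * v - 1) / (u * v).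
  by field; rewrite !gt_eqF.
have uv1 : 1 <= u * v by rewrite mulr_ege1//; lra.
by apply: divr_ge0; [apply: mulr_ge0; lra|lra].
Qed.

(** Convexity of [sinh] on the half-line: the difference of the two sides vanishes at 0, and its
    derivative has the sign of [cosh (th * y) - cosh y <= 0]. *)
Lemma sinh_scale (th w : R) : 0 <= th <= 1 -> 0 <= w ->
  expR (th * w) - expR (- (th * w)) <= th * (expR w - expR (- w)).
Proof.
move=> /andP[th0 th1] w0.
pose f y := (expR (th * y) - expR (- th * y)) - th * (expR (1 * y) - expR (-1 * y)).
pose df y := (th * expR (th * y) - (- th) * expR (- th * y))
   - th * (1 * expR (1 * y) - (-1) * expR (-1 * y)).
have hf y : is_derive y 1 f (df y).
  apply: is_deriveB.
    by apply: is_deriveB; exact: is_derive_expR_lin.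
  apply: (@is_deriveZ _ _ _ (fun y => expR (1 * y) - expR (-1 * y)) th).
  by apply: is_deriveB; exact: is_derive_expR_lin.
have := @is_derive_bound f df 0 w 0 w0 hf.
rewrite /f /df !mulr0 expR0 !subrr mulr0 !subr0 mul0r.
rewrite !(mulN1r, mul1r, mulNr) => h.
suff : expR (th * w) - expR (- (th * w)) - th * (expR w - expR (- w)) <= 0.
  by rewrite subr_le0.
apply: h => x /andP[x0 _]; rewrite !(mulN1r, mul1r, mulNr, opprK).
have := @coshR_mono (th * x) x.
rewrite ger0_norm ?mulr_ge0// ler_piMl// => /(_ isT) h.
by rewrite -mulrDr -mulrBr; nra.
Qed.

Definition coshm1 z := (expR z + expR (- z)) / 2 - 1.

(** This is [cosh z - 1 = 2 sinh (z / 2) ^ 2], which turns linear scaling of [sinh] into quadratic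
    scaling of [coshm1]. *)
Lemma coshm1_sinh z : coshm1 z = (expR (z / 2) - expR (- (z / 2))) ^+ 2 / 2.
Proof.
have e1 : expR z = expR (z / 2) * expR (z / 2) by rewrite -expRD -splitr.
have e2 : expR (- z) = expR (- (z / 2)) * expR (- (z / 2)).
  by rewrite -expRD -opprD -splitr.
have e3 : expR (z / 2) * expR (- (z / 2)) = 1 by rewrite -expRD subrr expR0.
rewrite /coshm1 e1 e2; set u := expR (z / 2) in e3 *; set v := expR _ in e3 *.
have -> : (u - v) ^+ 2 / 2 = (u * u + v * v) / 2 - u * v by field.
by rewrite e3.
Qed.

Lemma coshm1_ge0 z : 0 <= coshm1 z.
Proof. by rewrite coshm1_sinh divr_ge0// sqr_ge0. Qed.

(** [(cosh z - 1) / z ^ 2] increases with [|z|], here in the form [sinh (k dl / 2) <= (dl / s) sinh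
    (k s / 2)]. The factor [dl ^ 2] is what an intrinsic metric can absorb, and the constant is
    sharp at [dl = s]. *)
Lemma coshm1_scale (k s dl z : R) : 0 <= k -> 0 < s -> 0 <= dl <= s ->
  `|z| <= k * dl -> `|coshm1 z| <= coshm1 (k * s) / s ^+ 2 * dl ^+ 2.
Proof.
move=> k0 s0 /andP[d0 ds] zk; rewrite ger0_norm ?coshm1_ge0//.
apply: (@le_trans _ _ (coshm1 (k * dl))).
  by rewrite /coshm1 lerD2r ler_pM2r ?invr_gt0// coshR_mono.
rewrite !coshm1_sinh.
have th : 0 <= dl / s <= 1.
  by rewrite divr_ge0 ?(ltW s0)//= ler_pdivrMr// mul1r.
have w0 : 0 <= k * s / 2 by rewrite divr_ge0// mulr_ge0// ltW.
have := sinh_scale th w0.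
have -> : dl / s * (k * s / 2) = k * dl / 2 by field; rewrite gt_eqF.
set A := expR (k * dl / 2) - _; set B := expR (k * s / 2) - _ => AB.
have A0 : 0 <= A.
  by rewrite subr_ge0 ler_expR; have := mulr_ge0 k0 d0; lra.
have -> : B ^+ 2 / 2 / s ^+ 2 * dl ^+ 2 = (dl / s * B) ^+ 2 / 2.
  by field; rewrite gt_eqF.
rewrite ler_pM2r ?invr_gt0// ler_pXn2r// nnegrE//.
exact: le_trans A0 AB.
Qed.

(** The exponent [t (cosh (k s) - 1) / s ^ 2 - k D] is stationary in [k] when
    [sinh (k s) = s D / t]. There [cosh (k s) = sqrt (1 + r ^ 2)] with [r = s D / t], and the value
    is expressed by [zeta]. *)
Lemma arcsinh_zeta (s t D : R) : 0 < s -> 0 < t -> 0 <= D ->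
  let k := arcsinh (s * D / t) / s in
  0 <= k /\ t * (coshm1 (k * s) / s ^+ 2) - k * D = - (t / s ^+ 2 * zeta (s * D / t)).
Proof.
move=> s0 t0 D0 /=.
set r := s * D / t.
have r0 : 0 <= r by rewrite divr_ge0 ?mulr_ge0// ltW.
have q0 : 0 <= 1 + r ^+ 2 by rewrite addr_ge0// sqr_ge0.
set q := Num.sqrt (1 + r ^+ 2).
have q1 : 1 <= q.
  by rewrite -[leLHS]sqrtr1 ler_wsqrtr// lerDl sqr_ge0.
have qq : q ^+ 2 = 1 + r ^+ 2 by rewrite sqr_sqrtr.
have rq1 : 1 <= r + q by rewrite (le_trans q1)// lerDr.
have rq0 : 0 < r + q by apply: lt_le_trans rq1.
split; first by rewrite divr_ge0 ?(ltW s0)// /arcsinh ln_ge0.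
rewrite divfK ?gt_eqF// /coshm1 expRN /zeta /arcsinh -/q lnK ?posrE//.
have -> : (r + q)^-1 = q - r.
  by apply: (mulIf (lt0r_neq0 rq0)); rewrite mulVf ?lt0r_neq0//; lra.
have -> : D = r * t / s by rewrite /r; field; rewrite !gt_eqF.
by field; rewrite !gt_eqF.
Qed.

End RealAnalysis.

(** * Exponential perturbation of the form *)

Section Perturbation.
Context {V : countType} {R : realType} {X : weighted_complex V R}.
Implicit Types (f g h : cochain X) (u v w z : nat -> cochain X).
Variable L : cochain X -> cochain X.
Hypothesis HL : form_operator L.

Let Llin := let: And3 h _ _ := HL in h.
Let Ll2 := let: And3 _ h _ := HL in h.

Variable d : simplex X -> simplex X -> R.
Hypothesis hd : intrinsic_metric (edge_weight (lform L)) d.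
Let b := edge_weight (lform L).

Definition coef f (x : simplex X) : cochain X := zscale (f x) (delta1 x).
(** The real matrix of the form in the coordinates of [f]. Multiplying [f] by real functions
    rescales its entries, so every perturbed form is a weighted sum of the same [pairing]. *)
Definition pairing f (x y : simplex X) : R := rip (L (coef f x)) (L (coef f y)).

Lemma finitely_supported_coef f x : finitely_supported (coef f x).
Proof. exact/finitely_supportedZ/finitely_supported_delta1. Qed.

Lemma pairingC f x y : pairing f x y = pairing f y x.
Proof. exact: ripC. Qed.

Lemma edge_weight_sym x y : b x y = b y x.
Proof.
rewrite /b /edge_weight eq_sym; case: eqP => // _.
by rewrite /lform innerC; case: (inner _ _) => p q /=; rewrite sqrrN.
Qed.

Lemma edge_weight_ge0 x y : 0 <= b x y.
Proof. by rewrite /b /edge_weight; case: ifP => // _; exact: normc_ge0. Qed.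

Lemma pairing_le f x y : x != y ->
  `|pairing f x y| <= b x y * (Normc.normc (f x) * Normc.normc (f y)).
Proof.
move=> xy; rewrite edge_weight_sym /b /edge_weight eq_sym (negbTE xy) /pairing /coef.
have fd := @finitely_supported_delta1 _ _ X.
rewrite !(form_operatorZ Llin _ (fd _)).
have lx := Ll2 (fd x); have ly := Ll2 (fd y).
apply: le_trans (ler_normc_Re _) _.
rewrite inner_zscale//; last exact: l2Z.
rewrite innerC inner_zscale// Normc.normcM.
have nJ (z : R[i]) : Normc.normc (z^*)%C = Normc.normc z.
  by case: z => p q /=; rewrite sqrrN.
rewrite nJ Normc.normcM /lform.
by rewrite mulrA mulrC [inner (L (delta1 y)) _]innerC nJ.
Qed.

Lemma rmul_decomp phi f : finitely_supported f ->
  rmul phi f = \sum_(x <- fset_set (supp f)) zscale (phi x)%:C%C (coef f x).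
Proof.
move=> hf; apply/funext => s; rewrite cochain_sumE cochainE {1}(delta1_decomp hf).
rewrite cochain_sumE mulr_sumr; apply: eq_bigr => x _.
rewrite /coef !cochainE /delta1; have [->//|_] := eqVneq s x.
by rewrite !mulr0.
Qed.

Lemma rmul_expansion phi chi f : finitely_supported f ->
  rip (L (rmul phi f)) (L (rmul chi f)) =
  \sum_(x <- fset_set (supp f)) \sum_(y <- fset_set (supp f))
    phi x * chi y * pairing f x y.
Proof.
move=> hf; have fc := finitely_supported_coef f; have lc x := Ll2 (fc x).
have fz (psi : simplex X -> R) x : finitely_supported (zscale (psi x)%:C%C (coef f x)).
  exact: finitely_supportedZ.
have E psi : L (rmul psi f) =
    \sum_(x <- fset_set (supp f)) zscale (psi x)%:C%C (L (coef f x)).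
  rewrite rmul_decomp// (form_operator_sum Llin _ (fz psi)).
  by apply: eq_bigr => x _; rewrite (form_operatorZ Llin).
have lz (psi : simplex X -> R) x : l2 (zscale (psi x)%:C%C (L (coef f x))).
  exact: l2Z.
rewrite !E rip_suml//; last by apply: l2_sum => x _; exact: lz.
apply: eq_bigr => x _; rewrite rip_sumr//; apply: eq_bigr => y _.
by rewrite ripZl// ripZr// mulrA.
Qed.

Lemma intrinsic_sum_le x (F : set (simplex X)) : finite_set F ->
  \sum_(y <- fset_set F) b x y * d x y ^+ 2 <= mass x.
Proof.
move=> fF; have := hd.2 x; have m0 := mass_gt0 x.
set S := esum _ _ => hS.
have bd0 y : 0 <= b x y * d x y ^+ 2 by rewrite mulr_ge0 ?edge_weight_ge0 ?sqr_ge0.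
have le : ((\sum_(y <- fset_set F) b x y * d x y ^+ 2)%:E <= S)%E.
  exact: esum_ge_finite.
have : (((mass x)^-1)%:E * (\sum_(y <- fset_set F) b x y * d x y ^+ 2)%:E <= 1)%E.
  by apply: le_trans hS; rewrite lee_wpmul2l// lee_fin invr_ge0 ltW.
by rewrite -EFinM lee_fin mulrC ler_pdivrMr// mul1r.
Qed.

(** A Schur test: [|f x| |f y|] is split into half squares, and the intrinsic condition bounds each
    row sum of [b x y * d x y ^ 2] by [mass x]. The diagonal, not controlled by [b], is removed by
    [k x x = 0]; where [b] vanishes off the diagonal, so does [pairing]. *)
Lemma kernel_bound (k : simplex X -> simplex X -> R) (c : R) f :
  finitely_supported f -> 0 <= c -> (forall x, k x x = 0) ->
  (forall x y, 0 < b x y -> `|k x y| <= c * d x y ^+ 2) ->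
  `|\sum_(x <- fset_set (supp f)) \sum_(y <- fset_set (supp f)) k x y * pairing f x y|
  <= c * rip f f.
Proof.
move=> hf c0 k0 kd; have [_ _ dC _] := hd.1.
set F := fset_set (supp f).
pose A x y := c / 2 * Normc.normc (f x) ^+ 2 * (b x y * d x y ^+ 2).
have kA x y : `|k x y * pairing f x y| <= A x y + A y x.
  rewrite normrM; have b0 := edge_weight_ge0 x y.
  rewrite /A -(edge_weight_sym x y) (dC y x).
  have [->|xy] := eqVneq x y.
    rewrite k0 normr0 mul0r.
    have A0 : 0 <= c / 2 * Normc.normc (f y) ^+ 2 * (b y y * d y y ^+ 2).
      apply: mulr_ge0; first by rewrite mulr_ge0 ?sqr_ge0// divr_ge0.
      by apply: mulr_ge0; [exact: edge_weight_ge0|exact: sqr_ge0].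
    exact: addr_ge0.
  have pb := pairing_le f xy.
  have [b00|b00] := eqVneq (b x y) 0.
    by move: pb; rewrite b00 !mul0r normr_le0 => /eqP ->; rewrite normr0 !mulr0 addr0.
  have bp : 0 < b x y by rewrite lt_neqAle eq_sym b00.
  apply: le_trans (ler_pM _ _ (kd _ _ bp) pb) _ => //.
  set p := Normc.normc (f x); set q := Normc.normc (f y); set e := d x y ^+ 2.
  have e0 : 0 <= e := sqr_ge0 _.
  have -> : c / 2 * p ^+ 2 * (b x y * e) + c / 2 * q ^+ 2 * (b x y * e) =
     c * e * (b x y * ((p ^+ 2 + q ^+ 2) / 2)) by field.
  apply: ler_wpM2l; first exact: mulr_ge0.
  apply: ler_wpM2l; first exact: b0.
  by have := sqr_ge0 (p - q); rewrite sqrrB; lra.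
have sA : \sum_(x <- F) \sum_(y <- F) A x y <= c / 2 * rip f f.
  apply: (@le_trans _ _ (c / 2 * \sum_(x <- F) mass x * Normc.normc (f x) ^+ 2)).
    rewrite mulr_sumr; apply: ler_sum => x _.
    rewrite -mulr_sumr.
    have -> : c / 2 * (mass x * Normc.normc (f x) ^+ 2) =
      c / 2 * Normc.normc (f x) ^+ 2 * mass x by ring.
    apply: ler_wpM2l; first by rewrite mulr_ge0 ?sqr_ge0// divr_ge0.
    exact: intrinsic_sum_le.
  rewrite ler_wpM2l ?divr_ge0//; apply: rip_finite_le => //.
  exact: finitely_supported_l2.
apply: le_trans (ler_norm_sum _ _ _) _.
apply: (@le_trans _ _ (\sum_(x <- F) \sum_(y <- F) (A x y + A y x))).
  by apply: ler_sum => x _; apply: le_trans (ler_norm_sum _ _ _) _; apply: ler_sum.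
under eq_bigr do rewrite big_split/=.
rewrite big_split/= [X in _ + X]exchange_big/=.
by have := sA; lra.
Qed.

Section Exponential.
Variable s : R.
Hypothesis hs0 : 0 < s.
Hypothesis hs : forall x y, 0 < b x y -> d x y <= s.

(** Meant for [g = phi u] with [phi = exp psi]: the two arguments on the right are then [u] and
    [phi^2 u]. *)
Lemma form_exp_lower (psi : simplex X -> R) (k : R) g :
  finitely_supported g -> 0 <= k -> (forall x y, `|psi x - psi y| <= k * d x y) ->
  rip (L g) (L g) - coshm1 (k * s) / s ^+ 2 * rip g g <=
  rip (L (rmul (fun x => expR (- psi x)) g)) (L (rmul (fun x => expR (psi x)) g)).
Proof.
move=> hg k0 hpsi; have [d0 _ _ _] := hd.1.
set c := coshm1 _ / _.
have c0 : 0 <= c by rewrite divr_ge0 ?sqr_ge0// coshm1_ge0.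
have E1 : rip (L g) (L g) = \sum_(x <- fset_set (supp g)) \sum_(y <- fset_set (supp g))
    pairing g x y.
  have gE : g = rmul (fun=> 1) g by apply/funext => x; rewrite cochainE mul1r.
  rewrite {1 2}gE rmul_expansion//.
  by apply: eq_bigr => x _; apply: eq_bigr => y _; rewrite !mul1r.
rewrite rmul_expansion//.
set S := (X in _ <= X).
(* Averaging [S] with its transpose replaces [exp (psi y - psi x)] by [cosh (psi x - psi y)], and
   the excess over 1 goes to [kernel_bound]. *)
have S2 : S = \sum_(x <- fset_set (supp g)) \sum_(y <- fset_set (supp g))
    (coshm1 (psi x - psi y) + 1) * pairing g x y.
  have -> : S = (S + S) / 2 by field.
  rewrite {2}/S exchange_big/= -big_split/= mulr_suml; apply: eq_bigr => x _.
  rewrite -big_split/= mulr_suml; apply: eq_bigr => y _.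
  rewrite (pairingC _ y x) /coshm1 -!expRD opprB [- psi x + _]addrC [- psi y + _]addrC.
  by field.
have H1 x : coshm1 (psi x - psi x) = 0.
  by rewrite subrr /coshm1 oppr0 expR0; field.
have H2 x y : 0 < b x y -> `|coshm1 (psi x - psi y)| <= c * d x y ^+ 2.
  by move=> bxy; apply: coshm1_scale => //; rewrite d0 hs.
have := @kernel_bound (fun x y => coshm1 (psi x - psi y)) c g hg c0 H1 H2.
rewrite S2 E1 ler_norml => /andP[+ _].
under [X in _ -> _ <= X]eq_bigr do under eq_bigr do rewrite mulrDl mul1r.
under [X in _ -> _ <= X]eq_bigr do rewrite big_split/=.
rewrite big_split/=; lra.
Qed.

End Exponential.

(** The bound [1 / 2] keeps [chi = sqrt (1 - phi^2)] away from 0, where the root is not Lipschitz.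
    Since [(chi x - chi y)(chi x + chi y) = - (phi x - phi y)(phi x + phi y)] and
    [|phi x + phi y| <= 1 <= chi x + chi y], [chi] varies no more than [phi]. *)
Lemma form_mul_half (phi : simplex X -> R) (l : R) g :
  finitely_supported g -> 0 <= l -> (forall x, `|phi x| <= 1 / 2) ->
  (forall x y, `|phi x - phi y| <= l * d x y) ->
  rip (L (rmul phi g)) (L (rmul phi g)) <= rip (L g) (L g) + l ^+ 2 * rip g g.
Proof.
move=> hg l0 phib phil; have [d0 _ _ _] := hd.1.
pose chi x := Num.sqrt (1 - phi x ^+ 2).
have ph2 x : phi x ^+ 2 <= 1 / 4.
  have := phib x; rewrite ler_norml => /andP[p1 p2]; nra.
have chi2 x : chi x ^+ 2 = 1 - phi x ^+ 2.
  by rewrite sqr_sqrtr//; have := ph2 x; lra.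
have chi0 x : 1 / 2 <= chi x.
  have : 0 <= chi x by exact: sqrtr_ge0.
  have := chi2 x; have := ph2 x; nra.
have dphi x y : (phi x - phi y) ^+ 2 <= l ^+ 2 * d x y ^+ 2.
  rewrite -exprMn -[(phi x - phi y) ^+ 2]real_normK ?num_real//.
  by rewrite ler_pXn2r ?nnegrE ?mulr_ge0.
have dchi x y : (chi x - chi y) ^+ 2 <= (phi x - phi y) ^+ 2.
  have e : (chi x - chi y) * (chi x + chi y) = - ((phi x - phi y) * (phi x + phi y)).
    by have := chi2 x; have := chi2 y; rewrite -!subr_sqr; lra.
  have c1 : 1 <= chi x + chi y by have := chi0 x; have := chi0 y; lra.
  have p1 : (phi x + phi y) ^+ 2 <= 1.
    have := phib x; have := phib y; rewrite !ler_norml => /andP[? ?] /andP[? ?]; nra.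
  have e2 : (chi x - chi y) ^+ 2 * (chi x + chi y) ^+ 2 =
            (phi x - phi y) ^+ 2 * (phi x + phi y) ^+ 2.
    by rewrite -!exprMn e sqrrN.
  have c2 : 1 <= (chi x + chi y) ^+ 2 by rewrite exprn_ege1.
  apply: (@le_trans _ _ ((chi x - chi y) ^+ 2 * (chi x + chi y) ^+ 2)).
    by rewrite ler_peMr// sqr_ge0.
  by rewrite e2 ler_piMr// sqr_ge0.
have E1 : rip (L g) (L g) = \sum_(x <- fset_set (supp g)) \sum_(y <- fset_set (supp g))
    pairing g x y.
  have gE : g = rmul (fun=> 1) g by apply/funext => x; rewrite cochainE mul1r.
  rewrite {1 2}gE rmul_expansion//.
  by apply: eq_bigr => x _; apply: eq_bigr => y _; rewrite !mul1r.
(* As [phi^2 + chi^2 = 1], this kernel equals [- ((phi x - phi y)^2 + (chi x - chi y)^2) / 2]. *)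
have := @kernel_bound (fun x y => phi x * phi y + chi x * chi y - 1) (l ^+ 2) g hg
   (sqr_ge0 _).
have H1 x : phi x * phi x + chi x * chi x - 1 = 0 by have := chi2 x; lra.
have H2 x y : 0 < b x y -> `|phi x * phi y + chi x * chi y - 1| <= l ^+ 2 * d x y ^+ 2.
  move=> _; have := dphi x y; have := dchi x y; have := chi2 x; have := chi2 y.
  have := sqr_ge0 (phi x - phi y); have := sqr_ge0 (chi x - chi y).
  rewrite !sqrrB ler_norml => *; apply/andP; split; lra.
move=> /(_ H1 H2); rewrite ler_norml => /andP[_].
under eq_bigr do under eq_bigr do rewrite mulrBl mulrDl mul1r.
under eq_bigr do rewrite sumrB big_split/=.
rewrite sumrB big_split/= -E1 -!rmul_expansion//.
have := rip_ge0 (L (rmul chi g)); lra.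
Qed.

Lemma zscale_rmul (a : R) phi g : zscale a%:C%C (rmul phi g) = rmul (fun x => a * phi x) g.
Proof. by apply/funext => x; rewrite !cochainE rmorphM/= mulrA. Qed.

Lemma form_mul_bound (phi : simplex X -> R) (a l : R) :
  0 < a -> 0 <= l -> (forall x, `|phi x| <= a) ->
  (forall x y, `|phi x - phi y| <= l * d x y) ->
  exists2 K : R, 0 < K & forall g, finitely_supported g ->
    norm2 (L (rmul phi g)) ^+ 2 <= K * (norm2 (L g) ^+ 2 + norm2 g ^+ 2).
Proof.
(* Scaling by [e] brings [phi] under the bound [1 / 2] of [form_mul_half]; undoing it costs the
   factor [(2 * a) ^+ 2]. *)
move=> a0 l0 pa pl; pose e := (2 * a)^-1.
have e0 : 0 < e by rewrite invr_gt0 mulr_gt0.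
have ea : 2 * a * e = 1 by rewrite divff// gt_eqF// mulr_gt0.
exists ((2 * a) ^+ 2 * (1 + (e * l) ^+ 2)).
  by rewrite mulr_gt0 ?exprn_gt0 ?mulr_gt0// ltr_wpDr// sqr_ge0.
move=> g hg; rewrite !norm2_sqrE.
have fe : finitely_supported (rmul (fun x => e * phi x) g).
  exact: finitely_supported_rmul.
have E : L (rmul phi g) = zscale (2 * a)%:C%C (L (rmul (fun x => e * phi x) g)).
  rewrite -(form_operatorZ Llin)// zscale_rmul; congr (L (rmul _ g)).
  by apply/funext => x; rewrite mulrA ea mul1r.
have le := Ll2 fe.
rewrite E ripZl ?ripZr//; last exact: l2Z.
rewrite mulrA -expr2 -mulrA ler_wpM2l ?sqr_ge0//.
have h1 x : `|e * phi x| <= 1 / 2.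
  rewrite normrM (gtr0_norm e0); have := pa x.
  have -> : 1 / 2 = e * a by lra.
  by rewrite ler_pM2l.
have h2 x y : `|e * phi x - e * phi y| <= e * l * d x y.
  by rewrite -mulrBr normrM (gtr0_norm e0) -mulrA ler_pM2l.
have := form_mul_half hg (mulr_ge0 (ltW e0) l0) h1 h2.
have := rip_ge0 g; have := rip_ge0 (L g); have := sqr_ge0 (e * l); nra.
Qed.

(** Besides keeping [rmul phi f] in the form domain, this provides an explicit approximating
    sequence, along which the finitely supported inequalities pass to the limit. *)
Lemma form_approx_rmul (phi : simplex X -> R) (a l : R) u f :
  0 < a -> 0 <= l -> (forall x, `|phi x| <= a) ->
  (forall x y, `|phi x - phi y| <= l * d x y) -> l2 f ->
  form_approx (lform L) u f ->
  form_approx (lform L) (fun n => rmul phi (u n)) (rmul phi f).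
Proof.
move=> a0 l0 pa pl hf /(form_approxP HL u hf)[fu uf uc].
have [K K0 hK] := form_mul_bound a0 l0 pa pl.
apply/(form_approxP HL); first exact: l2_rmul pa hf.
split; first by move=> n; exact: finitely_supported_rmul.
  exact: l2cvg_rmul (ltW a0) pa uf.
move=> e e0; pose e' := Num.sqrt (e ^+ 2 / (4 * K)).
have e'0 : 0 < e' by rewrite sqrtr_gt0 divr_gt0 ?exprn_gt0 ?mulr_gt0.
have e'2 : K * (e' ^+ 2 + e' ^+ 2) = e ^+ 2 / 2.
  rewrite sqr_sqrtr; last by rewrite divr_ge0 ?sqr_ge0// mulr_ge0// ltW.
  by field; rewrite gt_eqF.
have [N hN] := uc _ e'0.
have [_ _ uf0] := uf.
have e'' : 0 < e' / 2 by rewrite divr_gt0.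
have [M _ hM] := (cvgrPdist_lt _ _).1 uf0 _ e''.
exists (maxn N M) => n k; rewrite !geq_max => /andP[Nn Mn] /andP[Nk Mk].
rewrite -(form_operatorB Llin (finitely_supported_rmul _ (fu n))
  (finitely_supported_rmul _ (fu k))) -rmulB.
have fd := finitely_supportedB (fu n) (fu k).
rewrite -(@ltr_pXn2r _ 2) ?nnegrE ?norm2_ge0 ?(ltW e0)//.
apply: le_lt_trans (hK _ fd) _.
apply: (@le_lt_trans _ _ (e ^+ 2 / 2)); last first.
  by rewrite ltr_pdivrMr// ltr_pMr ?exprn_gt0// ltr1n.
rewrite -e'2 ler_pM2l// lerD//.
  rewrite ler_pXn2r ?nnegrE ?norm2_ge0 ?(ltW e'0)//.
  by rewrite (form_operatorB Llin (fu n) (fu k)) ltW// hN.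
rewrite ler_pXn2r ?nnegrE ?norm2_ge0 ?(ltW e'0)//.
have un m := finitely_supported_l2 (fu m).
have -> : u n - u k = (u n - f) - (u k - f) by rewrite opprB addrA subrK.
apply: le_trans (norm2_triangleB (l2B (un n) hf) (l2B (un k) hf)) _.
have := hM n Mn; have := hM k Mk; rewrite /= !sub0r !normrN.
rewrite !ger0_norm ?norm2_ge0// => *; lra.
Qed.

End Perturbation.

(** * The operator of the closed form *)

Section OperatorBounds.
Context {V : countType} {R : realType} {X : weighted_complex V R}.
Implicit Types (f g h : cochain X) (u v w z : nat -> cochain X).
Variable L : cochain X -> cochain X.
Hypothesis HL : form_operator L.

Let Llin := let: And3 h _ _ := HL in h.
Let Ll2 := let: And3 _ h _ := HL in h.

Lemma expR_lipschitz (M x y : R) : `|x| <= M -> `|y| <= M ->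
  `|expR x - expR y| <= expR M * `|x - y|.
Proof.
wlog xy : x y / x <= y => [wl hx hy|].
  have [xy|/ltW xy] := leP x y; first exact: wl.
  by rewrite distrC (distrC x) wl.
move=> _ yM; rewrite distrC (distrC x).
rewrite !ger0_norm ?subr_ge0 ?ler_expR//.
apply: (@le_trans _ _ (expR y * (y - x))).
  have := expR_ge1Dx (x - y); rewrite expRD expRN => h.
  have e0 := expR_gt0 y.
  have -> : expR x = expR y * (expR x / expR y) by field; rewrite gt_eqF.
  by rewrite -{1}[expR y]mulr1 -mulrBr ler_pM2l//; lra.
rewrite ler_wpM2r ?subr_ge0// ler_expR.
exact: le_trans (ler_norm _) yM.
Qed.

Lemma closure_domI u f : l2 f -> form_approx (lform L) u f -> closure_dom (lform L) f.
Proof. by move=> hf uf; split => //; exists u. Qed.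

(** Testing the operator equation against [phi^2 f] expresses [<g, phi^2 f>] as the limit of the
    form at [u n] and [phi^2 u n], where the finitely supported estimate applies. *)
Lemma operator_exp_lower (d : simplex X -> simplex X -> R) (s : R)
    (psi : simplex X -> R) (k M a0 : R) (f g : cochain X) :
  intrinsic_metric (edge_weight (lform L)) d -> 0 < s ->
  (forall x y, 0 < edge_weight (lform L) x y -> d x y <= s) ->
  0 <= k -> (forall x y, `|psi x - psi y| <= k * d x y) ->
  (forall x, `|psi x| <= M) ->
  (forall h, finitely_supported h -> a0 * rip h h <= rip (L h) (L h)) ->
  associated_operator (lform L) f g ->
  let phif := rmul (fun x => expR (psi x)) f in
  (a0 - coshm1 (k * s) / s ^+ 2) * rip phif phif <=
  rip g (rmul (fun x => expR (psi x)) phif).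
Proof.
move=> hd s0 hs k0 psik psiM ha0 [[hf [u uf]] hg Dfg] /=.
set C := coshm1 _ / _; set phi := fun x => expR (psi x).
pose phi2 x := expR (2 * psi x).
have phi2E h : rmul phi (rmul phi h) = rmul phi2 h.
  apply/funext => x; rewrite !cochainE mulrA -rmorphM/= /phi /phi2 -expRD.
  by congr ((expR _)%:C%C * _); ring.
have psiM2 x : `|2 * psi x| <= 2 * M by rewrite normrM ger0_norm// ler_pM2l.
have phib x : `|phi x| <= expR M.
  rewrite ger0_norm ?expR_ge0// ler_expR.
  exact: le_trans (ler_norm _) (psiM x).
have phi2b x : `|phi2 x| <= expR (2 * M).
  rewrite ger0_norm ?expR_ge0// ler_expR.
  exact: le_trans (ler_norm _) (psiM2 x).
have phi2l x y : `|phi2 x - phi2 y| <= expR (2 * M) * (2 * k) * d x y.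
  apply: le_trans (expR_lipschitz (psiM2 x) (psiM2 y)) _.
  rewrite -mulrA ler_wpM2l ?expR_ge0// -mulrBr normrM ger0_norm// -mulrA.
  by rewrite ler_pM2l.
have l0 : 0 <= expR (2 * M) * (2 * k) by rewrite !mulr_ge0 ?expR_ge0.
have uf2 := form_approx_rmul HL hd (expR_gt0 (2 * M)) l0 phi2b phi2l hf uf.
have hf2 : l2 (rmul phi2 f) by exact: l2_rmul phi2b hf.
have cf := Dfg _ (closure_domI hf2 uf2).
have lim := closure_form_cvg HL hf hf2 uf uf2 cf.
have [fu ul _] := (form_approxP HL u hf).1 uf.
have ulp := l2cvg_rmul (expR_ge0 M) phib ul.
have lim2 := l2cvg_rip ulp ulp.
rewrite phi2E; apply: (ler_cvg_to (cvgMl_tmp (a := a0 - C) lim2) lim).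
near=> n.
(* With [phi (u n)] in the role of [g], the arguments of the form become [phi^-1 phi (u n) = u n]
   and [phi^2 (u n)]. *)
have fg := finitely_supported_rmul phi (fu n).
have := form_exp_lower HL hd s0 hs fg k0 psik.
have -> : rmul (fun x => expR (- psi x)) (rmul phi (u n)) = u n.
  apply/funext => x; rewrite !cochainE mulrA -rmorphM/= /phi -expRD addNr expR0.
  by rewrite mul1r.
rewrite phi2E -/C; apply: le_trans.
by rewrite mulrBl lerD2r ha0.
Unshelve. all: by end_near.
Qed.

(* Cauchy-Schwarz for the form [Q - a0], which satisfies
   [(Q - a0)(w, f) = ||f||^2] and [(Q - a0)(w, w) = <f, w>]. *)
Lemma form_resolvent_gap (a0 C : R) (f w : cochain X) :
  (forall h, finitely_supported h -> a0 * rip h h <= rip (L h) (L h)) ->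
  finitely_supported f -> 0 < C -> l2 w -> norm2 w <= C * norm2 f ->
  associated_operator (lform L) w (fun s => f s + a0%:C%C * w s) ->
  (a0 + C^-1) * rip f f <= rip (L f) (L f).
Proof.
move=> ha0 ff C0 hw wC [[_ [u uw]] hg Dw].
have hf := finitely_supported_l2 ff.
have gE : (fun s => f s + a0%:C%C * w s) = f + zscale a0%:C%C w by [].
have haw := l2Z a0%:C%C hw.
have cf := Dw _ (closure_domI hf (form_approx_cst HL ff)).
have cw := Dw _ (closure_domI hw uw).
have lim1 := closure_form_cvg HL hw hf uw (form_approx_cst HL ff) cf.
have lim2 := closure_form_cvg HL hw hw uw uw cw.
have [fu ul _] := (form_approxP HL u hw).1 uw.
have lim3 := l2cvg_rip ul (l2cvg_cst hf).
have lim4 := l2cvg_rip ul ul.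
move: lim1 lim2; rewrite gE -!/(rip _ _) !ripDl// !ripZl// => lim1 lim2.
pose B (x y : cochain X) := rip (L x) (L y) - a0 * rip x y.
have Blim1 : (fun n => B (u n) f) @ \oo --> rip f f.
  have -> : rip f f = rip f f + a0 * rip w f - a0 * rip w f by ring.
  by apply: cvgB => //; exact: cvgMl_tmp.
have Blim2 : (fun n => B (u n) (u n)) @ \oo --> rip f w.
  have -> : rip f w = rip f w + a0 * rip w w - a0 * rip w w by ring.
  by apply: cvgB => //; exact: cvgMl_tmp.
have Bff : 0 <= B f f by rewrite subr_ge0 ha0.
have CS n : B (u n) f * B (u n) f <= B f f * B (u n) (u n).
  rewrite -expr2; apply: discr_le => t; have lu := finitely_supported_l2 (fu n).
  have ftu := finitely_supportedZ t%:C%C (fu n).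
  have := ha0 _ (finitely_supportedD ff ftu).
  rewrite (form_operatorD Llin ff ftu) (form_operatorZ Llin _ (fu n)).
  have Lf := Ll2 ff; have Lu := Ll2 (fu n).
  have ltu := l2Z t%:C%C lu; have ltLu := l2Z t%:C%C Lu.
  rewrite !ripDl ?ripDr//; try exact: l2D.
  rewrite !ripZl ?ripZr// (ripC f (u n)) (ripC (L f) (L (u n))) /B.
  by rewrite -subr_ge0; move/le_trans; apply; rewrite le_eqVlt; apply/orP; left;
    apply/eqP; ring.
have lim5 : (fun n => B (u n) f * B (u n) f) @ \oo --> rip f f * rip f f by exact: cvgM.
have lim6 : (fun n => B f f * B (u n) (u n)) @ \oo --> B f f * rip f w.
  exact: cvgMl_tmp.
have h : rip f f * rip f f <= B f f * rip f w.
  by apply: (ler_cvg_to lim5 lim6); near=> n; exact: CS.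
(* The bound on the resolvent enters here; afterwards one factor [||f||^2] cancels from
   [||f||^4 <= C * B f f * ||f||^2]. *)
have fw : rip f w <= C * rip f f.
  apply: le_trans (rip_CSr hf hw) _.
  by rewrite -norm2_sqrE expr2 mulrCA ler_wpM2l ?norm2_ge0.
have : rip f f ^+ 2 <= C * B f f * rip f f.
  rewrite expr2; apply: le_trans h _.
  by rewrite [C * _]mulrC -mulrA ler_wpM2l.
have [->|f0] := eqVneq (rip f f) 0.
  by move=> _; rewrite mulr0 rip_ge0.
have fp : 0 < rip f f by rewrite lt_neqAle eq_sym f0 rip_ge0.
rewrite expr2 ler_pM2r// => le.
rewrite mulrDl -lerBrDl -/(B f f) mulrC ler_pdivrMr// mulrC.
exact: le.
Unshelve. all: by end_near.
Qed.

(** If the best lower bound [sup S] of the form lay below [lam], it would belong to the resolvent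
    set, and [form_resolvent_gap] would improve it. *)
Lemma spectrum_inf_le h : finitely_supported h ->
  spectrum_inf (associated_operator (lform L)) * rip h h <= rip (L h) (L h).
Proof.
move=> fh; set D := associated_operator _.
(* [inf] is 0 on a set that is empty or unbounded below; the claim then reduces to [Q >= 0]. *)
have [hinf|/inf_out ninf] := pselect (has_inf [set x : R | spectrum D x%:C%C]); last first.
  by rewrite /spectrum_inf ninf mul0r rip_ge0.
rewrite leNgt; apply/negP => lt.
set lam := spectrum_inf D in lt.
have h0 : 0 < rip h h.
  rewrite lt_neqAle eq_sym rip_ge0 andbT; apply/eqP => h0.
  by move: lt; rewrite h0 mulr0 ltNge rip_ge0.
pose S := [set a : R | forall f, finitely_supported f -> a * rip f f <= rip (L f) (L f)].
have S0 : S 0 by move=> f _; rewrite mul0r rip_ge0.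
have Sub f : finitely_supported f -> 0 < rip f f ->
    ubound S (rip (L f) (L f) / rip f f).
  by move=> ff f0 a /= /(_ f ff); rewrite ler_pdivlMr.
have hsup : has_sup S.
  by split; [exists 0|exists (rip (L h) (L h) / rip h h); exact: Sub].
have Ssup : S (sup S).
  move=> f ff; have [->|f0] := eqVneq (rip f f) 0; first by rewrite mulr0 rip_ge0.
  have fp : 0 < rip f f by rewrite lt_neqAle eq_sym f0 rip_ge0.
  by rewrite -ler_pdivlMr// ge_sup//; [exists 0|exact: Sub].
have sl : sup S < lam.
  apply: le_lt_trans (_ : rip (L h) (L h) / rip h h < lam).
    by rewrite ge_sup//; [exists 0|exact: Sub].
  by rewrite ltr_pdivrMr.
have : resolvent_set D (sup S)%:C%C.
  apply: contrapT => ns; have : lam <= sup S.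
    by apply: ge_inf; [exact: hinf.2|exact: ns].
  by rewrite leNgt sl.
case=> [T [C [hT _]]].
(* The resolvent constant [C] is not known to be positive. *)
have C'0 : 0 < Num.max C 1 by rewrite lt_max ltr01 orbT.
suff : S (sup S + (Num.max C 1)^-1).
  move=> /(ub_le_sup hsup.2); rewrite gerDl leNgt invr_gt0.
  by rewrite C'0.
move=> f ff; have [hTf TC DTf] := hT f (finitely_supported_l2 ff).
apply: form_resolvent_gap DTf => //.
apply: le_trans TC _; rewrite ler_wpM2r ?norm2_ge0//.
by rewrite le_max lexx.
Qed.

Lemma associated_operator_sym f f' g g' :
  associated_operator (lform L) f f' -> associated_operator (lform L) g g' ->
  rip f' g = rip g' f.
Proof.
move=> [df hf' Df] [dg hg' Dg].
have [hf [u uf]] := df; have [hg [v vg]] := dg.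
have l1 := closure_form_cvg HL hf hg uf vg (Df _ dg).
have l2 := closure_form_cvg HL hg hf vg uf (Dg _ df).
have E : (fun n => rip (L (v n)) (L (u n))) = (fun n => rip (L (u n)) (L (v n))).
  by apply/funext => n; rewrite ripC.
rewrite E in l2; exact: cvg_unique l1 l2.
Qed.

Lemma associated_operator_ge0 f f' : associated_operator (lform L) f f' ->
  0 <= rip f' f.
Proof.
move=> [df hf' Df]; have [hf [u uf]] := df.
have l1 := closure_form_cvg HL hf hf uf uf (Df _ df).
by apply: cvgr_to_ge l1 _; apply: nearW => n; exact: rip_ge0.
Qed.

End OperatorBounds.

(** * Integrals against finite measures on the line *)

Section RealMeasures.
Context {R : realType}.
Implicit Types (m : {measure set R -> \bar R}) (A I J : set R) (phi : R -> R).

Lemma integral_between m I phi (a b : R) : measurable I -> measurable_fun setT phi ->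
  (forall x, I x -> a <= phi x <= b) -> (m I < +oo)%E ->
  exists r : R, [/\ (\int[m]_(x in I) (phi x)%:E)%E = r%:E,
    a * fine (m I) <= r & r <= b * fine (m I)].
Proof.
move=> mI mphi ab finI.
have mphiI : measurable_fun I phi by exact: measurable_funTS.
have bd : [bounded phi x | x in I].
  exists (`|a| + `|b|); split; first exact: num_real.
  move=> M abM x Ix; apply: le_trans (ltW abM).
  have /andP[h1 h2] := ab _ Ix.
  have := ler_norm (- a); have := ler_norm b; rewrite normrN.
  by have := normr_ge0 a; have := normr_ge0 b; rewrite ler_norml; lra.
have iphi := measurable_bounded_integrable mI finI mphiI bd.
have icst (c : R) : m.-integrable I (EFin \o cst c).
  apply: measurable_bounded_integrable => //.
  exists `|c|; split; first exact: num_real.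
  by move=> M cM x _; exact: ltW.
have finm : m I \is a fin_num by rewrite ge0_fin_numE.
have fint := integrable_fin_num mI iphi.
exists (fine (\int[m]_(x in I) (phi x)%:E)%E); split; first by rewrite fineK.
- rewrite -lee_fin fineK// EFinM fineK// -(integral_cst m mI a%:E).
  apply: le_integral; [exact: mI|exact: (icst a)|exact: iphi|move=> x].
  by rewrite inE => /ab /andP[h _]; rewrite lee_fin.
- rewrite -lee_fin fineK// EFinM fineK// -(integral_cst m mI b%:E).
  apply: le_integral; [exact: mI|exact: iphi|exact: (icst b)|move=> x].
  by rewrite inE => /ab /andP[_ h]; rewrite lee_fin.
Qed.

Lemma integral_split m A phi : measurable A -> measurable_fun setT phi ->
  (\int[m]_(x in setT) (phi x)%:E =
   \int[m]_(x in A) (phi x)%:E + \int[m]_(x in ~` A) (phi x)%:E)%E.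
Proof.
move=> mA mphi; rewrite -(setUv A) integral_setU//; first exact: measurableC.
  by rewrite setUv; exact/measurable_EFinP.
by apply/disj_setPS; rewrite setICr.
Qed.

Lemma integral_concentrated m J phi : measurable J -> measurable_fun setT phi ->
  m (~` J) = 0 ->
  (\int[m]_(x in setT) (phi x)%:E = \int[m]_(x in J) (phi x)%:E)%E.
Proof.
move=> mJ mphi J0; rewrite (integral_split m mJ mphi) [X in (_ + X)%E]null_set_integral ?adde0//.
  exact: measurableC.
by apply/measurable_EFinP; exact: measurable_funTS.
Qed.

(** The contributions outside [I] coincide and cancel; concentration on the bounded set [J] makes
    them finite, so that they may be subtracted. Inside [I] only [a <= x <= b] is used. *)
Lemma integral_id_diff m1 m2 I J (a b c e : R) :
  measurable I -> measurable J -> I `<=` J ->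
  (forall x, I x -> a <= x <= b) -> (forall x, J x -> c <= x <= e) ->
  (m1 setT < +oo)%E -> (m2 setT < +oo)%E ->
  m1 (~` J) = 0 -> m2 (~` J) = 0 ->
  (forall A, measurable A -> A `<=` ~` I -> m1 A = m2 A) ->
  fine (\int[m1]_(x in setT) x%:E) - fine (\int[m2]_(x in setT) x%:E) <=
  b * fine (m1 I) - a * fine (m2 I).
Proof.
move=> mI mJ IJ hI hJ f1 f2 n1 n2 agree.
have mid : measurable_fun [set: R] (fun x : R => x) by exact: measurable_id.
have fin m A : (m setT < +oo)%E -> measurable A -> (m A < +oo)%E.
  by move=> fm mA; apply: le_lt_trans fm; apply: le_measure; rewrite ?inE.
rewrite (integral_split m1 mI mid) (integral_split m2 mI mid).
have -> : (\int[m2]_(x in ~` I) x%:E = \int[m1]_(x in ~` I) x%:E)%E.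
  by apply: eq_measure_integral => A mA AI; rewrite agree.
have [r1 [-> _ r1b]] := integral_between mI mid hI (fin _ _ f1 mI).
have [r2 [-> r2a _]] := integral_between mI mid hI (fin _ _ f2 mI).
have mIJ : measurable (J `\` I) by exact: measurableD.
have hIJ x : (J `\` I) x -> c <= x <= e by move=> [/hJ].
have [r3 [r3E _ _]] := integral_between mIJ mid hIJ (fin _ _ f1 mIJ).
have -> : (\int[m1]_(x in ~` I) x%:E = r3%:E)%E.
  rewrite -r3E -[~` I](setUIDK _ J).
  have -> : ~` I `&` J = J `\` I by rewrite setIC.
  have mCI : measurable (~` I `\` J) by apply: measurableD => //; exact: measurableC.
  have dis : [disjoint J `\` I & ~` I `\` J].
    by apply/disj_setPS => x [[? ?] [? ?]].
  rewrite integral_setU//.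
  rewrite [X in (_ + X)%E]null_set_integral ?adde0//.
  apply/eqP; rewrite eq_le measure_ge0 andbT -n1 le_measure ?inE//.
    exact: measurableC.
rewrite -!EFinD /=; lra.
Qed.

(** On each cell [exp (- t x)] is compared with its value at the left endpoint: [expR (- t * e)]
    accounts for its variation over one cell, and the last term for the tail beyond [K%:R * e]. *)
Lemma laplace_bounds m (t e : R) (K : nat) : 0 <= t -> 0 < e -> (m setT < +oo)%E ->
  m `]-oo, 0[%classic = 0 ->
  let I k := [set x : R | k%:R * e <= x < k.+1%:R * e] in
  let U := \sum_(k < K) expR (- t * (k%:R * e)) * fine (m (I k)) in
  let r := fine (\int[m]_(x in setT) (expR (- t * x))%:E) in
  expR (- t * e) * U <= r /\ r <= U + expR (- t * (K%:R * e)) * fine (m setT).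
Proof.
move=> t0 e0 fm null I U r.
have mexp : measurable_fun [set: R] (fun x => expR (- t * x)).
  by apply: measurableT_comp => //; exact: measurable_funM.
have fin A : measurable A -> (m A < +oo)%E.
  by move=> mA; apply: le_lt_trans fm; apply: le_measure; rewrite ?inE.
have mI k : measurable (I k).
  have -> : I k = `[k%:R * e, k.+1%:R * e[%classic by apply/seteqP; split => x /=;
    rewrite in_itv.
  exact: measurable_itv.
pose J (n : nat) : set R := `[0, n%:R * e[%classic.
have mJ n : measurable (J n) by exact: measurable_itv.
have main n : exists q : R, [/\
    (\int[m]_(x in J n) (expR (- t * x))%:E)%E = q%:E,
    expR (- t * e) * \sum_(k < n) expR (- t * (k%:R * e)) * fine (m (I k)) <= q &
    q <= \sum_(k < n) expR (- t * (k%:R * e)) * fine (m (I k))].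
  elim: n => [|n [q [qE q1 q2]]].
    exists 0; rewrite /J mul0r !big_ord0 mulr0; split => //.
    by rewrite set_itvco0 integral_set0.
  have hI x : I n x -> expR (- t * (n.+1%:R * e)) <= expR (- t * x) <= expR (- t * (n%:R * e)).
    move=> /andP[x1 x2]; rewrite !ler_expR !mulNr !lerN2.
    by rewrite !ler_wpM2l// ltW.
  have [p [pE p1 p2]] := integral_between (mI n) mexp hI (fin _ (mI n)).
  exists (q + p); split.
  - have -> : J n.+1 = J n `|` I n.
      rewrite /J; apply/seteqP; split => x /=; rewrite !in_itv/=.
        move=> /andP[x0 xn]; have [h|h] := ltP x (n%:R * e).
          by left; rewrite x0.
        by right; rewrite /I /= h.
      case=> /andP[x1 x2].
        by rewrite x1 (lt_trans x2)// ltr_pM2r// ltr_nat.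
      by rewrite x2 (le_trans _ x1)// mulr_ge0// ltW.
    have dis : [disjoint J n & I n].
      rewrite /J; apply/disj_setPS => x [/=]; rewrite in_itv/= => /andP[_ h] /andP[h' _].
      by move: h; rewrite ltNge h'.
    by rewrite integral_setU ?qE ?pE//; apply/measurable_EFinP; exact: measurable_funTS.
  - rewrite big_ord_recr/= mulrDr lerD//; apply: le_trans p1.
    rewrite mulrA -expRD; apply: ler_wpM2r; first exact: fine_ge0.
    rewrite ler_expR (_ : - t * e + - t * (n%:R * e) = - t * (n.+1%:R * e))//.
    by rewrite -natr1; ring.
  - by rewrite big_ord_recr/= lerD.
have [q [qE q1 q2]] := main K.
have ht x : `[K%:R * e, +oo[%classic x -> 0 <= expR (- t * x) <= expR (- t * (K%:R * e)).
  rewrite /= in_itv/= andbT => Kx; rewrite expR_ge0 ler_expR !mulNr lerN2.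
  by rewrite ler_wpM2l.
have mt : measurable (`[K%:R * e, +oo[%classic : set R) by exact: measurable_itv.
have [p [pE p1 p2]] := integral_between mt mexp ht (fin _ mt).
have Ke : 0 <= K%:R * e by rewrite mulr_ge0// ltW.
have rE : r = q + p.
  rewrite /r (@integral_concentrated m `[0, +oo[%classic)//; last first.
    have -> : ~` (`[0, +oo[%classic : set R) = `]-oo, 0[%classic.
      by rewrite setCitvr.
    exact: null.
  have -> : (`[0, +oo[%classic : set R) = J K `|` `[K%:R * e, +oo[%classic.
    rewrite /J; apply/seteqP; split => x /=; rewrite !in_itv/= !andbT.
      by move=> ->; have [h|h] := ltP x (K%:R * e); [left|right].
    by case=> [/andP[]//|]; exact: le_trans.
  have dis : [disjoint J K & (`[K%:R * e, +oo[%classic : set R)].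
    rewrite /J; apply/disj_setPS => x [/=]; rewrite !in_itv/= andbT => /andP[_ h] h'.
    by move: h; rewrite ltNge h'.
  by rewrite integral_setU ?qE ?pE//; apply/measurable_EFinP; exact: measurable_funTS.
rewrite mul0r in p1; rewrite rE; split; first by rewrite -[leLHS]addr0 lerD.
apply: lerD => //; apply: le_trans p2 _; apply: ler_wpM2l; first exact: expR_ge0.
apply: fine_le; rewrite ?ge0_fin_numE ?fin//.
by apply: le_measure; rewrite ?inE.
Qed.

End RealMeasures.

(** * Projection-valued measures *)

Section SpectralMeasures.
Context {V : countType} {R : realType} {X : weighted_complex V R}.
Implicit Types (f g h : cochain X) (A B : set R).
Variable E : set R -> cochain X -> cochain X.
Hypothesis hE : projection_valued_measure E.

Lemma pvm_l2 A f : measurable A -> l2 f -> l2 (E A f).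
Proof. by case: hE => h _ _ mA; have [h1 _ _ _] := h A mA; exact: h1. Qed.

Lemma pvm_linear A (c : R[i]) f g : measurable A -> l2 f -> l2 g ->
  E A (zscale c f + g) = zscale c (E A f) + E A g.
Proof. by case: hE => h _ _ mA; have [_ h1 _ _] := h A mA; exact: h1. Qed.

Lemma pvm_idem A f : measurable A -> l2 f -> E A (E A f) = E A f.
Proof. by case: hE => h _ _ mA; have [_ _ h1 _] := h A mA; exact: h1. Qed.

Lemma pvm_adj A f g : measurable A -> l2 f -> l2 g -> rip (E A f) g = rip f (E A g).
Proof.
case: hE => h _ _ mA hf hg; have [_ _ _ h1] := h A mA.
by rewrite /rip h1.
Qed.

Lemma pvmT f : l2 f -> E setT f = f.
Proof. by case: hE => _ h _; exact: h. Qed.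

Lemma pvmD A f g : measurable A -> l2 f -> l2 g -> E A (f + g) = E A f + E A g.
Proof.
move=> mA hf hg; have z1 (h : cochain X) : zscale 1 h = h.
  by apply/funext => s; rewrite cochainE mul1r.
by have := pvm_linear 1 mA hf hg; rewrite !z1.
Qed.

Lemma pvm0 A : measurable A -> E A 0 = 0.
Proof.
move=> mA; have := pvmD mA l2_0 l2_0.
by rewrite addr0 => /eqP; rewrite -subr_eq subrr => /eqP.
Qed.

Lemma pvmZ A (c : R[i]) f : measurable A -> l2 f -> E A (zscale c f) = zscale c (E A f).
Proof.
by move=> mA hf; have := pvm_linear c mA hf l2_0; rewrite pvm0// !addr0.
Qed.

Lemma pvm_norm A f : measurable A -> l2 f -> rip (E A f) f = norm2 (E A f) ^+ 2.
Proof.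
move=> mA hf; have hA := pvm_l2 mA hf.
by rewrite norm2_sqrE -pvm_adj// pvm_idem.
Qed.

Lemma pvm_sigma (F : nat -> set R) f : (forall n, measurable (F n)) ->
  trivIset setT F -> l2 f ->
  l2cvg (fun n => \sum_(0 <= i < n) E (F i) f) (E (\bigcup_i F i) f).
Proof.
move=> mF tF hf; split.
- by move=> n; apply: l2_sum => i _; exact: pvm_l2.
- by apply: pvm_l2 => //; exact: bigcup_measurable.
- case: hE => _ _ h; have := h F mF tF f hf.
  apply: cvg_trans; apply: near_eq_cvg; near=> n; congr norm2.
  by apply/funext => s; rewrite !cochainE cochain_sumE.
Unshelve. all: by end_near.
Qed.

Lemma l2cvg_unique (u : nat -> cochain X) f g : l2cvg u f ->
  (\forall n \near \oo, u n = g) -> f = g.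
Proof.
move=> [hu hf uf] [N _ ug].
have hg : l2 g by rewrite -(ug N)//=.
apply/eqP; rewrite -subr_eq0 -oppr_eq0 opprB; apply/eqP.
apply: norm2_eq0; first exact: l2B.
have : (fun n => norm2 (u n - f)) @ \oo --> norm2 (g - f).
  by apply: cvg_near_cst; exists N => // n /= /ug ->.
by move/(cvg_unique (@Rhausdorff R) uf).
Qed.

Lemma pvm_set0 f : l2 f -> E set0 f = 0.
Proof.
move=> hf; have tri : trivIset [set: nat] (fun=> set0 : set R).
  by apply/trivIsetP => *; rewrite setI0.
have := @pvm_sigma (fun=> set0) f (fun=> measurable0) tri hf.
rewrite bigcup0// => h.
case: h => [hu _ h].
(* For the constant sequence of empty sets, removing the last term of the partial sum shows that the
   partial sums tend to 0 as well as to [E set0 f]. *)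
have c1 : (fun n => norm2 (\sum_(0 <= i < n.+1) E set0 f - E set0 f)) @ \oo --> (0 : R).
  by move: h; rewrite -cvg_shiftS.
have h0 := pvm_l2 measurable0 hf.
have E1 : l2cvg (fun n => \sum_(0 <= i < n) E set0 f) 0.
  split => //; first exact: l2_0.
  apply: cvg_trans c1; apply: near_eq_cvg; near=> n.
  by rewrite big_nat_recr//= addrK subr0.
have : E set0 f = 0; last by [].
have l1 : l2cvg (fun n => \sum_(0 <= i < n) E set0 f) (E set0 f) by split.
have l3 := l2cvg_rip l1 E1; rewrite [rip _ 0]ripC rip0l in l3.
have l4 := l2cvg_rip l1 l1.
apply: norm2_eq0 => //; rewrite norm2E.
by rewrite (cvg_unique (@Rhausdorff R) l4 l3) sqrtr0.
Unshelve. all: by end_near.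
Qed.

Lemma pvm_setU A B f : measurable A -> measurable B -> A `&` B = set0 -> l2 f ->
  E (A `|` B) f = E A f + E B f.
Proof.
move=> mA mB AB hf.
have mF n : measurable (bigcup2 A B n) by case: n => [|[|n]] /=.
have tF : trivIset setT (bigcup2 A B) by rewrite -trivIset_bigcup2.
have := pvm_sigma mF tF hf; rewrite bigcup2E => /l2cvg_unique; apply.
exists 2%N => // n /= n2; rewrite (big_cat_nat _ (n := 2))//=.
rewrite big_nat_recr//= big_nat1 /=.
rewrite big_nat_cond big1 ?addr0// => -[|[|i]]//= _.
exact: pvm_set0.
Qed.

(** For [g = E B f], additivity gives [||E (A U B) g||^2 = ||E A g||^2 + ||g||^2], while a symmetric
    idempotent does not increase norms; hence [E A g = 0]. *)
Lemma pvm_disjoint A B f : measurable A -> measurable B -> A `&` B = set0 -> l2 f ->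
  E A (E B f) = 0.
Proof.
move=> mA mB AB hf; set g := E B f; have hg : l2 g by exact: pvm_l2.
have mAB : measurable (A `|` B) by exact: measurableU.
have hA := pvm_l2 mA hg; have hU := pvm_l2 mAB hg.
have Bg : E B g = g by exact: pvm_idem.
have U : E (A `|` B) g = E A g + g by rewrite pvm_setU// Bg.
have e1 : norm2 (E (A `|` B) g) ^+ 2 = norm2 (E A g) ^+ 2 + norm2 g ^+ 2.
  by rewrite -(pvm_norm mAB hg) -(pvm_norm mA hg) U ripDl// norm2_sqrE.
have e2 : norm2 (E (A `|` B) g) <= norm2 g.
  have := rip_CSr hU hg; rewrite pvm_norm// expr2.
  have := norm2_ge0 (E (A `|` B) g); rewrite le_eqVlt => /orP[/eqP <-|p].
    by rewrite norm2_ge0.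
  by rewrite ler_pM2l.
apply: norm2_eq0 => //; apply/eqP; rewrite -sqrf_eq0; apply/eqP/le_anti.
rewrite sqr_ge0 andbT; have := norm2_ge0 (E (A `|` B) g); nra.
Qed.

Lemma pvm_sub A B f : measurable A -> measurable B -> B `<=` A -> l2 f ->
  E A (E B f) = E B f.
Proof.
move=> mA mB BA hf; have hB := pvm_l2 mB hf.
rewrite -(setDUK BA) pvm_setU//; last 2 first.
- exact: measurableD.
- by rewrite setDIK.
rewrite pvm_idem// pvm_disjoint ?addr0//; first exact: measurableD.
by rewrite setIC setDIK.
Qed.

Lemma pvm_restrict A B f : measurable A -> measurable B -> l2 f ->
  E A (E B f) = E (A `&` B) f.
Proof.
move=> mA mB hf; have mAB : measurable (A `&` B) by exact: measurableI.
have mBA : measurable (B `\` A) by exact: measurableD.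
have BE : B = (A `&` B) `|` (B `\` A) by rewrite setIC setUIDK.
have dis : (A `&` B) `&` (B `\` A) = set0.
  by apply/seteqP; split => x // [[? ?] [? ?]].
rewrite {1}BE pvm_setU// pvmD//; try exact: pvm_l2.
rewrite pvm_sub// pvm_disjoint ?addr0//.
by apply/seteqP; split => x // [? [? ?]].
Qed.

Lemma pvm_norm_le A f : measurable A -> l2 f -> norm2 (E A f) <= norm2 f.
Proof.
move=> mA hf; have hA := pvm_l2 mA hf.
have := rip_CSr hA hf; rewrite pvm_norm// expr2.
have := norm2_ge0 (E A f); rewrite le_eqVlt => /orP[/eqP <-|p].
  by rewrite norm2_ge0.
by rewrite ler_pM2l.
Qed.

Import HBNNSimple.

(** [spectral_measure] is a bare set function, constrained on measurable sets only. Its integral is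
    built from simple functions and sees no other sets, so it equals the integral against a genuine
    measure, obtained by setting the value 0 on nonmeasurable sets. *)
Lemma spectral_measureP f : l2 f -> exists m : {measure set R -> \bar R},
  (forall A, measurable A -> m A = (norm2 (E A f) ^+ 2)%:E) /\
  (forall phi : R -> \bar R,
    \int[spectral_measure E f]_(x in setT) phi x = \int[m]_(x in setT) phi x)%E.
Proof.
move=> hf.
pose m A : \bar R := if pselect (measurable A) then (norm2 (E A f) ^+ 2)%:E else 0%E.
have mE A : measurable A -> m A = (norm2 (E A f) ^+ 2)%:E.
  by move=> mA; rewrite /m; case: pselect.
have m0 : m set0 = 0%E by rewrite mE// pvm_set0// norm2_0 expr0n.
have mge A : (0 <= m A)%E.
  by rewrite /m; case: pselect => // mA; rewrite lee_fin sqr_ge0.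
have madd : semi_sigma_additive m.
  move=> F mF tF mU; rewrite mE//.
  have l1 := pvm_sigma mF tF hf.
  have := l2cvg_rip l1 (l2cvg_cst hf); rewrite pvm_norm// => l2.
  have -> : (fun n => (\sum_(0 <= i < n) m (F i))%E) =
      EFin \o (fun n => rip (\sum_(0 <= i < n) E (F i) f) f).
    apply/funext => n /=; rewrite rip_suml// => [|i _]; last exact: pvm_l2.
    by rewrite -sumEFin; apply: eq_bigr => i _; rewrite mE// pvm_norm.
  by apply: cvg_EFin; [exact: nearW|exact: l2].
pose mm := isMeasure.Build _ _ _ m m0 mge madd.
pose M : {measure set R -> \bar R} := HB.pack m mm.
exists M; split; first exact: mE.
move=> phi; rewrite /integral.
have sE (h : {nnsfun R >-> R}) : sintegral (spectral_measure E f) h = sintegral M h.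
  apply: eq_fsbigr => r _; congr (_ * _)%E.
  have mh : measurable (h @^-1` [set r]) by exact: measurable_sfunP.
  by rewrite /spectral_measure -/(rip _ _) pvm_norm// -mE.
by congr (ereal_sup _ - ereal_sup _)%E; apply/seteqP; split => _ [h hh <-];
  exists h => //; rewrite sE.
Qed.

End SpectralMeasures.

(** * Spectral cells of the operator *)

Section SpectralOperator.
Context {V : countType} {R : realType} {X : weighted_complex V R}.
Implicit Types (f g h p q w : cochain X) (A I J : set R).
Variable L : cochain X -> cochain X.
Hypothesis HL : form_operator L.
Variable E : set R -> cochain X -> cochain X.
Hypothesis hE : projection_valued_measure E.
Let D := associated_operator (lform L).
Hypothesis hD : spectral_integral E (fun x => x) D.

Lemma op_linear (c : R[i]) f f' g g' : D f g -> D f' g' ->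
  D (zscale c f + f') (zscale c g + g').
Proof. by case: hD => h _ _; exact: h. Qed.

Lemma op_add f f' g g' : D f g -> D f' g' -> D (f + f') (g + g').
Proof.
move=> h h'; have := op_linear 1 h h'.
have z1 (k : cochain X) : zscale 1 k = k by apply/funext => s; rewrite cochainE mul1r.
by rewrite !z1.
Qed.

Lemma op_0 f g : D f g -> D 0 0.
Proof.
move=> h; have := op_linear (-1) h h.
have z1 (k : cochain X) : zscale (-1) k + k = 0.
  by apply/funext => s; rewrite !cochainE mulN1r addNr.
by rewrite !z1.
Qed.

Lemma op_scale (c : R[i]) f g : D f g -> D (zscale c f) (zscale c g).
Proof.
by move=> h; have := op_linear c h (op_0 h); rewrite !addr0.
Qed.

Lemma op_opp f g : D f g -> D (- f) (- g).
Proof.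
have z1 (k : cochain X) : - k = zscale (-1) k.
  by apply/funext => s; rewrite !cochainE mulN1r.
by move=> /(op_scale (-1)); rewrite -!z1.
Qed.

Lemma op_l2 f g : D f g -> l2 f /\ l2 g.
Proof. by case=> [[]]. Qed.

Lemma op_pairing f g (m : {measure set R -> \bar R}) :
  (forall phi : R -> \bar R,
    \int[spectral_measure E f]_(x in setT) phi x = \int[m]_(x in setT) phi x)%E ->
  D f g -> rip g f = fine (\int[m]_(x in setT) x%:E).
Proof.
move=> hm; case: hD => _ _ h /h [_ gf].
by rewrite /rip gf /= (hm (fun x => x%:E)).
Qed.

Lemma spectral_concentrated p J (m : {measure set R -> \bar R}) : l2 p ->
  measurable J -> E J p = p ->
  (forall A, measurable A -> m A = (norm2 (E A p) ^+ 2)%:E) -> m (~` J) = 0.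
Proof.
move=> hp mJ Jp hm; rewrite hm; last exact: measurableC.
rewrite -Jp (pvm_disjoint hE)//; last by rewrite setICl.
  by rewrite norm2_0 expr0n.
exact: measurableC.
Qed.

Lemma op_domain p J (c e : R) : l2 p -> measurable J -> E J p = p ->
  (forall x, J x -> c <= x <= e) -> exists q, D p q.
Proof.
move=> hp mJ Jp hJ; case: hD => _ h _; apply/(h p); split => //.
have [m [hm ->]] := spectral_measureP hE hp.
have J0 := spectral_concentrated hp mJ Jp hm.
have mx : measurable_fun [set: R] (fun x : R => x ^+ 2) by exact: measurable_funX.
rewrite (integral_concentrated mJ mx J0).
have hx x : J x -> 0 <= x ^+ 2 <= c ^+ 2 + e ^+ 2.
  move=> /hJ /andP[x1 x2]; rewrite sqr_ge0 /=.
  have := sqr_ge0 c; have := sqr_ge0 e; have [x0|x0] := leP 0 x; nra.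
have mf : (m J < +oo)%E by rewrite hm ?ltry.
by have [r [-> _ _]] := integral_between mJ mx hx mf; rewrite ltry.
Qed.

(** The negative half-line is exhausted by intervals [J n] that are bounded, so that [p = E (J n) f]
    is in the domain, and lie below [- 1 / (n + 1)], so that [<D p, p> <= - ||p||^2 / (n + 1)].
    Nonnegativity of the form forces [p = 0]. *)
Lemma op_nonneg f : l2 f -> E `]-oo, 0[%classic f = 0.
Proof.
move=> hf; have [m [hm hi]] := spectral_measureP hE hf.
pose J n : set R := `[- n.+1%:R, - n.+1%:R^-1[%classic.
have mJ n : measurable (J n) by exact: measurable_itv.
have J0 n : m (J n) = 0.
  set p := E (J n) f; have hp : l2 p by exact: pvm_l2.
  have Jp : E (J n) p = p by exact: pvm_idem.
  have hJ x : J n x -> - n.+1%:R <= x <= - n.+1%:R^-1.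
    by rewrite /J /= in_itv/= => /andP[-> /ltW ->].
  have [q Dpq] := op_domain hp (mJ n) Jp hJ.
  have [mp [hmp hip]] := spectral_measureP hE hp.
  have := associated_operator_ge0 HL Dpq; rewrite (op_pairing hip Dpq).
  have mid : measurable_fun [set: R] (fun x : R => x) by exact: measurable_id.
  rewrite (integral_concentrated (mJ n) mid (spectral_concentrated hp (mJ n) Jp hmp)).
  have mf : (mp (J n) < +oo)%E by rewrite hmp ?ltry.
  have [r [-> _ /= r2]] := integral_between (mJ n) mid hJ mf.
  move=> r0; have := le_trans r0 r2; rewrite hmp// Jp /= => h.
  rewrite hm// -/p; congr (_%:E); apply/le_anti; rewrite sqr_ge0 andbT.
  have n0 : 0 < n.+1%:R^-1 :> R by rewrite invr_gt0.
  by rewrite -(ler_pM2l n0) mulr0 -oppr_ge0 -mulNr.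
apply: norm2_eq0; first exact: pvm_l2.
have mneg : measurable (`]-oo, 0[%classic : set R) by exact: measurable_itv.
have : m `]-oo, 0[%classic = 0.
  have -> : (`]-oo, 0[%classic : set R) = \bigcup_n J n.
    apply/seteqP; split => x /=; rewrite in_itv/=.
      move=> x0; pose n := maxn (Num.truncn (- x)) (Num.truncn (- x)^-1).
      exists n => //; rewrite /J /= in_itv/=.
      have nx : 0 < - x by rewrite oppr_gt0.
      apply/andP; split.
        rewrite lerNl (le_trans (ltW (truncnS_gt _)))// ler_nat ltnS.
        exact: leq_maxl.
      rewrite ltrNr -[ltRHS]invrK ltf_pV2 ?posrE ?invr_gt0//.
      rewrite (lt_le_trans (truncnS_gt _))// ler_nat ltnS.
      exact: leq_maxr.
    move=> [n _]; rewrite /J /= in_itv/= => /andP[_ /lt_trans]; apply.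
    by rewrite oppr_lt0 invr_gt0.
  apply: measure_negligible; first exact: bigcup_measurable.
  by apply: negligible_bigcup => n; exists (J n); split.
by rewrite hm// => -[] /eqP; rewrite sqrf_eq0 => /eqP.
Qed.

(** Continuity of the scalar measure along increasing sets gives convergence of the norms; for a
    projection [||E f - f||^2 = ||f||^2 - ||E f||^2] makes this strong convergence. *)
Lemma pvm_cutoff f : l2 f -> l2cvg (fun n => E `[- n%:R, n%:R[%classic f) f.
Proof.
move=> hf; have [m [hm _]] := spectral_measureP hE hf.
pose J n : set R := `[- n%:R, n%:R[%classic.
have mJ n : measurable (J n) by exact: measurable_itv.
have hJ n : l2 (E (J n) f) by exact: pvm_l2.
split => //.
have UJ : \bigcup_n J n = setT.
  apply/seteqP; split => x //= _; exists (Num.truncn `|x|).+1 => //.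
  rewrite /J /= in_itv/=; have := truncnS_gt `|x|.
  by rewrite ltr_norml => /andP[/ltW -> ->].
have c1 : (m \o J) @ \oo --> m (\bigcup_n J n).
  apply: nondecreasing_cvg_mu => //; first by rewrite UJ; exact: measurableT.
  move=> n k nk; apply/subsetPset => x; rewrite /J /= !in_itv/= => /andP[h1 h2].
  have nk' : n%:R <= k%:R :> R by rewrite ler_nat.
  by rewrite (lt_le_trans h2)// (le_trans _ h1)// lerN2.
have c2 : (fun n => norm2 (E (J n) f) ^+ 2) @ \oo --> norm2 f ^+ 2.
  move: c1; rewrite UJ hm// (pvmT hE)//.
  have -> : m \o J = EFin \o (fun n => norm2 (E (J n) f) ^+ 2).
    by apply/funext => n /=; rewrite hm.
  by move/fine_cvg.
have c3 : (fun n => norm2 (E (J n) f - f) ^+ 2) @ \oo --> (0 : R).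
  have -> : (fun n => norm2 (E (J n) f - f) ^+ 2) =
      (fun n => norm2 f ^+ 2 - norm2 (E (J n) f) ^+ 2).
    apply/funext => n; rewrite norm2_sqrE ripBl ?ripBr//; try exact: l2B.
    rewrite (ripC f) (pvm_norm hE)// -!norm2_sqrE; ring.
  by rewrite -(subrr (norm2 f ^+ 2)); apply: cvgB => //; exact: cvg_cst.
have -> : (fun n => norm2 (E (J n) f - f)) =
    (fun n => Num.sqrt (norm2 (E (J n) f - f) ^+ 2)).
  by apply/funext => n; rewrite sqrtr_sqr ger0_norm ?norm2_ge0.
by rewrite -sqrtr0; apply: continuous_cvg c3; exact: sqrt_continuous.
Qed.

(** Optimization over the length of a test vector: [c = P / W] balances the two terms of the square,
    and for [P = 0] the choice [c = 1 / (1 + b)] contradicts [W > 0]. *)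
Lemma scaled_square_bound (b P W : R) : 0 <= b -> 0 <= P -> 0 <= W ->
  (forall c, 0 < c -> 4 * c * W ^+ 2 <= b * (P + c * W) ^+ 2) -> W <= b * P.
Proof.
move=> b0 P0 W0 h; have [->|Wn] := eqVneq W 0; first by rewrite mulr_ge0.
have Wp : 0 < W by rewrite lt_neqAle eq_sym Wn.
have [Pz|Pn] := eqVneq P 0.
  have c0 : 0 < (1 + b)^-1 by rewrite invr_gt0; lra.
  have := h _ c0; rewrite Pz add0r exprMn.
  set c := (1 + b)^-1; have cb : c * (1 + b) = 1 by rewrite mulVf// gt_eqF//; lra.
  have -> : b * (c ^+ 2 * W ^+ 2) = (c * b) * (c * W ^+ 2) by ring.
  have -> : 4 * c * W ^+ 2 = 4 * (c * W ^+ 2) by ring.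
  rewrite ler_pM2r ?mulr_gt0 ?exprn_gt0//.
  by rewrite mulrDr mulr1 in cb; move=> *; exfalso; move: c0; rewrite -/c; lra.
have Pp : 0 < P by rewrite lt_neqAle eq_sym Pn.
have := h _ (divr_gt0 Pp Wp); rewrite divfK//.
have -> : 4 * (P / W) * W ^+ 2 = W * (4 * P) by field.
have -> : b * (P + P) ^+ 2 = b * P * (4 * P) by ring.
by rewrite ler_pM2r// mulr_gt0.
Qed.

(* Polarization against multiples of [w = E J (q - a p)] for a large interval
   [J]: the spectral measures of [p + w] and [p - w] agree outside [I], and the
   points of [I] are within [b - a] of [a]. *)
Lemma op_piece I (a b : R) p q : measurable I -> (forall x, I x -> a <= x <= b) ->
  a <= b -> l2 p -> E I p = p -> D p q ->
  norm2 (q - zscale a%:C%C p) <= (b - a) * norm2 p.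
Proof.
move=> mI hI ab hp Ip Dpq; have [_ hq] := op_l2 Dpq.
have hap := l2Z a%:C%C hp.
set y := q - _; have hy : l2 y by exact: l2B.
(* [y] need not lie in the domain of [D]. Its cutoffs to bounded intervals do, and their norms tend
   to that of [y]. *)
have cut := l2cvg_norm2 (pvm_cutoff hy).
apply: (cvgr_to_le cut); near=> n.
pose J : set R := `[- n%:R, n%:R[%classic.
have mJ : measurable J by exact: measurable_itv.
have IJ : I `<=` J.
  move=> x /hI /andP[x1 x2]; rewrite /J /= in_itv/=.
  have : Num.max (- a) (b + 1) <= n%:R.
    near: n; exists (Num.truncn (Num.max (- a) (b + 1))).+1 => // n /= nn.
    by rewrite (le_trans (ltW (truncnS_gt _)))// ler_nat.
  by rewrite ge_max => /andP[n1 n2]; apply/andP; split; lra.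
have hJ x : J x -> - n%:R <= x <= n%:R.
  by rewrite /J /= in_itv/= => /andP[-> /ltW ->].
rewrite -/J; set w := E J y.
have hw : l2 w by exact: pvm_l2.
have Jw : E J w = w by exact: pvm_idem.
have Jp : E J p = p by rewrite -Ip (pvm_sub hE).
have [z Dwz] := op_domain hw mJ Jw hJ.
have [_ hz] := op_l2 Dwz.
apply: scaled_square_bound; rewrite ?subr_ge0 ?norm2_ge0// => c c0.
pose w' := zscale c%:C%C w; pose z' := zscale c%:C%C z.
have hw' : l2 w' by exact: l2Z.
have hz' : l2 z' by exact: l2Z.
have Dw' : D w' z' by exact: op_scale.
have Jw' : E J w' = w' by rewrite (pvmZ hE)// Jw.
have Dp1 := op_add Dpq Dw'; have Dp2 := op_add Dpq (op_opp Dw').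
have hp1 : l2 (p + w') by exact: l2D.
have hp2 : l2 (p - w') by exact: l2B.
have hNw' : l2 (- w') by exact: l2N.
have ENw A : measurable A -> E A (- w') = - E A w'.
  move=> mA; have zN (k : cochain X) : - k = zscale (-1) k.
    by apply/funext => s; rewrite !cochainE mulN1r.
  by rewrite !zN (pvmZ hE).
have [m1 [hm1 hi1]] := spectral_measureP hE hp1.
have [m2 [hm2 hi2]] := spectral_measureP hE hp2.
have J1 : E J (p + w') = p + w' by rewrite (pvmD hE)// Jp Jw'.
have J2 : E J (p - w') = p - w' by rewrite (pvmD hE)// ENw// Jp Jw'.
have n1 := spectral_concentrated hp1 mJ J1 hm1.
have n2 := spectral_concentrated hp2 mJ J2 hm2.
have f1 : (m1 setT < +oo)%E by rewrite hm1 ?ltry.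
have f2 : (m2 setT < +oo)%E by rewrite hm2 ?ltry.
have agree A : measurable A -> A `<=` ~` I -> m1 A = m2 A.
  move=> mA AI; rewrite hm1// hm2//.
  have Ap : E A p = 0.
    rewrite -Ip (pvm_disjoint hE)//.
    by apply/seteqP; split => x // [/AI].
  by rewrite !(pvmD hE)// ENw// Ap !add0r norm2N.
have := integral_id_diff mI mJ IJ hI hJ f1 f2 n1 n2 agree.
rewrite -(op_pairing hi1 Dp1) -(op_pairing hi2 Dp2).
rewrite (hm1 _ mI) (hm2 _ mI) /= !(pvmD hE)// (ENw _ mI) Ip.
set g := E I w'; have hg : l2 g by exact: pvm_l2.
have gw : norm2 g <= c * norm2 w.
  apply: le_trans (pvm_norm_le hE mI hw') _.
  by rewrite norm2Z// gtr0_norm.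
have pg : rip p g = rip p w' by rewrite /g -(pvm_adj hE)// Ip.
have sym := associated_operator_sym HL Dpq Dw'.
have yw : rip q w' - a * rip p w' = c * norm2 w ^+ 2.
  rewrite -ripZl// -ripBl// -/y /w' ripZr//; congr (_ * _).
  by rewrite ripC /w (pvm_norm hE).
have hNg := l2N hg; have hNz' := l2N hz'.
have hpg : l2 (p + g) by exact: l2D.
have hpg' : l2 (p - g) by exact: l2B.
rewrite !norm2_sqrE !ripDl ?ripDr ?ripBl ?ripBr ?ripNl ?ripNr//;
  rewrite ?(ripC w' q) ?(ripC g p) => le.
(* Polarization has left [4 <q, w'> <= b ||p + g||^2 - a ||p - g||^2], whose right side is
   [(b - a) ||p + g||^2 + 4 a <p, g>]. Since [<p, g> = <p, w'>], the left side becomes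
   [4 <q - a p, w'> = 4 c ||w||^2]. *)
have k : rip p p + 2 * rip p g + rip g g <= (norm2 p + c * norm2 w) ^+ 2.
  apply: (@le_trans _ _ ((norm2 p + norm2 g) ^+ 2)); last first.
    have cw : 0 <= c * norm2 w by rewrite mulr_ge0 ?norm2_ge0// ltW.
    by rewrite ler_pXn2r ?nnegrE ?addr_ge0 ?norm2_ge0// lerD2l.
  by have := rip_CSr hp hg; rewrite -!norm2_sqrE sqrrD; lra.
have ba : 0 <= b - a by rewrite subr_ge0.
have := ler_wpM2l ba k; rewrite norm2_sqrE in yw; rewrite -pg in yw.
set Z := (norm2 p + _) ^+ 2.
by move=> kk; move: le; rewrite sym in yw *; lra.
Unshelve. all: by end_near.
Qed.

End SpectralOperator.

(** * Discretized semigroup *)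

Section HeatApproximation.
Context {V : countType} {R : realType} {X : weighted_complex V R}.
Implicit Types (f g h p q w : cochain X) (A I J : set R).
Variable L : cochain X -> cochain X.
Hypothesis HL : form_operator L.
Variable E : set R -> cochain X -> cochain X.
Hypothesis hE : projection_valued_measure E.
Let D := associated_operator (lform L).
Hypothesis hD : spectral_integral E (fun x => x) D.

Definition cell (e : R) (k : nat) : set R := [set x | k%:R * e <= x < k.+1%:R * e].

Lemma measurable_cell e k : measurable (cell e k).
Proof.
have -> : cell e k = `[k%:R * e, k.+1%:R * e[%classic.
  by apply/seteqP; split => x /=; rewrite in_itv.
exact: measurable_itv.
Qed.

Lemma cell_disjoint e j k : 0 < e -> j != k -> cell e j `&` cell e k = set0.
Proof.
move=> e0; wlog jk : j k / (j < k)%N => [wl|_].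
  rewrite neq_ltn => /orP[jk|kj]; first by apply: wl => //; rewrite ltn_eqF.
  by rewrite setIC; apply: wl => //; rewrite ltn_eqF.
apply/seteqP; split => x // [/andP[_ h1] /andP[h2 _]].
have : j.+1%:R * e <= k%:R * e by rewrite ler_pM2r// ler_nat.
by move=> h3; have := lt_le_trans h1 (le_trans h3 h2); rewrite ltxx.
Qed.

Definition heat_approx (e : R) (K : nat) (t : R) (f : cochain X) : cochain X :=
  \sum_(k < K) zscale (expR (- (k%:R * e) * t))%:C%C (E (cell e k) f).

Lemma heat_approx_l2 e K t f : l2 f -> l2 (heat_approx e K t f).
Proof.
move=> hf; apply: l2_sum => k _; apply: l2Z; apply: pvm_l2 => //.
exact: measurable_cell.
Qed.

Lemma heat_approx0 e K f : 0 < e -> l2 f ->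
  heat_approx e K 0 f = E `[0, K%:R * e[%classic f.
Proof.
move=> e0 hf; rewrite /heat_approx.
have mJ n : measurable (`[0, n%:R * e[%classic : set R) by exact: measurable_itv.
elim: K => [|n IH].
  by rewrite big_ord0 mul0r set_itvco0 (pvm_set0 hE).
rewrite big_ord_recr/= IH.
have -> : `[0, n.+1%:R * e[%classic = `[0, n%:R * e[%classic `|` cell e n :> set R.
  apply/seteqP; split => x /=; rewrite !in_itv/=.
    move=> /andP[x0 xn]; have [h|h] := ltP x (n%:R * e).
      by left; rewrite x0.
    by right; rewrite /cell /= h.
  case=> /andP[x1 x2].
    by rewrite x1 (lt_trans x2)// ltr_pM2r// ltr_nat.
  by rewrite x2 (le_trans _ x1)// mulr_ge0// ltW.
rewrite (pvm_setU hE)//; last 2 first.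
- exact: measurable_cell.
- apply/seteqP; split => x //= [+ /andP[h' _]]; rewrite in_itv/= => /andP[_ h].
  by move: h; rewrite ltNge h'.
congr (_ + _); apply/funext => s.
by rewrite mulr0 expR0 cochainE mul1r.
Qed.

(** Bessel's inequality: at time 0 [heat_approx] is the projection of the union of the cells. *)
Lemma cell_norms e K f : 0 < e -> l2 f ->
  \sum_(k < K) norm2 (E (cell e k) f) ^+ 2 <= norm2 f ^+ 2.
Proof.
move=> e0 hf; have mc := measurable_cell e.
have mJ : measurable (`[0, K%:R * e[%classic : set R) by exact: measurable_itv.
have -> : \sum_(k < K) norm2 (E (cell e k) f) ^+ 2 = rip (E `[0, K%:R * e[%classic f) f.
  rewrite -heat_approx0// rip_suml//; last first.
    by move=> k _; apply: l2Z; exact: pvm_l2.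
  apply: eq_bigr => k _; have hk : l2 (E (cell e k) f) by exact: pvm_l2.
  by rewrite mulr0 expR0 ripZl// mul1r (pvm_norm hE).
rewrite (pvm_norm hE)// ler_pXn2r ?nnegrE ?norm2_ge0//.
exact: pvm_norm_le.
Qed.

Lemma rip_cells e j k f : 0 < e -> l2 f -> j != k ->
  rip (E (cell e j) f) (E (cell e k) f) = 0.
Proof.
move=> e0 hf jk; have mc := measurable_cell e.
rewrite (pvm_adj hE)//; last exact: pvm_l2.
by rewrite (pvm_disjoint hE) ?cell_disjoint// ripC rip0l.
Qed.

Lemma heat_approx_contraction e K t f : 0 < e -> 0 <= t -> l2 f ->
  norm2 (heat_approx e K t f) <= norm2 f.
Proof.
move=> e0 t0 hf; have mc := measurable_cell e.
have hk (k : 'I_K) : l2 (E (cell e k) f) by exact: pvm_l2.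
have hz (k : 'I_K) c : l2 (zscale c (E (cell e k) f)) by exact: l2Z.
rewrite -(@ler_pXn2r _ 2) ?nnegrE ?norm2_ge0//.
apply: le_trans (cell_norms K e0 hf).
rewrite norm2_sqrE {1}/heat_approx rip_suml//; last exact: heat_approx_l2.
apply: ler_sum => k _; rewrite /heat_approx rip_sumr//.
rewrite (bigD1 k)//= [X in _ + X]big1 ?addr0; last first.
  by move=> j jk; rewrite ripZl// ripZr// rip_cells ?mulr0// eq_sym.
rewrite ripZl// ripZr// -norm2_sqrE mulrA -[leRHS]mul1r.
rewrite ler_wpM2r ?sqr_ge0// -expr2 exprn_ile1// ?expR_ge0//.
by rewrite -expR0 ler_expR mulNr oppr_le0 !mulr_ge0// ltW.
Qed.

Lemma rmulZ phi (c : R[i]) f : rmul phi (zscale c f) = zscale c (rmul phi f).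
Proof. by apply/funext => s; rewrite !cochainE mulrCA. Qed.

Lemma rmul_sum (J : Type) (r : seq J) phi (F : J -> cochain X) :
  rmul phi (\sum_(i <- r) F i) = \sum_(i <- r) rmul phi (F i).
Proof.
by apply/funext => s; rewrite cochainE !cochain_sumE mulr_sumr.
Qed.

Lemma is_derive_sumseq (J : Type) (r : seq J) (F dF : J -> R -> R) (x : R) :
  (forall i, is_derive x 1 (F i) (dF i x)) ->
  is_derive x 1 (fun y => \sum_(i <- r) F i y) (\sum_(i <- r) dF i x).
Proof.
move=> hF; elim: r => [|i r IH].
  rewrite big_nil (_ : (fun y => _) = cst 0); last first.
    by apply/funext => y; rewrite big_nil.
  exact: is_derive_cst.
rewrite big_cons (_ : (fun y => _) = F i + (fun y => \sum_(i <- r) F i y)).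
  exact: is_deriveD.
by apply/funext => y; rewrite big_cons.
Qed.

(** Minus the time derivative of [heat_approx], and what [D] would give if it were exactly [k e] on
    the cell [k]. *)
Definition heat_generator (e : R) (K : nat) (t : R) (f : cochain X) : cochain X :=
  \sum_(k < K) zscale (k%:R * e * expR (- (k%:R * e) * t))%:C%C (E (cell e k) f).

(* [dl] is the weight in Young's inequality for the norms of the cell components. *)
Lemma op_heat_approx e K t dl f : 0 < e -> 0 <= t -> 0 < dl -> l2 f ->
  exists w, D (heat_approx e K t f) w /\
    norm2 (w - heat_generator e K t f) <= e * (K%:R * dl + norm2 f ^+ 2 / dl) / 2.
Proof.
move=> e0 t0 dl0 hf; have mc := measurable_cell e.
have hk k : l2 (E (cell e k) f) by exact: pvm_l2.
have Ik k x : cell e k x -> k%:R * e <= x <= k.+1%:R * e.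
  by move=> /andP[-> /ltW ->].
have ek k : E (cell e k) (E (cell e k) f) = E (cell e k) f by exact: (pvm_idem hE).
have ex k := op_domain hE hD (hk k) (mc k) (ek k) (Ik k).
have [q hq] := choice ex.
have hql k : l2 (q k) := (op_l2 (hq k)).2.
have mono k : k%:R * e <= k.+1%:R * e by rewrite ler_pM2r// ler_nat.
have err k := op_piece HL hE hD (mc k) (Ik k) (mono k) (hk k) (ek k) (hq k).
have {}err k : norm2 (q k - zscale (k%:R * e)%:C%C (E (cell e k) f)) <=
    e * norm2 (E (cell e k) f).
  apply: le_trans (err k) _; rewrite -mulrBl -natr1 addrAC subrr add0r mul1r.
  exact: lexx.
pose c k := expR (- (k%:R * e) * t).
have c1 k : c k <= 1.
  by rewrite -expR0 ler_expR mulNr oppr_le0 !mulr_ge0// ltW.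
exists (\sum_(k < K) zscale (c k)%:C%C (q k)); split.
  rewrite /heat_approx; elim: (K) => [|n IH].
    by rewrite !big_ord0; have := op_0 hD (hq 0%N).
  rewrite !big_ord_recr/=; apply: (op_add hD IH); exact: (op_scale hD).
have hd k : l2 (q k - zscale (k%:R * e)%:C%C (E (cell e k) f)).
  by apply: l2B => //; exact: l2Z.
have -> : \sum_(k < K) zscale (c k)%:C%C (q k) - heat_generator e K t f =
    \sum_(k < K) zscale (c k)%:C%C (q k - zscale (k%:R * e)%:C%C (E (cell e k) f)).
  rewrite /heat_generator -sumrB; apply: eq_bigr => k _; apply/funext => s.
  by rewrite !cochainE rmorphM/= -/(c k); ring.
apply: (@le_trans _ _ (\sum_(k < K) e * norm2 (E (cell e k) f))).
  elim: (K) => [|n IH]; first by rewrite !big_ord0 norm2_0.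
  rewrite !big_ord_recr/=.
  apply: le_trans (norm2_triangle (l2_sum _ _) (l2Z _ (hd n))) _.
    by move=> k _; exact: l2Z.
  apply: lerD => //; rewrite norm2Z// ger0_norm ?expR_ge0//.
  by rewrite (le_trans _ (err n))// ler_piMl ?norm2_ge0.
rewrite -mulr_sumr -mulrA; apply: ler_wpM2l; first exact: ltW.
apply: (@le_trans _ _ (\sum_(k < K) (dl + norm2 (E (cell e k) f) ^+ 2 / dl) / 2)).
  apply: ler_sum => k _; set x := norm2 _.
  have : 0 <= (dl - x) ^+ 2 / dl by rewrite divr_ge0 ?sqr_ge0// ltW.
  have -> : (dl - x) ^+ 2 / dl = dl - 2 * x + x ^+ 2 / dl by field; rewrite gt_eqF.
  by rewrite ler_pdivlMr//; lra.
rewrite -mulr_suml big_split/= sumr_const card_ord -mulr_suml.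
rewrite ler_pM2r ?invr_gt0// -[dl *+ K]mulr_natl lerD2l.
rewrite ler_pM2r ?invr_gt0//; exact: cell_norms.
Qed.

(** Let [u_x] be the approximation at time [x] and [v_x] its [heat_generator]. The derivative of
    [expR (2 * beta * x) * ||phi u_x||^2] is [2 * expR (2 * beta * x) * (beta * ||phi u_x||^2 -
    <v_x, phi^2 u_x>)]. Replacing [v_x] by the value of [D] at [u_x] makes it nonpositive, up to the
    error of [op_heat_approx]. *)
Lemma heat_approx_evolution (phi : simplex X -> R) (c beta e dl t : R) (K : nat) f :
  0 < e -> 0 < dl -> 0 <= t -> 0 <= c -> l2 f -> (forall x, `|phi x| <= c) ->
  (forall v w, D v w ->
     beta * rip (rmul phi v) (rmul phi v) <= rip w (rmul phi (rmul phi v))) ->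
  expR (2 * beta * t) * norm2 (rmul phi (heat_approx e K t f)) ^+ 2 <=
  norm2 (rmul phi (heat_approx e K 0 f)) ^+ 2 +
  t * (expR (2 * `|beta| * t) * c ^+ 2 * norm2 f *
    (e * (K%:R * dl + norm2 f ^+ 2 / dl))).
Proof.
move=> e0 dl0 t0 c0 hf phic lower; have mc := measurable_cell e.
have hk k : l2 (E (cell e k) f) by exact: pvm_l2.
pose F k := rmul phi (E (cell e k) f).
have hF k : l2 (F k) by exact: l2_rmul phic (hk k).
pose a k := k%:R * e.
pose G (j k : 'I_K) := rip (F j) (F k).
pose N (x : R) : R := \sum_(j < K) \sum_(k < K) G j k * expR ((2 * beta - (a j + a k)) * x).
pose dN (x : R) : R := \sum_(j < K) \sum_(k < K)
  G j k * ((2 * beta - (a j + a k)) * expR ((2 * beta - (a j + a k)) * x)).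
have derN (x : R) : is_derive x (1 : R) N (dN x).
  apply: (@is_derive_sumseq _ (index_enum 'I_K)
    (fun j y => \sum_(k < K) G j k * expR ((2 * beta - (a j + a k)) * y))
    (fun j y => \sum_(k < K)
       G j k * ((2 * beta - (a j + a k)) * expR ((2 * beta - (a j + a k)) * y)))) => j.
  apply: (@is_derive_sumseq _ (index_enum 'I_K)
    (fun k y => G j k * expR ((2 * beta - (a j + a k)) * y))
    (fun k y => G j k * ((2 * beta - (a j + a k)) *
       expR ((2 * beta - (a j + a k)) * y)))) => k.
  exact: (is_deriveZ (G j k) (is_derive_expR_lin _ _)).
have hexp (C : 'I_K -> R) (C' : 'I_K -> R) :
    rip (rmul phi (\sum_(k < K) zscale (C k)%:C%C (E (cell e k) f)))
        (rmul phi (\sum_(k < K) zscale (C' k)%:C%C (E (cell e k) f))) =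
    \sum_(j < K) \sum_(k < K) C j * C' k * G j k.
  have hz (b : R) k : l2 (zscale b%:C%C (F k)) by exact: l2Z.
  rewrite !rmul_sum.
  under eq_bigr do rewrite rmulZ -/(F _).
  under [X in rip _ X]eq_bigr do rewrite rmulZ -/(F _).
  rewrite rip_suml//; last by apply: l2_sum => k _; exact: hz.
  apply: eq_bigr => j _; rewrite rip_sumr//; apply: eq_bigr => k _.
  by rewrite ripZl// ripZr// mulrA.
have NE x : N x = expR (2 * beta * x) * norm2 (rmul phi (heat_approx e K x f)) ^+ 2.
  rewrite norm2_sqrE hexp /N mulr_sumr; apply: eq_bigr => j _.
  rewrite mulr_sumr; apply: eq_bigr => k _.
  rewrite -expRD mulrA -expRD mulrC; congr (expR _ * _).
  by rewrite /a; ring.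
have GC j k : G j k = G k j by exact: ripC.
have dNE x : dN x = expR (2 * beta * x) *
   (2 * beta * norm2 (rmul phi (heat_approx e K x f)) ^+ 2 -
    2 * rip (rmul phi (heat_generator e K x f)) (rmul phi (heat_approx e K x f))).
  rewrite norm2_sqrE !hexp.
  set S1 := \sum_(j < K) _; set S2 := \sum_(j < K) _.
  (* The generator puts the factor [a j] on one index only; symmetry of the Gram matrix [G] produces
     the [a j + a k] of the derivative. *)
  have S2E : 2 * S2 = \sum_(j < K) \sum_(k < K) (a j + a k) *
      (expR (- (j%:R * e) * x) * expR (- (k%:R * e) * x) * G j k).
    rewrite mulr2n mulrDl mul1r {2}/S2 exchange_big/= -big_split/=.
    apply: eq_bigr => j _; rewrite -big_split/=; apply: eq_bigr => k _.
    by rewrite (GC k j) /a; ring.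
  rewrite S2E /S1 mulr_sumr -sumrB mulr_sumr; apply: eq_bigr => j _.
  rewrite mulr_sumr -sumrB mulr_sumr; apply: eq_bigr => k _.
  have -> : expR ((2 * beta - (a j + a k)) * x) =
     expR (2 * beta * x) * (expR (- (j%:R * e) * x) * expR (- (k%:R * e) * x)).
    by rewrite -!expRD; congr expR; rewrite /a; ring.
  by ring.
set Err := e * (K%:R * dl + norm2 f ^+ 2 / dl).
have Err0 : 0 <= Err.
  apply: mulr_ge0 (ltW e0) _; apply: addr_ge0; first by rewrite mulr_ge0// ltW.
  by rewrite divr_ge0 ?sqr_ge0// ltW.
(* The absolute value of [beta] makes the exponential bounded on [[0, t]] whatever the sign of
   [beta]. *)
pose B := expR (2 * `|beta| * t) * c ^+ 2 * norm2 f * Err.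
have bound x : 0 <= x <= t -> dN x <= B.
  move=> /andP[x0 xt]; rewrite dNE.
  have [w [Dw werr]] := op_heat_approx K e0 x0 dl0 hf.
  set u := heat_approx e K x f in Dw *; set gu := heat_generator e K x f in werr *.
  have hu : l2 u by exact: heat_approx_l2.
  have hw : l2 w := (op_l2 Dw).2.
  have hgu : l2 gu by apply: l2_sum => k _; exact: l2Z.
  have hpu : l2 (rmul phi u) by exact: l2_rmul phic hu.
  have hppu : l2 (rmul phi (rmul phi u)) by exact: l2_rmul phic hpu.
  have := lower _ _ Dw.
  have -> : rip (rmul phi gu) (rmul phi u) = rip gu (rmul phi (rmul phi u)).
    by rewrite rip_rmul.
  have hwg : l2 (w - gu) by exact: l2B.
  have := rip_CSr hwg hppu; rewrite ripBl//.
  have pu : norm2 (rmul phi (rmul phi u)) <= c ^+ 2 * norm2 f.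
    apply: le_trans (norm2_rmul c0 phic hpu) _; rewrite expr2 -mulrA.
    apply: ler_wpM2l => //; apply: le_trans (norm2_rmul c0 phic hu) _.
    by apply: ler_wpM2l => //; exact: heat_approx_contraction.
  have prod : norm2 (w - gu) * norm2 (rmul phi (rmul phi u)) <=
      Err / 2 * (c ^+ 2 * norm2 f).
    by apply: ler_pM => //; exact: norm2_ge0.
  rewrite -norm2_sqrE => h1 h2.
  apply: (@le_trans _ _ (expR (2 * beta * x) * (c ^+ 2 * norm2 f * Err))).
    rewrite ler_pM2l ?expR_gt0//; lra.
  have -> : B = expR (2 * `|beta| * t) * (c ^+ 2 * norm2 f * Err) by rewrite /B; ring.
  apply: ler_wpM2r.
    by apply: mulr_ge0 => //; rewrite mulr_ge0 ?sqr_ge0 ?norm2_ge0.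
  rewrite ler_expR.
  have b1 : beta <= `|beta| := ler_norm _.
  have b2 : 0 <= `|beta| by exact: normr_ge0.
  nra.
have := is_derive_bound t0 derN bound.
rewrite !NE mulr0 expR0 mul1r subr0 lerBlDr addrC [B * t]mulrC.
by rewrite /B.
Qed.

End HeatApproximation.

(** * Passage to the semigroup *)

Section HeatBound.
Context {V : countType} {R : realType} {X : weighted_complex V R}.
Implicit Types (f g h : cochain X).
Variable L : cochain X -> cochain X.
Hypothesis HL : form_operator L.
Variable E : set R -> cochain X -> cochain X.
Hypothesis hE : projection_valued_measure E.
Let D := associated_operator (lform L).
Hypothesis hD : spectral_integral E (fun x => x) D.
Variables (t : R) (S : cochain X -> cochain X).
Hypothesis t0 : 0 < t.
Hypothesis hS : spectral_integral E (fun x => expR (- t * x)) (bounded_operator S).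

Lemma semigroup_linear (c : R[i]) f g : l2 f -> l2 g ->
  S (zscale c f + g) = zscale c (S f) + S g.
Proof.
move=> hf hg; case: hS => h _ _.
by have [_] := h c f g (S f) (S g) (conj hf erefl) (conj hg erefl).
Qed.

Lemma semigroup_l2 f : l2 f -> l2 (S f).
Proof. by move=> hf; case: hS => _ _ h; have [] := h f (S f) (conj hf erefl). Qed.

Lemma semigroupD f g : l2 f -> l2 g -> S (f + g) = S f + S g.
Proof.
move=> hf hg; have z1 (h : cochain X) : zscale 1 h = h.
  by apply/funext => s; rewrite cochainE mul1r.
by have := semigroup_linear 1 hf hg; rewrite !z1.
Qed.

Lemma semigroup0 : S 0 = 0.
Proof.
have := semigroupD (l2_0 (X := X)) (l2_0 (X := X)).
by rewrite addr0 => /eqP; rewrite -subr_eq subrr => /eqP.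
Qed.

Lemma semigroupZ (c : R[i]) f : l2 f -> S (zscale c f) = zscale c (S f).
Proof.
move=> hf; have := semigroup_linear c hf (l2_0 (X := X)).
by rewrite semigroup0 !addr0.
Qed.

(* A complex-linear operator with real quadratic form is symmetric. *)
Lemma semigroup_sym f g : l2 f -> l2 g -> rip (S f) g = rip (S g) f.
Proof.
move=> hf hg.
have real h : l2 h -> rip (S h) (zscale 'i%C h) = 0.
  move=> hh; case: hS => _ _ k; have [_] := k h (S h) (conj hh erefl).
  by rewrite innerE => -[].
have anti a b : l2 a -> l2 b ->
    rip (S a) (zscale 'i%C b) + rip (S b) (zscale 'i%C a) = 0.
  move=> ha hb; have hia := l2Z 'i%C ha; have hib := l2Z 'i%C hb.
  have hSa := semigroup_l2 ha; have hSb := semigroup_l2 hb.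
  have := real _ (l2D ha hb).
  have -> : zscale 'i%C (a + b) = zscale 'i%C a + zscale 'i%C b.
    by apply/funext => s; rewrite !cochainE mulrDr.
  have hab := l2D hia hib.
  rewrite semigroupD// ripDl// (ripDr hia hib hSa) (ripDr hia hib hSb).
  by rewrite !real// add0r addr0.
have hif := l2Z 'i%C hf; have := anti _ _ hif hg.
rewrite semigroupZ// rip_zscaleJ.
have -> : zscale ('i^*)%C (zscale 'i%C g) = g.
  by apply/funext => s; apply: cplx_eq; rewrite !cochainE !reimE /=; ring.
have -> : zscale 'i%C (zscale 'i%C f) = - f.
  by apply/funext => s; apply: cplx_eq; rewrite !cochainE !reimE /=; ring.
by rewrite ripNr => /eqP; rewrite subr_eq0 => /eqP.
Qed.

Lemma polarization (P : cochain X -> cochain X) f g : l2 f -> l2 g ->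
  (forall h, l2 h -> l2 (P h)) -> P (f + g) = P f + P g -> P (f - g) = P f - P g ->
  rip (P f) g = rip (P g) f ->
  4 * rip (P f) g = rip (P (f + g)) (f + g) - rip (P (f - g)) (f - g).
Proof.
move=> hf hg hP PD PB sym; have hPf := hP _ hf; have hPg := hP _ hg.
have hfg := l2D hf hg; have hfg' := l2B hf hg.
rewrite PD PB (ripDl hPf hPg hfg) (ripBl hPf hPg hfg').
rewrite (ripDr hf hg hPf) (ripDr hf hg hPg) (ripBr hf hg hPf) (ripBr hf hg hPg).
by rewrite sym; ring.
Qed.

(* With [N = n + 1], mesh [N^-3], [N^4] cells and Young weight [N^-2], the cells
   reach up to [N] and the error is of order [1 / N]. *)
Let mesh (n : nat) : R := n.+1%:R ^- 3.
Let level (n : nat) : nat := (n.+1 ^ 4)%N.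
Let approx n f := heat_approx E (mesh n) (level n) t f.

Lemma mesh_gt0 n : 0 < mesh n.
Proof. by rewrite invr_gt0 exprn_gt0. Qed.

Lemma mesh_level n : (level n)%:R * mesh n = n.+1%:R.
Proof.
rewrite /level /mesh natrX; set N : R := n.+1%:R.
have N0 : N != 0 by rewrite pnatr_eq0.
by field.
Qed.

Lemma approx_l2 n f : l2 f -> l2 (approx n f).
Proof. exact: heat_approx_l2. Qed.

Lemma approx_linear n (c : R[i]) f g : l2 f -> l2 g ->
  approx n (zscale c f + g) = zscale c (approx n f) + approx n g.
Proof.
move=> hf hg; apply/funext => s; rewrite /approx /heat_approx !cochainE !cochain_sumE.
rewrite mulr_sumr -big_split.
apply: eq_bigr => k _; have mk := measurable_cell (mesh n) k.
by rewrite (pvm_linear hE _ mk)// !cochainE /=; ring.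
Qed.

Lemma approx_sym n f g : l2 f -> l2 g -> rip (approx n f) g = rip (approx n g) f.
Proof.
move=> hf hg; have mk k := measurable_cell (mesh n) k.
have hk h (k : nat) : l2 h -> l2 (E (cell (mesh n) k) h) by move=> *; exact: pvm_l2.
have hz h (k : 'I_(level n)) c : l2 h -> l2 (zscale c (E (cell (mesh n) k) h)).
  by move=> hh; apply: l2Z; exact: hk.
rewrite /approx /heat_approx !rip_suml//; try by move=> k _; exact: hz.
apply: eq_bigr => k _; rewrite !ripZl//; try exact: hk.
by rewrite (pvm_adj hE)// ripC.
Qed.

(** Both quadratic forms are read off from the spectral measure of [h]: an integral for [S], its
    left-endpoint sum for [approx]. *)
Lemma approx_diag n h : l2 h ->
  rip (S h) h - expR (- t * n.+1%:R) * rip h h <= rip (approx n h) h <=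
  expR (t * mesh n) * rip (S h) h.
Proof.
move=> hh; have [m [hm hi]] := spectral_measureP hE hh.
have fm : (m setT < +oo)%E by rewrite hm ?ltry.
have mneg : measurable (`]-oo, 0[%classic : set R) by exact: measurable_itv.
have null : m `]-oo, 0[%classic = 0.
  by rewrite hm// (op_nonneg HL hE hD hh) norm2_0 expr0n.
have /= := laplace_bounds (level n) (ltW t0) (mesh_gt0 n) fm null.
have -> : fine (\int[m]_(x in setT) (expR (- t * x))%:E) = rip (S h) h.
  rewrite -(hi (fun x => (expR (- t * x))%:E)); case: hS => _ _ k.
  by have [_ e] := k h (S h) (conj hh erefl); rewrite /rip e.
have -> : \sum_(k < level n) expR (- t * (k%:R * mesh n)) *
    fine (m [set x | k%:R * mesh n <= x < k.+1%:R * mesh n]) = rip (approx n h) h.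
  have mk k := measurable_cell (mesh n) k.
  have hk (k : nat) : l2 (E (cell (mesh n) k) h) by exact: pvm_l2.
  rewrite /approx /heat_approx rip_suml//; last by move=> k _; exact: l2Z.
  apply: eq_bigr => k _; rewrite ripZl// (pvm_norm hE)// -/(cell _ _) hm//=.
  by congr (expR _ * _); ring.
rewrite mesh_level (hm _ measurableT) (pvmT hE hh) /= norm2_sqrE => -[h1 h2].
apply/andP; split; first by lra.
rewrite -(ler_pM2l (expR_gt0 (- t * mesh n))) mulrA -expRD mulNr addNr expR0 mul1r.
by rewrite -mulNr.
Qed.

Lemma harmonic_cvg0 : (fun n : nat => n.+1%:R^-1 : R) @ \oo --> (0 : R).
Proof. exact: cvg_harmonic. Qed.

Lemma expR_decay_cvg0 : (fun n : nat => expR (- t * n.+1%:R)) @ \oo --> (0 : R).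
Proof.
apply: (@cvg0_squeeze _ _ (fun n => t^-1 * n.+1%:R^-1)).
  near=> n; rewrite ger0_norm ?expR_ge0// mulNr expRN -invfM.
  have tn : 0 < t * n.+1%:R by rewrite mulr_gt0.
  rewrite lef_pV2 ?posrE ?expR_gt0//.
  by apply: le_trans (expR_ge1Dx _); rewrite lerDr.
by rewrite -[X in _ --> X](mulr0 t^-1); apply: cvgMl_tmp; exact: harmonic_cvg0.
Unshelve. all: by end_near.
Qed.

Lemma mesh_le n : mesh n <= n.+1%:R^-1.
Proof.
rewrite /mesh lef_pV2 ?posrE ?exprn_gt0//.
by rewrite -[leLHS]expr1; apply: ler_weXn2l; rewrite // ler1n.
Qed.

Lemma approx_diag_cvg h : l2 h -> (fun n => rip (approx n h) h) @ \oo --> rip (S h) h.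
Proof.
move=> hh; have mesh0 : mesh @ \oo --> (0 : R).
  apply: (@cvg0_squeeze _ _ (fun n => n.+1%:R^-1)); last exact: harmonic_cvg0.
  by near=> n; rewrite ger0_norm ?mesh_le// ltW// mesh_gt0.
have lo : (fun n => rip (S h) h - expR (- t * n.+1%:R) * rip h h) @ \oo --> rip (S h) h.
  rewrite -[X in _ --> X]subr0; apply: cvgB; first exact: cvg_cst.
  by rewrite -[X in _ --> X](mul0r (rip h h)); apply: cvgMr_tmp; exact: expR_decay_cvg0.
have up : (fun n => expR (t * mesh n) * rip (S h) h) @ \oo --> rip (S h) h.
  rewrite -[X in _ --> X]mul1r; apply: cvgMr_tmp; rewrite -expR0 -(mulr0 t).
  apply: continuous_cvg; first exact: continuous_expR.
  exact: cvgMl_tmp.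
by apply: squeeze_cvgr lo up; near=> n; exact: approx_diag.
Unshelve. all: by end_near.
Qed.

(** Spectral measures give convergence on the diagonal only; it extends by polarization because [S]
    and [approx n] are both symmetric. *)
Lemma approx_cvg f g : l2 f -> l2 g ->
  (fun n => rip (approx n f) g) @ \oo --> rip (S f) g.
Proof.
move=> hf hg; have hp := l2D hf hg; have hm := l2B hf hg.
have zN (k : cochain X) : - k = zscale (-1) k.
  by apply/funext => s; rewrite !cochainE mulN1r.
have z1 (k : cochain X) : zscale 1 k = k.
  by apply/funext => s; rewrite cochainE mul1r.
have pS : 4 * rip (S f) g = rip (S (f + g)) (f + g) - rip (S (f - g)) (f - g).
  apply: polarization => //; [exact: semigroup_l2|exact: semigroupD| |exact: semigroup_sym].
  by rewrite semigroupD; [rewrite !zN semigroupZ|exact: hf|exact: l2N].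
have pA n : 4 * rip (approx n f) g =
    rip (approx n (f + g)) (f + g) - rip (approx n (f - g)) (f - g).
  apply: polarization => //; [exact: approx_l2| | |exact: approx_sym].
    by have := approx_linear n 1 hf hg; rewrite !z1.
  rewrite [f - g]addrC [_ - approx n g]addrC !zN.
  exact: approx_linear.
have lim : (fun n => 4 * rip (approx n f) g) @ \oo --> 4 * rip (S f) g.
  rewrite pS (_ : (fun n => _) = (fun n => rip (approx n (f + g)) (f + g) -
    rip (approx n (f - g)) (f - g))); last by apply/funext.
  by apply: cvgB; exact: approx_diag_cvg.
have -> : (fun n => rip (approx n f) g) = (fun n => 4^-1 * (4 * rip (approx n f) g)).
  by apply/funext => n; rewrite mulrA mulVf// mul1r.
have -> : rip (S f) g = 4^-1 * (4 * rip (S f) g) by rewrite mulrA mulVf// mul1r.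
exact: cvgMl_tmp.
Qed.

Lemma approx_init_cvg f : l2 f ->
  l2cvg (fun n => heat_approx E (mesh n) (level n) 0 f) f.
Proof.
move=> hf; have [_ _ cut] := pvm_cutoff hE hf.
(* At time 0 the cells add up to the cutoff to [[0, n + 1)], which equals the symmetric cutoff
   because the negative half-line carries nothing. *)
have E0 n : heat_approx E (mesh n) (level n) 0 f = E `[- n.+1%:R, n.+1%:R[%classic f.
  rewrite (heat_approx0 hE)// ?mesh_gt0// mesh_level.
  have m1 : measurable (`[- n.+1%:R, 0[%classic : set R) by exact: measurable_itv.
  have m2 : measurable (`[0, n.+1%:R[%classic : set R) by exact: measurable_itv.
  have m3 : measurable (`]-oo, 0[%classic : set R) by exact: measurable_itv.
  have -> : (`[- n.+1%:R, n.+1%:R[%classic : set R) =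
      `[- n.+1%:R, 0[%classic `|` `[0, n.+1%:R[%classic.
    apply/seteqP; split => x /=; rewrite !in_itv/=.
      by move=> /andP[-> ->]; have [h|h] := ltP x 0; [left|right].
    by case=> /andP[x1 x2]; apply/andP; split => //;
      [apply: lt_trans x2 _|apply: le_trans x1; rewrite oppr_le0].
  rewrite (pvm_setU hE)//; last first.
    apply/seteqP; split => x //= []; rewrite !in_itv/= => /andP[_ h] /andP[h' _].
    by move: h; rewrite ltNge h'.
  have : E `[- n.+1%:R, 0[%classic (E `]-oo, 0[%classic f) = 0.
    by rewrite (op_nonneg HL hE hD hf) (pvm0 hE).
  rewrite (pvm_restrict hE)//.
  have -> : (`[- n.+1%:R, 0[%classic : set R) `&` `]-oo, 0[%classic = `[- n.+1%:R, 0[%classic.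
    by apply/setIidPl => x /=; rewrite !in_itv/= => /andP[].
  by move=> ->; rewrite add0r.
split => //; first by move=> n; exact: heat_approx_l2.
under eq_fun do rewrite E0.
by move: cut; rewrite -cvg_shiftS.
Qed.

(** The pairing is unchanged when [phi] is put on the evolving vector and its inverse [phi'] on [g].
    Cauchy-Schwarz is applied before the limit, since weak convergence concerns the pairing and not
    the weighted norms. *)
Lemma semigroup_weighted_bound (phi phi' : simplex X -> R) (c beta : R) f g :
  0 <= c -> (forall x, `|phi x| <= c) -> (forall x, `|phi' x| <= c) ->
  (forall x, phi x * phi' x = 1) ->
  (forall v w, D v w ->
     beta * rip (rmul phi v) (rmul phi v) <= rip w (rmul phi (rmul phi v))) ->
  l2 f -> l2 g ->
  rip (S f) g <= expR (- beta * t) * norm2 (rmul phi f) * norm2 (rmul phi' g).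
Proof.
move=> c0 phic phic' phiV lower hf hg.
have hpf : l2 (rmul phi f) by exact: l2_rmul phic hf.
have hpg : l2 (rmul phi' g) by exact: l2_rmul phic' hg.
(* The error constant of [heat_approx_evolution]: for this mesh, level and Young weight its last
   factor becomes [(1 + ||f||^2) / (n + 1)]. *)
pose C := t * (expR (2 * `|beta| * t) * c ^+ 2 * norm2 f * (1 + norm2 f ^+ 2)).
pose bnd n := expR (- (2 * beta * t)) *
  (norm2 (rmul phi (heat_approx E (mesh n) (level n) 0 f)) ^+ 2 + C * n.+1%:R^-1) *
  norm2 (rmul phi' g) ^+ 2.
have le n : rip (approx n f) g * rip (approx n f) g <= bnd n.
  have ha := approx_l2 n hf.
  have hpa : l2 (rmul phi (approx n f)) by exact: l2_rmul phic ha.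
  have -> : rip (approx n f) g = rip (rmul phi (approx n f)) (rmul phi' g).
    rewrite rip_rmul; congr rip; apply/funext => x.
    by rewrite !cochainE mulrA -rmorphM/= phiV mul1r.
  rewrite -expr2 /bnd.
  have dl0 : 0 < n.+1%:R ^- 2 :> R by rewrite invr_gt0 exprn_gt0.
  have := heat_approx_evolution HL hE hD (level n) (mesh_gt0 n) dl0 (ltW t0) c0 hf phic lower.
  have -> : mesh n * ((level n)%:R * n.+1%:R ^- 2 + norm2 f ^+ 2 / n.+1%:R ^- 2) =
      (1 + norm2 f ^+ 2) * n.+1%:R^-1.
    rewrite /level /mesh natrX; set N : R := n.+1%:R.
    have N0 : N != 0 by rewrite pnatr_eq0.
    by field.
  rewrite -/(approx n f) => ev.
  apply: (@le_trans _ _ (norm2 (rmul phi (approx n f)) ^+ 2 * norm2 (rmul phi' g) ^+ 2)).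
    rewrite -exprMn -[leLHS]real_normK ?num_real// ler_pXn2r ?nnegrE ?mulr_ge0 ?norm2_ge0//.
    exact: rip_CS.
  rewrite ler_wpM2r ?sqr_ge0//.
  rewrite -(ler_pM2l (expR_gt0 (2 * beta * t))) [leRHS]mulrA -expRD subrr expR0 mul1r.
  apply: le_trans ev _; rewrite lerD2l /C le_eqVlt; apply/orP; left; apply/eqP; ring.
have lim1 := approx_cvg hf hg.
have lim2 : (fun n => rip (approx n f) g * rip (approx n f) g) @ \oo -->
    rip (S f) g * rip (S f) g by exact: cvgM.
have lim3 := l2cvg_norm2 (l2cvg_rmul c0 phic (approx_init_cvg hf)).
have lim4 : bnd @ \oo --> expR (- (2 * beta * t)) *
    (norm2 (rmul phi f) ^+ 2 + C * 0) * norm2 (rmul phi' g) ^+ 2.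
  apply: cvgMr_tmp; apply: cvgMl_tmp; apply: cvgD; first by rewrite expr2; exact: cvgM.
  by apply: cvgMl_tmp; exact: harmonic_cvg0.
have sq : rip (S f) g * rip (S f) g <= expR (- (2 * beta * t)) *
    (norm2 (rmul phi f) ^+ 2 + C * 0) * norm2 (rmul phi' g) ^+ 2.
  by apply: (ler_cvg_to lim2 lim4); near=> n; exact: le.
apply: le_trans (ler_norm _) _.
rewrite -(@ler_pXn2r _ 2) ?nnegrE ?mulr_ge0 ?norm2_ge0 ?expR_ge0//.
rewrite real_normK ?num_real// expr2; apply: le_trans sq _.
have -> : expR (- (2 * beta * t)) = expR (- beta * t) ^+ 2.
  by rewrite expr2 -expRD; congr expR; ring.
by rewrite mulr0 addr0 !exprMn.
Unshelve. all: by end_near.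
Qed.

End HeatBound.

(** * The Davies-Gaffney estimate *)

Section DistanceWeight.
Context {V : countType} {R : realType} {X : weighted_complex V R}.
Variable d : simplex X -> simplex X -> R.
Hypothesis hd : pseudo_metric d.

Definition point_dist (A : set (simplex X)) (x : simplex X) : R :=
  inf [set r | exists2 a, A a & r = d a x].

Lemma point_dist_lb A x : has_lbound [set r | exists2 a, A a & r = d a x].
Proof. by exists 0 => _ [a _ ->]; case: hd => d0 _ _ _; exact: d0. Qed.

Lemma point_dist_le A a x : A a -> point_dist A x <= d a x.
Proof. by move=> Aa; apply: ge_inf; [exact: point_dist_lb|exists a]. Qed.

Lemma point_dist_ge0 A x : 0 <= point_dist A x.
Proof.
rewrite /point_dist; set D := [set r | _].
have [->|/set0P ne] := eqVneq D set0; first by rewrite inf0.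
by apply: lb_le_inf => // _ [a _ ->]; case: hd.
Qed.

Lemma point_dist_lip A x y : A !=set0 ->
  `|point_dist A x - point_dist A y| <= d x y.
Proof.
move=> [a0 Aa0]; case: (hd) => _ _ dC dT.
have half u v : point_dist A u - point_dist A v <= d u v.
  rewrite lerBlDr -lerBlDl; apply: lb_le_inf; first by exists (d a0 v), a0.
  move=> _ [a Aa ->]; rewrite lerBlDl.
  apply: le_trans (point_dist_le u Aa) _.
  by apply: le_trans (dT a v u) _; rewrite addrC (dC v).
by rewrite ler_norml half andbT lerNl opprB dC half.
Qed.

Lemma min_lip (u v c : R) : `|Num.min u c - Num.min v c| <= `|u - v|.
Proof.
have := ler_norm (u - v); have := ler_norm (v - u); rewrite (distrC v u).
have := normr_ge0 (u - v).
rewrite ler_norml.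
by case: (leP u c) => h1; case: (leP v c) => h2 *; apply/andP; split; lra.
Qed.

End DistanceWeight.

Section GaffneyBound.
Context {V : countType} {R : realType} {X : weighted_complex V R}.

Lemma supp_eq0 (f : cochain X) : supp f = set0 -> f = 0.
Proof.
move=> f0; apply/funext => s; apply: contrapT => /eqP fs.
by have : supp f s := fs; rewrite f0.
Qed.

Lemma davies_gaffney (L : cochain X -> cochain X) (d : simplex X -> simplex X -> R)
    (s t : R) (S : cochain X -> cochain X) (E : set R -> cochain X -> cochain X)
    (f g : cochain X) :
  form_operator L -> intrinsic_metric (edge_weight (lform L)) d -> 0 < s ->
  (forall x y, 0 < edge_weight (lform L) x y -> d x y <= s) ->
  projection_valued_measure E ->
  spectral_integral E (fun x => x) (associated_operator (lform L)) -> 0 < t ->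
  spectral_integral E (fun x => expR (- t * x)) (bounded_operator S) ->
  l2 f -> l2 g ->
  Normc.normc (inner (S f) g) <=
    expR (- spectrum_inf (associated_operator (lform L)) * t
          - t / s ^+ 2 * zeta (s * set_dist d (supp f) (supp g) / t))
    * norm2 f * norm2 g.
Proof.
move=> HL hd s0 hs hE hD t0 hS hf hg.
set lam := spectrum_inf _.
(* For an empty support [set_dist] is the default infimum 0, but then the cochain is zero and both
   sides vanish. *)
have [fe|/set0P fne] := eqVneq (supp f) set0.
  rewrite (supp_eq0 fe) (semigroup0 hS) norm2_0 mulr0 mul0r.
  by rewrite innerE !rip0l Normc.normc0.
have [ge|/set0P gne] := eqVneq (supp g) set0.
  rewrite (supp_eq0 ge) norm2_0 mulr0 innerC innerE !rip0l conjc0.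
  by rewrite Normc.normc0.
have hpd := hd.1; case: (hpd) => dge0 d00 dC dT.
set D0 := set_dist _ _ _.
have lbD : has_lbound [set x | exists a b, [/\ supp f a, supp g b & x = d a b]].
  by exists 0 => _ [a [b [_ _ ->]]].
have D00 : 0 <= D0.
  case: fne gne => a fa [b gb]; apply: lb_le_inf; first by exists (d a b), a, b.
  by move=> _ [a' [b' [_ _ ->]]].
have [k0 kE] := arcsinh_zeta s0 t0 D00; set k := arcsinh _ / s in k0 kE.
(* Truncation makes [exp psi] and its inverse bounded, as required for acting on [l2] and on the
   form domain. The value [k * D0] is still reached on [supp g], which is at distance at least [D0]
   from [supp f]. *)
pose psi x := k * Num.min (point_dist d (supp f) x) D0.
have psi0 x : 0 <= psi x.
  by rewrite mulr_ge0// le_min D00 point_dist_ge0.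
have psiM x : `|psi x| <= k * D0.
  by rewrite ger0_norm//; apply: ler_wpM2l => //; rewrite ge_min lexx orbT.
have psil x y : `|psi x - psi y| <= k * d x y.
  rewrite -mulrBr normrM ger0_norm// ler_wpM2l//.
  by apply: le_trans (min_lip _ _ _) _; exact: point_dist_lip.
have psif x : supp f x -> psi x = 0.
  move=> fx; rewrite /psi.
  have -> : point_dist d (supp f) x = 0.
    by apply/le_anti; rewrite point_dist_ge0// andbT -(d00 x) point_dist_le.
  by rewrite min_l// mulr0.
have psig x : supp g x -> psi x = k * D0.
  move=> gx; rewrite /psi min_r//.
  case: (fne) => a fa; apply: lb_le_inf; first by exists (d a x), a.
  move=> _ [b fb ->]; apply: ge_inf => //; exists b, x; split => //.
have [c [c1 ->]] := rip_inner_rot (S f) g.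
have hSf := semigroup_l2 hS hf.
rewrite -inner_zscale// -/(rip _ _) rip_zscaleJ.
set g' := zscale _ g; have hg' : l2 g' by exact: l2Z.
have ng' : norm2 g' <= norm2 g.
  rewrite -[leRHS]mul1r; apply: norm2_le => // x.
  rewrite Normc.normcM; have -> : Normc.normc (c^*)%C = Normc.normc c.
    by case: (c) => p q /=; rewrite sqrrN.
  by rewrite c1.
pose phi x := expR (psi x); pose phi' x := expR (- psi x).
have phib x : `|phi x| <= expR (k * D0).
  by rewrite ger0_norm ?expR_ge0// ler_expR; apply: le_trans (ler_norm _) (psiM x).
have phib' x : `|phi' x| <= expR (k * D0).
  rewrite ger0_norm ?expR_ge0// ler_expR; apply: le_trans (psiM x).
  by rewrite -normrN ler_norm.
have phiV x : phi x * phi' x = 1 by rewrite -expRD subrr expR0.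
have lower v w (Dvw : associated_operator (lform L) v w) :=
  operator_exp_lower HL hd s0 hs k0 psil psiM (spectrum_inf_le HL) Dvw.
have := semigroup_weighted_bound HL hE hD t0 hS (expR_ge0 _) phib phib' phiV lower hf hg'.
have -> : rmul phi f = f.
  apply/funext => x; rewrite cochainE /phi.
  have [->|fx] := eqVneq (f x) 0; first by rewrite mulr0.
  by rewrite psif// expR0 mul1r.
have -> : rmul phi' g' = zscale (expR (- (k * D0)))%:C%C g'.
  apply/funext => x; rewrite !cochainE /phi'.
  have [g0|gx] := eqVneq (g x) 0; first by rewrite /g' zscaleE g0 !mulr0.
  by rewrite psig.
rewrite norm2Z// ger0_norm ?expR_ge0// => /le_trans; apply.
rewrite mulrA; apply: ler_pM; rewrite ?norm2_ge0 ?mulr_ge0 ?norm2_ge0 ?expR_ge0//.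
rewrite mulrAC -expRD; apply: ler_wpM2r; first exact: norm2_ge0.
rewrite ler_expR -kE le_eqVlt; apply/orP; left; apply/eqP; rewrite -/lam; ring.
Qed.

Lemma supp_delta1 (x : simplex X) : supp (delta1 x) = [set x].
Proof.
apply/seteqP; split => y; rewrite /supp /delta1 /=.
  by case: (eqVneq y x) => // _; rewrite eqxx.
by move=> ->; rewrite eqxx oner_neq0.
Qed.

Lemma norm2_delta1 (x : simplex X) : norm2 (delta1 x) = Num.sqrt (mass x).
Proof.
rewrite norm2E /rip inner_delta1 /delta1 eqxx; congr Num.sqrt.
by rewrite conjc1 mulr1.
Qed.

End GaffneyBound.

Theorem theorem5p1 (V : countType) (R : realType) (X : weighted_complex V R)
    (hX : locally_summable X)
    (theta : simplex X -> simplex X -> R) (htheta : coboundary_signs theta)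
    (o : laplacian_kind)
    (d : simplex X -> simplex X -> R) (s : R)
    (hd : intrinsic_metric (edge_weight (energy theta o)) d)
    (hs : jump_size (edge_weight (energy theta o)) d = s%:E) (hs0 : 0 < s)
    (T : R -> cochain X -> cochain X)
    (hT : heat_semigroup (laplacian theta o) T) :
  (forall (t : R) (f g : cochain X), 0 < t -> l2 f -> l2 g ->
     Normc.normc (inner (T t f) g) <=
       expR (- spectrum_inf (laplacian theta o) * t
             - t / s ^+ 2 * zeta (s * set_dist d (supp f) (supp g) / t))
       * norm2 f * norm2 g) /\
  (forall (t : R) (x y : simplex X), 0 < t ->
     Normc.normc (heat_kernel T t x y) <=
       (mass x * mass y) `^ (- 2^-1) *
       expR (- spectrum_inf (laplacian theta o) * t
             - t / s ^+ 2 * zeta (s * d x y / t))).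
Proof.
have [L HL eL] := energy_form_operator hX htheta.1 o.
have jump x y : 0 < edge_weight (energy theta o) x y -> d x y <= s.
  by move=> bxy; rewrite -lee_fin -hs; apply: ereal_sup_ubound; exists x, y.
have [E [hE hD hTt]] := hT.
rewrite /laplacian !eL -/(lform L) in hd jump hD *.
have bound (t : R) (f g : cochain X) : 0 < t -> l2 f -> l2 g -> _ :=
  fun t0 hf hg => davies_gaffney HL hd hs0 jump hE hD t0 (hTt t t0) hf hg.
split => // t x y t0.
have lx : l2 (delta1 x) by exact/finitely_supported_l2/finitely_supported_delta1.
have ly : l2 (delta1 y) by exact/finitely_supported_l2/finitely_supported_delta1.
have := bound t _ _ t0 lx ly.
have -> : set_dist d (supp (delta1 x)) (supp (delta1 y)) = d x y.
  rewrite !supp_delta1 /set_dist (_ : [set _ | _] = [set d x y]) ?inf1//.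
  apply/seteqP; split => r /=; first by move=> [a [b [-> -> ->]]].
  by move=> ->; exists x, y.
rewrite !norm2_delta1 -mulrA -sqrtrM ?mass_ge0// => le.
have m0 : 0 < mass x * mass y by rewrite mulr_gt0 ?mass_gt0.
rewrite /heat_kernel Normc.normcM Normc.normcV normc_real gtr0_norm//.
rewrite powRN -powR12_sqrt ?(ltW m0)// in le *.
rewrite ler_pdivrMr//; apply: le_trans le _.
set q := (mass x * mass y) `^ 2^-1.
have q0 : 0 < q by rewrite powR_gt0.
have qq : mass x * mass y = q * q.
  by rewrite /q powR12_sqrt ?(ltW m0)// -expr2 sqr_sqrtr// ltW.
(* The masses contribute [q] to the numerator through the norms of the indicators and [q * q] to the
   denominator. *)
rewrite qq le_eqVlt; apply/orP; left; apply/eqP; field.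
by rewrite gt_eqF.
Qed.
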